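(* Let $\gamma\ge 1$ and fix $T'\ge 0$. Let $(h,u,v)\in C^1([0,T']\times\mathbb{R})$ be a classical solution of $$\partial_t h+h^2\partial_\xi u=0,\qquad \partial_t u+\partial_\xi\big(h^\gamma/\gamma\big)-v=0,\qquad \partial_t v+u=0,$$ with initial data $(h,u,v)(0,\xi)=(h_0,u_0,v_0)(\xi)$ satisfying $\inf_{\xi}h_0>0$ and $(h_0-1,u_0,v_0)\in C_0^1(\mathbb{R})$. If $$\inf_{\xi}\min_{1\le i\le 2} Z_i(T',\xi)\le -\sqrt{2\omega_0^\sharp},$$ then the solution must develop a singularity at some finite time $T^\sharp>T'$ in the following sense: on $[0,T^\sharp)$ the solution exists as a classical solution and $$\inf_{0\le t<T^\sharp,\ \xi\in\mathbb{R}} h(t,\xi)>0,\qquad \sup_{0\le t<T^\sharp,\ \xi\in\mathbb{R}}\max\{h(t,\xi),|u(t,\xi)|,|v(t,\xi)|\}<\infty,$$ $$\sup_{0\le t<T^\sharp,\ \xi\in\mathbb{R}}\max_{1\le j\le 2}Z_j(t,\xi)<\infty,\qquad \lim_{t\nearrow T^\sharp}\inf_{\xi\in\mathbb{R}}\min_{1\le j\le 2}Z_j(t,\xi)=-\infty.$$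
   Context: $C_0^1(\mathbb{R})$ denotes compactly supported $C^1$ functions. A classical solution is a $C^1$ solution with $h>0$. The weighted gradients of Riemann invariants are $Z_j=\sqrt{h}\,\big[\partial_\xi u+(-1)^j h^{\frac{\gamma-3}{2}}\partial_\xi h\big]$ for $j=1,2$. The initial potential vorticity is $\omega_0(\xi)=\frac{1}{h_0(\xi)}+v_0'(\xi)$, and $\omega_0^\sharp:=\sup_\xi \omega_0(\xi)$. *)

(* Defs.v *)
From Stdlib Require Import Reals Lra.
From Coquelicot Require Import Coquelicot.
Open Scope R_scope.

(** Partial time derivative of [f] at [(t,x)] equal to [d], taken within the
    time set [I] (one-sided at endpoints of an interval). *)
Definition is_pdt_within (I : R -> Prop) (f : R -> R -> R) (t x d : R) : Prop :=
  filterlim (fun s => (f s x - f t x) / (s - t))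
            (within (fun s => I s /\ s <> t) (locally t)) (locally d).

Definition is_pdx (f : R -> R -> R) (t x d : R) : Prop :=
  is_derive (fun y => f t y) x d.

Definition cont_on (I : R -> Prop) (f : R -> R -> R) : Prop :=
  forall t x, I t ->
    filterlim (fun p : R * R => f (fst p) (snd p))
              (within (fun p : R * R => I (fst p)) (locally (t, x)))
              (locally (f t x)).

Definition C1_on (I : R -> Prop) (f ft fx : R -> R -> R) : Prop :=
  (forall t x, I t -> is_pdt_within I f t x (ft t x) /\ is_pdx f t x (fx t x)) /\
  cont_on I f /\ cont_on I ft /\ cont_on I fx.

Definition classical_sol (gamma : R) (I : R -> Prop) (h u v : R -> R -> R) : Prop :=
  exists ht hx ut ux vt vx : R -> R -> R,
    C1_on I h ht hx /\ C1_on I u ut ux /\ C1_on I v vt vx /\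
    (forall t x, I t -> 0 < h t x) /\
    (forall t x, I t ->
       ht t x + (h t x) ^ 2 * ux t x = 0 /\
       ut t x + Derive (fun y => Rpower (h t y) gamma / gamma) x - v t x = 0 /\
       vt t x + u t x = 0).

(** Weighted gradients of Riemann invariants (j = 1, 2):
    Z_j = sqrt h [u_x + (-1)^j h^((gamma-3)/2) h_x]. *)
Definition Zj (gamma : R) (j : nat) (h u : R -> R -> R) (t x : R) : R :=
  sqrt (h t x) *
  (Derive (fun y => u t y) x
   + (-1) ^ j * Rpower (h t x) ((gamma - 3) / 2) * Derive (fun y => h t y) x).

Definition minZ (gamma : R) (h u : R -> R -> R) (t x : R) : R :=
  Rmin (Zj gamma 1 h u t x) (Zj gamma 2 h u t x).

Definition infZ (gamma : R) (h u : R -> R -> R) (t : R) : Rbar :=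
  Glb_Rbar (fun z => exists x, z = minZ gamma h u t x).

Definition C1_R (f : R -> R) : Prop :=
  forall x, ex_derive f x /\ continuous (Derive f) x.

Definition compact_support (f : R -> R) : Prop :=
  exists M, forall x, M < Rabs x -> f x = 0.

Definition omega0 (h0 v0 : R -> R) (x : R) : R := / h0 x + Derive v0 x.

Definition omega0_sharp (h0 v0 : R -> R) : R :=
  real (Lub_Rbar (fun z => exists x, z = omega0 h0 v0 x)).

(* Main.v *)
(** In terms of [phi' (h) = h ^ ((gamma - 3) / 2)] the Riemann invariants [u + phi h] and
    [u - phi h] are transported with the speeds [h ^ ((gamma + 1) / 2)] and
    [- h ^ ((gamma + 1) / 2)] and the source [v], while [v_t = - u]. An exponentially weighted
    maximum principle along characteristics gives finite propagation speed and bounds on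
    [h, u, v]. The potential vorticity [omega = 1 / h + v_x] does not depend on time, so
    [Z_j] satisfies along its characteristic, with [k] the other index,
    [Z_j' = sqrt h (- Z_j^2 / 2 - (gamma - 1) / 4 * Z_j (Z_j - Z_k) + omega - 1 / h)].
    At a positive maximum or a negative minimum over both families the mixed term has a sign.
    Hence the [Z_j] stay bounded above, [h ^ (-1/2)] grows at most linearly, and once the
    minimum is below [- sqrt (2 sup omega)] it decreases (strictly, because of [- 1 / h])
    and runs into a Riccati blow-up in finite time. The [Z_j] are only continuous; these
    arguments are applied to difference quotients of the Riemann invariants instead.

    As long as the minimum of the [Z_j] stays bounded, so do the C^1 norms, and the solution
    continues for a time depending only on these norms. This local existence theorem is a
    Picard iteration on the Riemann invariants together with their backward characteristics;
    the iterates are C^1, and their derivatives converge uniformly by fiber contraction. *)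
Require Import Defs.
From Stdlib Require Import Reals Lra Lia Classical IndefiniteDescription.
From Coquelicot Require Import Coquelicot.
Open Scope R_scope.

(** * Uniform continuity and iteration *)

(** The hypothesis allows equality with [- sqrt (2 * W)], [W = sup omega], and the difference
    quotients solve the Riccati equations only up to an error [eta]. One term absorbs both:
    [sqrt h * (- 1 / h) <= - 1 / sqrt Mh], where [Mh] bounds [h]. After a unit of time the minimum
    lies strictly below the threshold, so a fixed fraction [k] of the quadratic term survives
    against [W]. Since [sqrt h >= 1 / (p + q * t)], the comparison equation is
    [z' = - k * z^2 / (p + q * t)]; it blows up in finite time because the integral of
    [1 / (p + q * t)] diverges, which is why linear growth of [h ^ (-1/2)] is good enough.
    Uniqueness of solutions is never proved. The final solution is the union of a chain of
    extensions, each taking at least half of the longest possible step. If the minima of the [Z_j]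
    along the chain were bounded below, local existence would provide a uniform step length and
    carry the chain past the time bound. The decline of the minimum then turns mere unboundedness
    into a limit. *)

Definition clamp (a b x : R) : R := Rmax a (Rmin b x).

Lemma clamp_in a b x : a <= b -> a <= clamp a b x <= b.
Proof.
  intros H; unfold clamp, Rmax, Rmin; repeat destruct Rle_dec; lra.
Qed.

Lemma clamp_id a b x : a <= x <= b -> clamp a b x = x.
Proof.
  intros H; unfold clamp, Rmax, Rmin; repeat destruct Rle_dec; lra.
Qed.

Lemma clamp_lip a b x y : Rabs (clamp a b x - clamp a b y) <= Rabs (x - y).
Proof.
  unfold clamp, Rmax, Rmin; repeat destruct Rle_dec; unfold Rabs; repeat destruct Rcase_abs; lra.
Qed.

Lemma Rabs_le_iff x d : Rabs x <= d <-> - d <= x <= d.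
Proof. unfold Rabs; destruct Rcase_abs; lra. Qed.

Ltac abs_lra := repeat match goal with H : Rabs _ <= _ |- _ => apply Rabs_le_iff in H end;
  apply Rabs_le_iff; lra.

Ltac rmin_bounds a b := let Rl := fresh "Rl" in let Rr := fresh "Rr" in
  assert (Rl := Rmin_l a b); assert (Rr := Rmin_r a b).

Lemma ex_derive_cont (f : R -> R) x : ex_derive f x -> continuous f x.
Proof. apply (ex_derive_continuous (V := R_NormedModule)). Qed.

Lemma Rabs_mult_le x y a b : Rabs x <= a -> Rabs y <= b -> Rabs (x * y) <= a * b.
Proof.
  intros Hx Hy; rewrite Rabs_mult.
  apply Rmult_le_compat; auto using Rabs_pos.
Qed.

Lemma Rabs_mult_diff x y x' y' a b dx dy :
  Rabs x' <= a -> Rabs y <= b -> Rabs (x - x') <= dx -> Rabs (y - y') <= dy ->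
  Rabs (x * y - x' * y') <= a * dy + b * dx.
Proof.
  intros Hx Hy Hdx Hdy.
  replace (x * y - x' * y') with (x' * (y - y') + y * (x - x')) by ring.
  eapply Rle_trans; [apply Rabs_triang|].
  apply Rplus_le_compat; apply Rabs_mult_le; auto.
Qed.

(** Continuous induction on a compact interval: arguments that would speak of a first exit time
    become an open step and a closed step. *)
Lemma real_induction (a b : R) (P : R -> Prop) :
  P a ->
  (forall t, a <= t < b -> (forall s, a <= s <= t -> P s) ->
     exists d, 0 < d /\ forall s, t < s < t + d -> s <= b -> P s) ->
  (forall t, a < t <= b -> (forall s, a <= s < t -> P s) -> P t) ->
  forall t, a <= t <= b -> P t.
Proof.
  intros Ha Hstep Hlim t Ht.
  set (E := fun s => a <= s <= b /\ forall r, a <= r <= s -> P r).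
  destruct (completeness E) as [m [Hub Hlub]].
  { exists b; intros s [Hs _]; lra. }
  { exists a; split; [lra|]; intros r Hr; replace r with a by lra; auto. }
  assert (HEa : E a) by (split; [lra|]; intros r Hr; replace r with a by lra; auto).
  assert (Ham : a <= m) by (apply Hub; auto).
  assert (Hmb : m <= b) by (apply Hlub; intros s [Hs _]; lra).
  assert (Hbelow : forall s, a <= s < m -> P s).
  { intros s Hs.
    destruct (Classical_Prop.classic (exists r, E r /\ s < r)) as [[r [[Hr1 Hr2] Hr3]]|Hn].
    - apply Hr2; lra.
    - exfalso. assert (m <= s); [|lra].
      apply Hlub; intros r Hr. destruct (Rle_dec r s); auto.
      exfalso; apply Hn; exists r; split; auto; lra. }
  assert (Hm : P m).
  { destruct (Req_dec m a) as [->|]; auto. apply Hlim; [lra|auto]. }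
  assert (Hall : forall s, a <= s <= m -> P s).
  { intros s Hs; destruct (Req_dec s m) as [->|]; auto. apply Hbelow; lra. }
  destruct (Rlt_dec m b) as [Hlt|Hge].
  - exfalso. destruct (Hstep m (conj Ham Hlt) Hall) as [d [Hd HP]].
    set (m' := Rmin b (m + d / 2)).
    assert (m < m' <= b /\ m' < m + d) by (unfold m', Rmin; destruct Rle_dec; lra).
    assert (E m').
    { split; [lra|]. intros r Hr. destruct (Rle_dec r m); [apply Hall; lra|apply HP; lra]. }
    assert (m' <= m) by (apply Hub; auto). lra.
  - apply Hall; lra.
Qed.

Definition UC1 (f : R -> R) := forall e, 0 < e -> exists d, 0 < d /\
  forall x x', Rabs (x - x') <= d -> Rabs (f x - f x') <= e.
Definition UC2 (f : R -> R -> R) := forall e, 0 < e -> exists d, 0 < d /\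
  forall t t' x x', Rabs (t - t') <= d -> Rabs (x - x') <= d ->
  Rabs (f t x - f t' x') <= e.
Definition UC3 (f : R -> R -> R -> R) := forall e, 0 < e -> exists d, 0 < d /\
  forall s s' t t' x x', Rabs (s - s') <= d -> Rabs (t - t') <= d -> Rabs (x - x') <= d ->
  Rabs (f s t x - f s' t' x') <= e.

Lemma UC1_lip f C : (forall x y, Rabs (f x - f y) <= C * Rabs (x - y)) -> UC1 f.
Proof.
  intros H e He.
  assert (HC : 0 <= C).
  { generalize (H 1 0); rewrite Rminus_0_r, Rabs_R1, Rmult_1_r.
    generalize (Rabs_pos (f 1 - f 0)); lra. }
  exists (e / (C + 1)); split; [apply Rdiv_lt_0_compat; lra|].
  intros x x' Hx. eapply Rle_trans; [apply H|].
  eapply Rle_trans; [apply Rmult_le_compat_l; [lra|apply Hx]|].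
  apply Rmult_le_reg_r with (C + 1); [lra|]. field_simplify; [nra|lra].
Qed.

Lemma UC3_x : UC3 (fun s t x => x).
Proof. intros e He; exists e; split; auto. Qed.

Lemma UC3_const c : UC3 (fun s t x => c).
Proof. intros e He; exists e; split; auto. intros; rewrite Rminus_diag, Rabs_R0; lra. Qed.

Lemma UC2_const c : UC2 (fun t x => c).
Proof. intros e He; exists e; split; auto. intros; rewrite Rminus_diag, Rabs_R0; lra. Qed.

Lemma UC3_comp1 g f : UC1 g -> UC3 f -> UC3 (fun s t x => g (f s t x)).
Proof.
  intros Hg Hf e He. destruct (Hg e He) as [d1 [Hd1 H1]].
  destruct (Hf d1 Hd1) as [d [Hd H]]. exists d; split; auto.
Qed.

Lemma UC3_comp2 f y : UC2 f -> UC3 y -> UC3 (fun s t x => f s (y s t x)).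
Proof.
  intros Hg Hf e He. destruct (Hg e He) as [d1 [Hd1 H1]].
  destruct (Hf d1 Hd1) as [d [Hd H]]. exists (Rmin d d1); split.
  - apply Rmin_pos; auto.
  - intros. apply H1.
    + eapply Rle_trans; [eassumption|apply Rmin_r].
    + apply H; (eapply Rle_trans; [eassumption|apply Rmin_l]).
Qed.

Lemma UC3_plus f g : UC3 f -> UC3 g -> UC3 (fun s t x => f s t x + g s t x).
Proof.
  intros Hf Hg e He. destruct (Hf (e/2)) as [d1 [Hd1 H1]]; [lra|].
  destruct (Hg (e/2)) as [d2 [Hd2 H2]]; [lra|].
  exists (Rmin d1 d2); split; [apply Rmin_pos; auto|].
  intros s s' t t' x x' Hs Ht Hx.
  rmin_bounds d1 d2.
  specialize (H1 s s' t t' x x' ltac:(lra) ltac:(lra) ltac:(lra)).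
  specialize (H2 s s' t t' x x' ltac:(lra) ltac:(lra) ltac:(lra)).
  apply Rabs_le_iff in H1; abs_lra.
Qed.

Lemma UC3_scal c f : UC3 f -> UC3 (fun s t x => c * f s t x).
Proof.
  intros Hf. apply (UC3_comp1 (fun z => c * z)); auto.
  apply UC1_lip with (Rabs c). intros x y.
  rewrite <- Rmult_minus_distr_l, Rabs_mult; lra.
Qed.

Lemma UC3_minus f g : UC3 f -> UC3 g -> UC3 (fun s t x => f s t x - g s t x).
Proof.
  intros Hf Hg. generalize (UC3_plus _ _ Hf (UC3_scal (-1) _ Hg)).
  intros H e He; destruct (H e He) as [d [Hd H']]; exists d; split; auto.
  intros s s' t t' x x' A B C. specialize (H' s s' t t' x x' A B C).
  match type of H' with Rabs ?a <= _ => replace (Rabs _) with (Rabs a); auto; f_equal; ring end.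
Qed.

Lemma UC3_mult f g A B : (forall s t x, Rabs (f s t x) <= A) ->
  (forall s t x, Rabs (g s t x) <= B) -> UC3 f -> UC3 g ->
  UC3 (fun s t x => f s t x * g s t x).
Proof.
  intros HA HB Hf Hg e He.
  assert (A0 : 0 <= A) by (eapply Rle_trans; [apply Rabs_pos|apply (HA 0 0 0)]).
  assert (B0 : 0 <= B) by (eapply Rle_trans; [apply Rabs_pos|apply (HB 0 0 0)]).
  set (e' := e / (A + B + 1)).
  assert (He' : 0 < e') by (apply Rdiv_lt_0_compat; lra).
  destruct (Hf e' He') as [d1 [Hd1 H1]]. destruct (Hg e' He') as [d2 [Hd2 H2]].
  exists (Rmin d1 d2); split; [apply Rmin_pos; auto|].
  intros s s' t t' x x' Hs Ht Hx.
  rmin_bounds d1 d2.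
  eapply Rle_trans; [apply Rabs_mult_diff with (a := A) (b := B) (dx := e') (dy := e'); auto|].
  - apply H1; lra.
  - apply H2; lra.
  - assert (e' * (A + B + 1) = e) by (unfold e'; field; lra). nra.
Qed.

Lemma UC2_slice f s : UC3 f -> UC2 (f s).
Proof.
  intros H e He; destruct (H e He) as [d [Hd H']]; exists d; split; auto.
  intros; apply H'; auto. rewrite Rminus_diag, Rabs_R0; lra.
Qed.

Lemma UC3_cont f t x q : UC3 f -> continuous (fun q => f q t x) q.
Proof.
  intros H. apply continuity_pt_filterlim. intros e He.
  destruct (H (e / 2)) as [d [Hd H']]; [lra|].
  exists d; split; auto. intros y [_ Hy]. unfold dist in *; simpl in *; unfold R_dist in *.
  eapply Rle_lt_trans; [apply H'; try (rewrite Rminus_diag, Rabs_R0)|]; lra.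
Qed.

Lemma UC3_ex_RInt f t x a b : UC3 f -> ex_RInt (fun q => f q t x) a b.
Proof.
  intros H; apply (ex_RInt_continuous (V := R_CompleteNormedModule)).
  intros z _; apply UC3_cont; auto.
Qed.

Lemma RInt_le_bound f a b M : ex_RInt f a b -> (forall q, Rmin a b <= q <= Rmax a b -> Rabs (f q) <= M) ->
  Rabs (RInt f a b) <= Rabs (b - a) * M.
Proof.
  intros Hex H. destruct (Rle_dec a b) as [Hab|Hab].
  - rewrite (Rabs_right (b - a)) by lra. apply abs_RInt_le_const; auto.
    intros; apply H; rewrite Rmin_left, Rmax_right; auto.
  - assert (b <= a) by lra.
    rewrite <- (opp_RInt_swap (V := R_CompleteNormedModule)); [|apply ex_RInt_swap; auto].
    unfold opp; simpl. rewrite Rabs_Ropp, (Rabs_minus_sym b a), (Rabs_right (a - b)) by lra.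
    apply abs_RInt_le_const; auto.
    + apply ex_RInt_swap; auto.
    + intros; apply H; rewrite Rmin_right, Rmax_left; auto; lra.
Qed.

Lemma RInt_diff_bound f g a b M : ex_RInt f a b -> ex_RInt g a b ->
  (forall q, Rmin a b <= q <= Rmax a b -> Rabs (f q - g q) <= M) ->
  Rabs (RInt f a b - RInt g a b) <= Rabs (b - a) * M.
Proof.
  intros Hf Hg H.
  assert (E := RInt_minus (V := R_CompleteNormedModule) f g a b Hf Hg).
  unfold minus, plus, opp in E; simpl in E. unfold Rminus at 1. rewrite <- E.
  apply RInt_le_bound; [apply (ex_RInt_minus (V := R_NormedModule)); auto|].
  intros q Hq; apply (H q Hq).
Qed.

Lemma RInt_Chasles_R (f : R -> R) a b c : ex_RInt f a b -> ex_RInt f b c ->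
  RInt f a b + RInt f b c = RInt f a c.
Proof. intros; apply (RInt_Chasles (V := R_CompleteNormedModule)); auto. Qed.

(* Clamping the time variables makes all functions of the fixed point argument globally
   defined, so that it needs no domain conditions. *)
Definition cint (T : R) (F : R -> R -> R -> R) (s t x : R) : R :=
  RInt (fun q => F q t x) (clamp 0 T s) (clamp 0 T t).

Lemma clamp_dist T s t : 0 <= T -> Rabs (clamp 0 T t - clamp 0 T s) <= T.
Proof.
  intros H. generalize (clamp_in 0 T s H) (clamp_in 0 T t H); intros.
  apply Rabs_le_iff; lra.
Qed.

Lemma cint_bound T F B s t x : 0 <= T -> UC3 F -> (forall s t x, Rabs (F s t x) <= B) ->
  Rabs (cint T F s t x) <= T * B.
Proof.
  intros HT HF HB. unfold cint.
  assert (B0 : 0 <= B) by (eapply Rle_trans; [apply Rabs_pos|apply (HB 0 0 0)]).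
  eapply Rle_trans; [apply RInt_le_bound with (M := B); auto|].
  - apply UC3_ex_RInt; auto.
  - apply Rmult_le_compat_r; auto. apply clamp_dist; auto.
Qed.

Lemma cint_diff T F G B s t x : 0 <= T -> UC3 F -> UC3 G -> 
  (forall s t x, Rabs (F s t x - G s t x) <= B) ->
  Rabs (cint T F s t x - cint T G s t x) <= T * B.
Proof.
  intros HT HF HG HB. unfold cint.
  assert (B0 : 0 <= B) by (eapply Rle_trans; [apply Rabs_pos|apply (HB 0 0 0)]).
  eapply Rle_trans; [apply RInt_diff_bound with (M := B); auto|].
  - apply (UC3_ex_RInt F); auto.
  - apply (UC3_ex_RInt G); auto.
  - apply Rmult_le_compat_r; auto. apply clamp_dist; auto.
Qed.

Lemma cint_UC T F B : 0 <= T -> UC3 F -> (forall s t x, Rabs (F s t x) <= B) ->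
  UC3 (cint T F).
Proof.
  intros HT HF HB e He.
  assert (B0 : 0 <= B) by (eapply Rle_trans; [apply Rabs_pos|apply (HB 0 0 0)]).
  set (e' := e / (2 * B + T + 1)).
  assert (He' : 0 < e') by (apply Rdiv_lt_0_compat; lra).
  destruct (HF e' He') as [d [Hd H]].
  exists (Rmin d e'); split; [apply Rmin_pos; auto|].
  intros s s' t t' x x' Hs Ht Hx.
  assert (C1 := Rmin_l d e'). assert (C2 := Rmin_r d e'). unfold cint.
  set (a := clamp 0 T s) in *. set (a' := clamp 0 T s').
  set (b := clamp 0 T t). set (b' := clamp 0 T t').
  assert (Ha : Rabs (a - a') <= e') by (eapply Rle_trans; [apply clamp_lip|lra]).
  assert (Hb : Rabs (b - b') <= e') by (eapply Rle_trans; [apply clamp_lip|lra]).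
  assert (Hex : forall a b, ex_RInt (fun q => F q t x) a b) by (intros; apply UC3_ex_RInt; auto).
  assert (Hex' : forall a b, ex_RInt (fun q => F q t' x') a b) by (intros; apply UC3_ex_RInt; auto).
  rewrite <- (RInt_Chasles_R (fun q => F q t x) a a' b) by auto.
  rewrite <- (RInt_Chasles_R (fun q => F q t x) a' b' b) by auto.
  assert (I1 := RInt_le_bound (fun q => F q t x) a a' B (Hex _ _) (fun q _ => HB q t x)).
  assert (I2 := RInt_le_bound (fun q => F q t x) b' b B (Hex _ _) (fun q _ => HB q t x)).
  assert (I3 : Rabs (RInt (fun q => F q t x) a' b' - RInt (fun q => F q t' x') a' b') <= Rabs (b' - a') * e').
  { apply RInt_diff_bound; auto. intros q _. apply H; try (rewrite Rminus_diag, Rabs_R0); lra. }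
  assert (I4 := clamp_dist T s' t' HT). fold a' b' in I4.
  rewrite Rabs_minus_sym in Ha.
  assert (Rabs (a' - a) * B <= e' * B) by (apply Rmult_le_compat_r; auto).
  assert (Rabs (b - b') * B <= e' * B) by (apply Rmult_le_compat_r; auto).
  assert (Rabs (b' - a') * e' <= T * e') by (apply Rmult_le_compat_r; lra).
  assert (e' * (2 * B + T + 1) = e) by (unfold e'; field; lra).
  apply Rabs_le_iff in I1. apply Rabs_le_iff in I2. apply Rabs_le_iff in I3.
  apply Rabs_le_iff. nra.
Qed.

Lemma UC3_ext f g : (forall s t x, f s t x = g s t x) -> UC3 f -> UC3 g.
Proof.
  intros E H e He; destruct (H e He) as [d [Hd H']]; exists d; split; auto.
  intros; rewrite <- !E; auto.
Qed.

Lemma UC3_deriv_2d F x q t : UC3 F -> continuity_2d_pt (fun u v => F v t u) x q.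
Proof.
  intros H e. destruct (H (e / 2)) as [d [Hd H']]; [destruct e; simpl; lra|].
  exists (mkposreal d Hd). simpl. intros u v Hu Hv.
  eapply Rle_lt_trans; [apply H'|]; try (rewrite Rminus_diag, Rabs_R0; lra); try lra.
  destruct e; simpl; lra.
Qed.

Lemma cint_derive T F F' s t x : UC3 F -> UC3 F' ->
  (forall q t x, is_derive (fun z => F q t z) x (F' q t x)) ->
  is_derive (fun z => cint T F s t z) x (cint T F' s t x).
Proof.
  intros HF HF' HD. unfold cint.
  set (a := clamp 0 T s). set (b := clamp 0 T t).
  assert (E : RInt (fun q => F' q t x) a b = RInt (fun q => Derive (fun u => F q t u) x) a b).
  { apply RInt_ext. intros q _. symmetry. apply is_derive_unique, HD. }
  rewrite E.
  apply (is_derive_RInt_param (fun z q => F q t z)).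
  - exists (mkposreal 1 Rlt_0_1). intros y _ q _. exists (F' q t y); apply HD.
  - intros q _. apply continuity_2d_pt_ext with (fun u v => F' v t u).
    + intros u v. symmetry; apply is_derive_unique, HD.
    + apply UC3_deriv_2d; auto.
  - exists (mkposreal 1 Rlt_0_1). intros y _. apply UC3_ex_RInt; auto.
Qed.

Lemma MVT_lip f f' L x y : (forall z, is_derive f z (f' z)) -> (forall z, Rabs (f' z) <= L) ->
  Rabs (f x - f y) <= L * Rabs (x - y).
Proof.
  intros HD HL. destruct (MVT_gen f y x f') as [c [_ E]].
  - intros; apply HD.
  - intros z _. apply continuity_pt_filterlim.
    apply ex_derive_cont. exists (f' z); apply HD.
  - rewrite E, Rabs_mult. apply Rmult_le_compat_r; auto using Rabs_pos.
Qed.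

Lemma MVT_R f f' x y : (forall z, is_derive f z (f' z)) ->
  exists c, Rmin x y <= c <= Rmax x y /\ f y - f x = f' c * (y - x).
Proof.
  intros HD. apply MVT_gen.
  - intros; apply HD.
  - intros z _. apply continuity_pt_filterlim.
    apply ex_derive_cont. exists (f' z); apply HD.
Qed.

Lemma is_derive_eps (f : R -> R) x l : is_derive f x l <->
  (forall e, 0 < e -> exists d, 0 < d /\ forall y, Rabs (y - x) < d ->
     Rabs (f y - f x - l * (y - x)) <= e * Rabs (y - x)).
Proof.
  split.
  - intros H e He. apply is_derive_Reals in H. destruct (H e He) as [d Hd].
    exists d; split; [apply cond_pos|]. intros y Hy.
    destruct (Req_dec y x) as [->|Hn].
    + rewrite !Rminus_diag, Rmult_0_r, Rminus_0_r, Rabs_R0; lra.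
    + specialize (Hd (y - x) ltac:(lra) Hy). replace (x + (y - x)) with y in Hd by ring.
      replace (f y - f x - l * (y - x)) with (((f y - f x) / (y - x) - l) * (y - x)) by (field; lra).
      rewrite Rabs_mult. apply Rmult_le_compat_r; [apply Rabs_pos|lra].
  - intros H. apply is_derive_Reals. intros e He.
    destruct (H (e / 2)) as [d [Hd H']]; [lra|]. exists (mkposreal d Hd). simpl.
    intros k Hk Hkd. specialize (H' (x + k)). replace (x + k - x) with k in H' by ring.
    specialize (H' Hkd).
    replace ((f (x + k) - f x) / k - l) with ((f (x + k) - f x - l * k) / k) by (field; auto).
    unfold Rdiv. rewrite Rabs_mult, Rabs_inv.
    assert (0 < Rabs k) by (apply Rabs_pos_lt; auto).
    apply Rmult_lt_reg_r with (Rabs k); auto.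
    rewrite Rmult_assoc, Rinv_l by lra. nra.
Qed.

(** Pointwise convergence of the functions is enough: the mean value theorem turns increments of
    [fn n] into values of [gn n], and these converge uniformly. *)
Lemma derive_limit (fn gn : nat -> R -> R) f g :
  (forall n x, is_derive (fn n) x (gn n x)) ->
  (forall e x, 0 < e -> exists N, forall n, (N <= n)%nat -> Rabs (fn n x - f x) <= e) ->
  (forall e, 0 < e -> exists N, forall n, (N <= n)%nat -> forall x, Rabs (gn n x - g x) <= e) ->
  UC1 g -> forall x, is_derive f x (g x).
Proof.
  intros HD Hf Hg HU x. apply is_derive_eps. intros e He.
  destruct (HU (e / 2)) as [d [Hd H]]; [lra|].
  exists d; split; auto. intros y Hy.
  apply Rnot_lt_le; intros Hlt.
  assert (Hyx : y <> x).
  { intros ->. rewrite !Rminus_diag, Rmult_0_r, Rminus_0_r, Rabs_R0, Rmult_0_r in Hlt; lra. }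
  assert (Hp : 0 < Rabs (y - x)) by (apply Rabs_pos_lt; lra).
  (* If the estimate fails at [y], the excess [gap] is a fixed positive number, and two errors of
     [gap / 4] in the function values cannot make up for it. *)
  set (gap := Rabs (f y - f x - g x * (y - x)) - e * Rabs (y - x)).
  assert (0 < gap) by (unfold gap; lra).
  destruct (Hf (gap / 4) x) as [N1 HN1]; [lra|].
  destruct (Hf (gap / 4) y) as [N2 HN2]; [lra|].
  destruct (Hg (e / 2)) as [N3 HN3]; [lra|].
  set (n := (N1 + N2 + N3)%nat).
  specialize (HN1 n ltac:(unfold n; lia)). specialize (HN2 n ltac:(unfold n; lia)).
  specialize (HN3 n ltac:(unfold n; lia)).
  destruct (MVT_R (fn n) (gn n) x y (HD n)) as [c [Hc E]].
  assert (Hcx : Rabs (c - x) <= d).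
  { revert Hc Hy; unfold Rmin, Rmax, Rabs; repeat destruct Rle_dec; repeat destruct Rcase_abs; lra. }
  specialize (H c x Hcx). specialize (HN3 c).
  assert (K : Rabs (fn n y - fn n x - g x * (y - x)) <= e * Rabs (y - x)).
  { rewrite E, <- Rmult_minus_distr_r, Rabs_mult. apply Rmult_le_compat_r; [lra|].
    apply Rabs_le_iff in H; abs_lra. }
  assert (Rabs (f y - f x - g x * (y - x)) <= Rabs (fn n y - fn n x - g x * (y - x)) + gap / 2).
  { apply Rabs_le_iff in HN1; apply Rabs_le_iff in HN2.
    unfold Rabs at 1 2; repeat destruct Rcase_abs; lra. }
  unfold gap in *; lra.
Qed.

Lemma geo_lim (a : nat -> R) D : (forall n, Rabs (a n - a (S n)) <= D * (/ 2) ^ n) ->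
  exists l, forall n, Rabs (a n - l) <= 2 * D * (/ 2) ^ n.
Proof.
  intros H.
  assert (HD : 0 <= D) by (specialize (H O); simpl in H; generalize (Rabs_pos (a O - a 1%nat)); lra).
  (* The factor [1 - (/ 2) ^ k] is the exact partial geometric sum; with it the induction on [k]
     closes. *)
  assert (Hk : forall n k, Rabs (a n - a (n + k)%nat) <= 2 * D * (/ 2) ^ n * (1 - (/ 2) ^ k)).
  { intros n k; induction k.
    - rewrite Nat.add_0_r, Rminus_diag, Rabs_R0; simpl; lra.
    - rewrite Nat.add_succ_r. specialize (H (n + k)%nat).
      rewrite pow_add in H. simpl.
      apply Rabs_le_iff in IHk. apply Rabs_le_iff in H. apply Rabs_le_iff. nra. }
  assert (Hp : forall k, 0 < (/ 2) ^ k) by (intros; apply pow_lt; lra).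
  assert (Hk' : forall n k, Rabs (a n - a (n + k)%nat) <= 2 * D * (/ 2) ^ n).
  { intros n k. eapply Rle_trans; [apply Hk|].
    rewrite <- (Rmult_1_r (2 * D * (/ 2) ^ n)) at 2. apply Rmult_le_compat_l; [|generalize (Hp k); lra].
    generalize (Hp n); nra. }
  assert (Hc : ex_finite_lim_seq a).
  { apply ex_lim_seq_cauchy_corr. intros e.
    destruct (pow_lt_1_zero (/ 2) ltac:(rewrite Rabs_right; lra) (e / (4 * D + 1))) as [N HN].
    { apply Rdiv_lt_0_compat; [apply cond_pos|lra]. }
    exists N. intros n m Hn Hm.
    assert (B1 := Hk' N (n - N)%nat). assert (B2 := Hk' N (m - N)%nat).
    replace (N + (n - N))%nat with n in B1 by lia. replace (N + (m - N))%nat with m in B2 by lia.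
    specialize (HN N ltac:(lia)). rewrite Rabs_right in HN by (generalize (Hp N); lra).
    assert (E : e / (4 * D + 1) * (4 * D + 1) = e) by (field; lra).
    assert (4 * D * (/ 2) ^ N < e).
    { rewrite <- E. generalize (Hp N); intros. destruct e as [e He]; simpl in *. nra. }
    apply Rabs_le_iff in B1; apply Rabs_le_iff in B2.
    unfold Rabs; destruct Rcase_abs; lra. }
  destruct Hc as [l Hl]. exists l. intros n.
  apply is_lim_seq_spec in Hl.
  apply Rnot_lt_le; intros Hlt.
  destruct (Hl (mkposreal (Rabs (a n - l) - 2 * D * (/ 2) ^ n) ltac:(lra))) as [N HN]. simpl in HN.
  specialize (HN (n + N)%nat ltac:(lia)). specialize (Hk' n N).
  revert HN Hk' Hlt. unfold Rabs; repeat destruct Rcase_abs; lra.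
Qed.

(** * Local existence for the diagonal system *)

Inductive fam := Fwd | Bwd | Still.

Definition sg (i : fam) : R := match i with Fwd => 1 | Bwd => -1 | Still => 0 end.

Definition src (i : fam) (r : fam -> R) : R :=
  match i with Still => - (r Fwd + r Bwd) / 2 | _ => r Still end.

Lemma Rabs_sg i : Rabs (sg i) <= 1.
Proof. destruct i; simpl; apply Rabs_le_iff; lra. Qed.

Lemma src_bound i r a : (forall j, Rabs (r j) <= a) -> Rabs (src i r) <= a.
Proof.
  intros H; generalize (H Fwd) (H Bwd) (H Still); intros a1 a2 a3.
  apply Rabs_le_iff in a1, a2, a3. destruct i; simpl; apply Rabs_le_iff; lra.
Qed.

Lemma src_diff i r r' a : (forall j, Rabs (r j - r' j) <= a) -> Rabs (src i r - src i r') <= a.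
Proof.
  intros H; generalize (H Fwd) (H Bwd) (H Still); intros a1 a2 a3.
  apply Rabs_le_iff in a1, a2, a3. destruct i; simpl; apply Rabs_le_iff; lra.
Qed.

(* An element of [state] is a pair (functions of (t,x), functions of (s,t,x)): either
   Riemann invariants with their backward characteristics [y i s t x] (position at time [s]
   of the [i]-characteristic through [(t,x)]), or the [x]-derivatives of such a pair. *)
Definition state : Type := ((fam -> R -> R -> R) * (fam -> R -> R -> R -> R))%type.

(** * The sup distance on states and contraction *)

Definition close (a b : state) (d : R) :=
  (forall i t x, Rabs (fst a i t x - fst b i t x) <= d) /\
  (forall i s t x, Rabs (snd a i s t x - snd b i s t x) <= d).

Definition UCS (a : state) := (forall i, UC2 (fst a i)) /\ (forall i, UC3 (snd a i)).

Definition bounded (A B : R) (a : state) :=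
  (forall i t x, Rabs (fst a i t x) <= A) /\ (forall i s t x, Rabs (snd a i s t x) <= B).

Lemma close_mono a b d d' : close a b d -> d <= d' -> close a b d'.
Proof. intros [H1 H2] H; split; intros; eapply Rle_trans; eauto. Qed.

Lemma close_trans a b c d d' : close a b d -> close b c d' -> close a c (d + d').
Proof.
  intros [H1 H2] [H3 H4]; split; intros.
  - specialize (H1 i t x); specialize (H3 i t x). abs_lra.
  - specialize (H2 i s t x); specialize (H4 i s t x). abs_lra.
Qed.

Lemma close_sym a b d : close a b d -> close b a d.
Proof. intros [H1 H2]; split; intros; rewrite Rabs_minus_sym; auto. Qed.

Lemma close_complete (u : nat -> state) D :
  (forall n, close (u n) (u (S n)) (D * (/ 2) ^ n)) ->
  exists l, forall n, close (u n) l (2 * D * (/ 2) ^ n).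
Proof.
  intros H.
  assert (H1 : forall q : fam * R * R, exists l, forall n,
    Rabs (fst (u n) (fst (fst q)) (snd (fst q)) (snd q) - l) <= 2 * D * (/ 2) ^ n).
  { intros q. apply geo_lim. intros n; apply (proj1 (H n)). }
  assert (H2 : forall q : fam * R * R * R, exists l, forall n,
    Rabs (snd (u n) (fst (fst (fst q))) (snd (fst (fst q))) (snd (fst q)) (snd q) - l) <= 2 * D * (/ 2) ^ n).
  { intros q. apply geo_lim. intros n; apply (proj2 (H n)). }
  apply IndefiniteDescription.functional_choice in H1. apply IndefiniteDescription.functional_choice in H2.
  destruct H1 as [f Hf]. destruct H2 as [g Hg].
  exists (fun i t x => f (i, t, x), fun i s t x => g (i, s, t, x)).
  intros n; split; intros; simpl.
  - apply (Hf (i, t, x) n).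
  - apply (Hg (i, s, t, x) n).
Qed.

Lemma pow_half_small e D : 0 < e -> exists N, forall n, (N <= n)%nat -> D * (/ 2) ^ n <= e.
Proof.
  intros He.
  destruct (pow_lt_1_zero (/ 2) ltac:(rewrite Rabs_right; lra) (e / (Rabs D + 1))) as [N HN].
  { apply Rdiv_lt_0_compat; auto. generalize (Rabs_pos D); lra. }
  exists N. intros n Hn. specialize (HN n Hn).
  assert (Hp : 0 < (/ 2) ^ n) by (apply pow_lt; lra).
  rewrite Rabs_right in HN by lra.
  assert (E : e / (Rabs D + 1) * (Rabs D + 1) = e) by (field; generalize (Rabs_pos D); lra).
  generalize (Rle_abs D) (Rabs_pos D); intros. nra.
Qed.

Lemma UCS_limit (u : nat -> state) l :
  (forall n, UCS (u n)) -> (forall e, 0 < e -> exists N, close (u N) l e) -> UCS l.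
Proof.
  intros HU HC. split; intros i e He.
  - destruct (HC (e / 3)) as [N [HN _]]; [lra|].
    destruct (proj1 (HU N) i (e / 3)) as [d [Hd H]]; [lra|].
    exists d; split; auto. intros t t' x x' Ht Hx. specialize (H t t' x x' Ht Hx).
    assert (K1 := HN i t x). assert (K2 := HN i t' x').
    abs_lra.
  - destruct (HC (e / 3)) as [N [_ HN]]; [lra|].
    destruct (proj2 (HU N) i (e / 3)) as [d [Hd H]]; [lra|].
    exists d; split; auto. intros s s' t t' x x' Hs Ht Hx. specialize (H s s' t t' x x' Hs Ht Hx).
    assert (K1 := HN i s t x). assert (K2 := HN i s' t' x').
    abs_lra.
Qed.

Lemma bounded_limit A B (u : nat -> state) l :
  (forall n, bounded A B (u n)) -> (forall e, 0 < e -> exists N, close (u N) l e) -> bounded A B l.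
Proof.
  intros HU HC. split; intros.
  - apply Rnot_lt_le; intros Hlt.
    destruct (HC ((Rabs (fst l i t x) - A) / 2)) as [N [HN _]]; [lra|].
    specialize (HN i t x). generalize (proj1 (HU N) i t x); intros K.
    revert HN K Hlt; unfold Rabs; repeat destruct Rcase_abs; lra.
  - apply Rnot_lt_le; intros Hlt.
    destruct (HC ((Rabs (snd l i s t x) - B) / 2)) as [N [_ HN]]; [lra|].
    specialize (HN i s t x). generalize (proj2 (HU N) i s t x); intros K.
    revert HN K Hlt; unfold Rabs; repeat destruct Rcase_abs; lra.
Qed.

(** The limit is not claimed to satisfy [Q], so [Q] may be a condition that is not closed, such as
    the existence of derivatives; the fixed point equation is checked by the caller. *)
Lemma banach (Q : state -> Prop) (F : state -> state) a0 D :
  Q a0 -> (forall a, Q a -> Q (F a)) ->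
  (forall a b d, Q a -> Q b -> close a b d -> close (F a) (F b) (d / 2)) ->
  close a0 (F a0) D ->
  exists l, forall n, close (Nat.iter n F a0) l (2 * D * (/ 2) ^ n).
Proof.
  intros HQ HF HC H0.
  assert (HQn : forall n, Q (Nat.iter n F a0)) by (induction n; simpl; auto).
  apply close_complete. intros n; induction n; simpl.
  - rewrite Rmult_1_r; auto.
  - replace (D * (/ 2 * (/ 2) ^ n)) with (D * (/ 2) ^ n / 2) by field.
    apply HC; auto; apply (HQn (S n)).
Qed.

(** For the invariants [u + phi h] and [u - phi h] this is [phi h], the only quantity on which the
    wave speed depends. *)
Definition wv (r : fam -> R -> R -> R) (q z : R) : R := (r Fwd q z - r Bwd q z) / 2.

Section Local.
Variables (Lam Lam' : R -> R) (C A0 B0 T : R) (r0 r0' : fam -> R -> R).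
(** [A] adds to the data the source integral, which is at most [T * A <= 1]. [B] adds to [B0 * 2],
    where 2 bounds the [x]-derivative of a characteristic, an integral of size at most
    [T * (B * 2) <= 1]. *)
Let A := A0 + 1.
Let B := 2 * B0 + 1.
Hypothesis HC : 0 <= C.
Hypothesis HA0 : 0 <= A0.
Hypothesis HB0 : 0 <= B0.
Hypothesis HLam : forall w, is_derive Lam w (Lam' w).
Hypothesis HLam'b : forall w, Rabs (Lam' w) <= C.
Hypothesis HLam'u : UC1 Lam'.
Hypothesis HLamb : forall w, Rabs w <= A -> Rabs (Lam w) <= C.
Hypothesis HT : 0 <= T.
Hypothesis HT1 : T * ((C + 1) * (B0 + 1) * (B + 2)) <= / 2.
Hypothesis HT2 : T * A <= 1.
Hypothesis Hr0 : forall i x, is_derive (r0 i) x (r0' i x).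
Hypothesis Hr0b : forall i x, Rabs (r0 i x) <= A0.
Hypothesis Hr0'b : forall i x, Rabs (r0' i x) <= B0.
Hypothesis Hr0'u : forall i, UC1 (r0' i).

Definition Yint (a : state) i q t x := Lam (wv (fst a) q (snd a i q t x)).
(** The characteristic equation [dy/ds = sg i * Lam], [y(t) = x], in integrated form with the
    right-hand side taken from the old state. [Rnew] integrates the source along the same old curve
    and adds the datum at the new foot. *)
Definition Ynew (a : state) i s t x := x - sg i * cint T (Yint a i) s t x.
Definition Rint (a : state) i q t x := src i (fun j => fst a j q (snd a i q t x)).
Definition Rnew (a : state) i t x := r0 i (Ynew a i 0 t x) + cint T (Rint a i) 0 t x.
Definition Step (a : state) : state := (Rnew a, Ynew a).

Definition Eint (a b : state) i q t x :=
  Lam' (wv (fst a) q (snd a i q t x)) * (wv (fst b) q (snd a i q t x) * snd b i q t x).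
Definition Enew (a b : state) i s t x := 1 - sg i * cint T (Eint a b i) s t x.
Definition Pint (a b : state) i q t x :=
  src i (fun j => fst b j q (snd a i q t x)) * snd b i q t x.
Definition Pnew (a b : state) i t x :=
  r0' i (Ynew a i 0 t x) * Enew a b i 0 t x + cint T (Pint a b i) 0 t x.
(* the formal [x]-derivative of [Step] at [a] in the direction [b] *)
Definition DStep (a b : state) : state := (Pnew a b, Enew a b).

(** The Lipschitz bound in [x] controls [fst a] composed with [snd a] when both factors change; this
    is what makes [Step] a contraction in the sup distance. *)
Definition Base (a : state) := UCS a /\ (forall i t x, Rabs (fst a i t x) <= A) /\
  (forall i t x y, Rabs (fst a i t x - fst a i t y) <= B * Rabs (x - y)).
Definition Fib (b : state) := UCS b /\ bounded B 2 b.

Lemma Lam_lip x y : Rabs (Lam x - Lam y) <= C * Rabs (x - y).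
Proof. apply MVT_lip with Lam'; auto. Qed.

Lemma r0_lip i x y : Rabs (r0 i x - r0 i y) <= B0 * Rabs (x - y).
Proof. apply MVT_lip with (r0' i); auto. Qed.

Lemma wv_bound r q z a : (forall i t x, Rabs (r i t x) <= a) -> Rabs (wv r q z) <= a.
Proof.
  intros H; generalize (H Fwd q z) (H Bwd q z); intros a1 a2.
  apply Rabs_le_iff in a1, a2. apply Rabs_le_iff; unfold wv; lra.
Qed.

Lemma UC3_wv r y : (forall i, UC2 (r i)) -> UC3 y -> UC3 (fun q t x => wv r q (y q t x)).
Proof.
  intros Hr Hy. unfold wv.
  apply (UC3_ext (fun q t x => / 2 * (r Fwd q (y q t x) - r Bwd q (y q t x)))).
  - intros; field.
  - apply UC3_scal, UC3_minus; apply UC3_comp2; auto.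
Qed.

Lemma UC3_src r y i : (forall i, UC2 (r i)) -> UC3 y ->
  UC3 (fun q t x => src i (fun j => r j q (y q t x))).
Proof.
  intros Hr Hy. destruct i; simpl; try (apply UC3_comp2; auto).
  apply (UC3_ext (fun q t x => (- / 2) * (r Fwd q (y q t x) + r Bwd q (y q t x)))).
  - intros; field.
  - apply UC3_scal, UC3_plus; apply UC3_comp2; auto.
Qed.

Lemma Yint_UC a i : UCS a -> UC3 (Yint a i).
Proof.
  intros [H1 H2]. unfold Yint. apply UC3_comp1.
  - apply UC1_lip with C; apply Lam_lip.
  - apply UC3_wv; auto.
Qed.

Lemma Yint_bound a i : Base a -> forall s t x, Rabs (Yint a i s t x) <= C.
Proof. intros [_ [H _]] s t x; apply HLamb, wv_bound; auto. Qed.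

Lemma Rint_UC a i : UCS a -> UC3 (Rint a i).
Proof. intros [H1 H2]. apply UC3_src; auto. Qed.

Lemma Rint_bound a i : Base a -> forall s t x, Rabs (Rint a i s t x) <= A.
Proof. intros [_ [H _]] s t x; apply src_bound; auto. Qed.

Lemma Eint_UC a b i : UCS a -> Fib b -> UC3 (Eint a b i).
Proof.
  intros [H1 H2] [[H3 H4] [H5 H6]].
  assert (X : forall s t x, Rabs (wv (fst b) s (snd a i s t x)) <= B) by (intros; apply wv_bound; auto).
  apply UC3_mult with (A := C) (B := B * 2).
  - intros; auto.
  - intros; apply Rabs_mult_le; auto.
  - apply UC3_comp1; auto. apply UC3_wv; auto.
  - apply UC3_mult with (A := B) (B := 2); auto. apply UC3_wv; auto.
Qed.

Lemma Eint_bound a b i : Fib b -> forall s t x, Rabs (Eint a b i s t x) <= C * (B * 2).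
Proof.
  intros [_ [H5 H6]] s t x. apply Rabs_mult_le; auto. apply Rabs_mult_le; auto.
  apply wv_bound; auto.
Qed.

Lemma Pint_UC a b i : UCS a -> Fib b -> UC3 (Pint a b i).
Proof.
  intros [H1 H2] [[H3 H4] [H5 H6]].
  apply UC3_mult with (A := B) (B := 2); auto.
  - intros; apply src_bound; auto.
  - apply UC3_src; auto.
Qed.

Lemma Pint_bound a b i : Fib b -> forall s t x, Rabs (Pint a b i s t x) <= B * 2.
Proof.
  intros [_ [H5 H6]] s t x. apply Rabs_mult_le; auto. apply src_bound; auto.
Qed.

Lemma sg_mult_le i z a : Rabs z <= a -> Rabs (sg i * z) <= a.
Proof.
  intros H. replace a with (1 * a) by ring. apply Rabs_mult_le; auto using Rabs_sg.
Qed.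

Lemma Ynew_UC a i : Base a -> UC3 (Ynew a i).
Proof.
  intros Ha. apply UC3_minus; [apply UC3_x|]. apply UC3_scal.
  apply cint_UC with C; auto. apply Yint_UC, Ha. apply Yint_bound; auto.
Qed.

Lemma Enew_UC a b i : UCS a -> Fib b -> UC3 (Enew a b i).
Proof.
  intros Ha Hb. apply UC3_minus; [apply UC3_const|]. apply UC3_scal.
  apply cint_UC with (C * (B * 2)); auto. apply Eint_UC; auto. apply Eint_bound; auto.
Qed.

Lemma UC2_plus f g : UC2 f -> UC2 g -> UC2 (fun t x => f t x + g t x).
Proof.
  intros Hf Hg. intros e He.
  destruct (Hf (e/2)) as [d1 [Hd1 H1]]; [lra|].
  destruct (Hg (e/2)) as [d2 [Hd2 H2]]; [lra|].
  exists (Rmin d1 d2); split; [apply Rmin_pos; auto|].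
  intros t t' x x' Ht Hx.
  rmin_bounds d1 d2.
  specialize (H1 t t' x x' ltac:(lra) ltac:(lra)).
  specialize (H2 t t' x x' ltac:(lra) ltac:(lra)).
  abs_lra.
Qed.

Lemma Enew_bound a b i s t x : UCS a -> Fib b -> Rabs (Enew a b i s t x) <= 2.
Proof.
  intros Ha Hb. unfold Enew.
  assert (K := cint_bound T (Eint a b i) (C * (B * 2)) s t x HT (Eint_UC _ _ _ Ha Hb) (Eint_bound _ _ _ Hb)).
  apply (sg_mult_le i) in K.
  assert (T * (C * (B * 2)) <= 1).
  { unfold B in *. nra. }
  abs_lra.
Qed.

Lemma Base_bounds_pos : 0 <= A /\ 0 <= B /\ 1 <= B.
Proof. unfold A, B; lra. Qed.

(** This dominates the contraction factor of the Riemann invariants, [T_small2] that of the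
    characteristics; the product in [HT1] covers both. *)
Lemma T_small1 : T * (B + 2) * (B0 * C + 1) <= / 2.
Proof.
  destruct Base_bounds_pos as [_ [HB _]].
  eapply Rle_trans; [|apply HT1]. rewrite Rmult_assoc. apply Rmult_le_compat_l; auto.
  rewrite (Rmult_comm _ (B + 2)). apply Rmult_le_compat_l; nra.
Qed.

Lemma T_small2 : T * (C * (B + 2)) <= / 2.
Proof.
  destruct Base_bounds_pos as [_ [HB _]].
  eapply Rle_trans; [|apply HT1]. apply Rmult_le_compat_l; auto.
  apply Rmult_le_compat_r; nra.
Qed.

Lemma Pnew_bound a b i t x : UCS a -> Fib b -> Rabs (Pnew a b i t x) <= B.
Proof.
  intros Ha Hb. unfold Pnew.
  assert (K := cint_bound T (Pint a b i) (B * 2) 0 t x HT (Pint_UC _ _ _ Ha Hb) (Pint_bound _ _ _ Hb)).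
  assert (K2 : Rabs (r0' i (Ynew a i 0 t x) * Enew a b i 0 t x) <= B0 * 2).
  { apply Rabs_mult_le; auto. apply Enew_bound; auto. }
  destruct Base_bounds_pos as [_ [HB HB1]].
  assert (T * (B * 2) <= 1) by (generalize T_small1; assert (0 <= B0 * C) by nra; nra).
  apply Rabs_le_iff in K, K2; apply Rabs_le_iff; unfold B in *; lra.
Qed.

Lemma DStep_Fib a b : Base a -> Fib b -> Fib (DStep a b).
Proof.
  intros Ha Hb. assert (Hu := proj1 Ha). split; split; simpl; intros.
  - apply UC2_plus.
    + apply (UC2_slice (fun s t x => r0' i (Ynew a i s t x) * Enew a b i s t x)).
      apply UC3_mult with (A := B0) (B := 2).
      * intros; auto.
      * intros; apply Enew_bound; auto.
      * apply UC3_comp1; auto. apply Ynew_UC; auto.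
      * apply Enew_UC; auto.
    + apply UC2_slice. apply cint_UC with (B * 2); auto. apply Pint_UC; auto. apply Pint_bound; auto.
  - apply Enew_UC; auto.
  - apply Pnew_bound; auto.
  - apply Enew_bound; auto.
Qed.

Lemma Step_UC a : Base a -> UCS (Step a).
Proof.
  intros Ha. split; simpl; intros.
  - apply UC2_plus.
    + apply (UC2_slice (fun s t x => r0 i (Ynew a i s t x))).
      apply UC3_comp1; [apply UC1_lip with B0; apply r0_lip|apply Ynew_UC; auto].
    + apply UC2_slice. apply cint_UC with A; auto. apply Rint_UC, Ha. apply Rint_bound; auto.
  - apply Ynew_UC; auto.
Qed.

Lemma Step_bound a : Base a -> forall i t x, Rabs (fst (Step a) i t x) <= A.
Proof.
  intros Ha i t x; simpl. unfold Rnew.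
  assert (K := cint_bound T (Rint a i) A 0 t x HT (Rint_UC _ _ (proj1 Ha)) (Rint_bound _ _ Ha)).
  assert (K2 := Hr0b i (Ynew a i 0 t x)).
  apply Rabs_le_iff in K, K2; apply Rabs_le_iff; unfold A in *; lra.
Qed.

Lemma wv_diff a b d i s t x : Base b -> close a b d ->
  Rabs (wv (fst a) s (snd a i s t x) - wv (fst b) s (snd b i s t x)) <= (B + 1) * d.
Proof.
  intros [_ [_ HL]] [H1 H2]. destruct Base_bounds_pos as [_ [HB _]].
  assert (K : forall j, Rabs (fst a j s (snd a i s t x) - fst b j s (snd b i s t x)) <= (B + 1) * d).
  { intros j. replace (_ - _) with ((fst a j s (snd a i s t x) - fst b j s (snd a i s t x)) +
      (fst b j s (snd a i s t x) - fst b j s (snd b i s t x))) by ring.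
    eapply Rle_trans; [apply Rabs_triang|]. specialize (H1 j s (snd a i s t x)).
    specialize (HL j s (snd a i s t x) (snd b i s t x)). specialize (H2 i s t x).
    assert (B * Rabs (snd a i s t x - snd b i s t x) <= B * d) by (apply Rmult_le_compat_l; auto). lra. }
  generalize (K Fwd) (K Bwd); intros a1 a2. apply Rabs_le_iff in a1, a2.
  unfold wv; apply Rabs_le_iff; lra.
Qed.

Lemma Rint_diff a b d i s t x : Base b -> close a b d ->
  Rabs (Rint a i s t x - Rint b i s t x) <= (B + 1) * d.
Proof.
  intros [_ [_ HL]] [H1 H2]. destruct Base_bounds_pos as [_ [HB _]].
  apply src_diff. intros j.
  replace (_ - _) with ((fst a j s (snd a i s t x) - fst b j s (snd a i s t x)) +
      (fst b j s (snd a i s t x) - fst b j s (snd b i s t x))) by ring.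
  eapply Rle_trans; [apply Rabs_triang|]. specialize (H1 j s (snd a i s t x)).
  specialize (HL j s (snd a i s t x) (snd b i s t x)). specialize (H2 i s t x).
  assert (B * Rabs (snd a i s t x - snd b i s t x) <= B * d) by (apply Rmult_le_compat_l; auto). lra.
Qed.

Lemma close_pos a b d : close a b d -> 0 <= d.
Proof. intros [H _]. eapply Rle_trans; [apply Rabs_pos|apply (H Fwd 0 0)]. Qed.

Lemma Ynew_diff a b d i s t x : Base a -> Base b -> close a b d ->
  Rabs (Ynew a i s t x - Ynew b i s t x) <= T * (C * ((B + 1) * d)).
Proof.
  intros Ha Hb H. unfold Ynew.
  replace (_ - _) with (sg i * (cint T (Yint b i) s t x - cint T (Yint a i) s t x)) by ring.
  apply sg_mult_le. rewrite Rabs_minus_sym.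
  apply cint_diff; auto; try (apply Yint_UC; [apply Ha || apply Hb]).
  intros. eapply Rle_trans; [apply Lam_lip|]. apply Rmult_le_compat_l; auto.
  apply wv_diff; auto.
Qed.

Lemma Step_contract a b d : Base a -> Base b -> close a b d -> close (Step a) (Step b) (d / 2).
Proof.
  intros Ha Hb H. assert (Hd := close_pos _ _ _ H).
  destruct Base_bounds_pos as [_ [HB _]].
  assert (S1 := T_small1). assert (S2 := T_small2).
  split; simpl; intros.
  - unfold Rnew.
    assert (K1 : Rabs (r0 i (Ynew a i 0 t x) - r0 i (Ynew b i 0 t x)) <= B0 * (T * (C * ((B + 1) * d)))).
    { eapply Rle_trans; [apply r0_lip|]. apply Rmult_le_compat_l; auto. apply Ynew_diff; auto. }
    assert (K2 : Rabs (cint T (Rint a i) 0 t x - cint T (Rint b i) 0 t x) <= T * ((B + 1) * d)).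
    { apply cint_diff; auto. apply Rint_UC, Ha. apply Rint_UC, Hb. intros; apply Rint_diff; auto. }
    assert (B0 * (T * (C * ((B + 1) * d))) + T * ((B + 1) * d) <= d / 2).
    { replace (_ + _) with ((T * (B + 1) * (B0 * C + 1)) * d) by ring.
      assert (0 <= B0 * C) by nra.
      assert (T * (B + 1) * (B0 * C + 1) <= / 2) by nra. nra. }
    abs_lra.
  - eapply Rle_trans; [apply Ynew_diff; eauto|].
    assert (T * (C * (B + 1)) <= / 2) by nra. nra.
Qed.

Lemma Eint_diff a b b' d i s t x : Fib b -> Fib b' -> close b b' d ->
  Rabs (Eint a b i s t x - Eint a b' i s t x) <= C * ((B + 2) * d).
Proof.
  intros [_ [H1 H2]] [_ [H3 H4]] [H5 H6]. unfold Eint.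
  rewrite <- Rmult_minus_distr_l. apply Rabs_mult_le; auto.
  replace ((B + 2) * d) with (B * d + 2 * d) by ring.
  apply Rabs_mult_diff; auto.
  - apply wv_bound; auto.
  - generalize (H5 Fwd s (snd a i s t x)) (H5 Bwd s (snd a i s t x)); intros a1 a2.
    apply Rabs_le_iff in a1, a2. unfold wv; apply Rabs_le_iff; lra.
Qed.

Lemma Pint_diff a b b' d i s t x : Fib b -> Fib b' -> close b b' d ->
  Rabs (Pint a b i s t x - Pint a b' i s t x) <= (B + 2) * d.
Proof.
  intros [_ [H1 H2]] [_ [H3 H4]] [H5 H6]. unfold Pint.
  replace ((B + 2) * d) with (B * d + 2 * d) by ring.
  apply Rabs_mult_diff; auto.
  - apply src_bound; auto.
  - apply src_diff; auto.
Qed.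

Lemma DStep_contract a b b' d : Base a -> Fib b -> Fib b' -> close b b' d ->
  close (DStep a b) (DStep a b') (d / 2).
Proof.
  intros Ha Hb Hb' H. assert (Hd := close_pos _ _ _ H). assert (Hu := proj1 Ha).
  assert (S1 := T_small1). assert (S2 := T_small2).
  assert (E : forall i s t x, Rabs (Enew a b i s t x - Enew a b' i s t x) <= T * (C * ((B + 2) * d))).
  { intros. unfold Enew.
    replace (_ - _) with (sg i * (cint T (Eint a b' i) s t x - cint T (Eint a b i) s t x)) by ring.
    apply sg_mult_le. rewrite Rabs_minus_sym. apply cint_diff; auto; try (apply Eint_UC; auto).
    intros; apply Eint_diff; auto. }
  split; simpl; intros.
  - unfold Pnew.
    assert (K1 : Rabs (r0' i (Ynew a i 0 t x) * Enew a b i 0 t x - r0' i (Ynew a i 0 t x) * Enew a b' i 0 t x) <= B0 * (T * (C * ((B + 2) * d)))).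
    { rewrite <- Rmult_minus_distr_l. apply Rabs_mult_le; auto. }
    assert (K2 : Rabs (cint T (Pint a b i) 0 t x - cint T (Pint a b' i) 0 t x) <= T * ((B + 2) * d)).
    { apply cint_diff; auto; try (apply Pint_UC; auto). intros; apply Pint_diff; auto. }
    assert (B0 * (T * (C * ((B + 2) * d))) + T * ((B + 2) * d) <= d / 2).
    { replace (_ + _) with ((T * (B + 2) * (B0 * C + 1)) * d) by ring. nra. }
    abs_lra.
  - eapply Rle_trans; [apply E|]. nra.
Qed.

Definition deriv_rel (a b : state) :=
  (forall i t x, is_derive (fst a i t) x (fst b i t x)) /\
  (forall i s t x, is_derive (snd a i s t) x (snd b i s t x)).

Lemma is_derive_src i (f f' : fam -> R -> R) x : (forall j, is_derive (f j) x (f' j x)) ->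
  is_derive (fun z => src i (fun j => f j z)) x (src i (fun j => f' j x)).
Proof.
  intros H. destruct i; simpl; auto.
  apply (is_derive_ext (fun z => (- / 2) * (f Fwd z + f Bwd z))); [intros; simpl; field|].
  replace (- (f' Fwd x + f' Bwd x) / 2) with ((- / 2) * (f' Fwd x + f' Bwd x)) by field.
  apply (is_derive_scal (fun z => f Fwd z + f Bwd z)). apply (is_derive_plus (V := R_NormedModule)); auto.
Qed.

Lemma is_derive_wv (r p : fam -> R -> R -> R) q x : (forall j, is_derive (r j q) x (p j q x)) ->
  is_derive (wv r q) x (wv p q x).
Proof.
  intros H. unfold wv.
  apply (is_derive_ext (fun z => (/ 2) * (r Fwd q z - r Bwd q z))); [intros; simpl; field|].
  replace ((p Fwd q x - p Bwd q x) / 2) with ((/ 2) * (p Fwd q x - p Bwd q x)) by field.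
  apply (is_derive_scal (fun z => r Fwd q z - r Bwd q z)). apply (is_derive_minus (V := R_NormedModule)); auto.
Qed.

Lemma Ynew_derive a b i s t x : Base a -> Fib b -> deriv_rel a b ->
  is_derive (Ynew a i s t) x (Enew a b i s t x).
Proof.
  intros Ha Hb [H1 H2]. unfold Ynew, Enew.
  apply (is_derive_minus (V := R_NormedModule)); [apply (is_derive_id x)|].
  apply (is_derive_scal (fun z => cint T (Yint a i) s t z)).
  apply cint_derive; [apply Yint_UC, Ha|apply Eint_UC; auto; apply Ha|].
  intros q t' x'. unfold Yint, Eint.
  replace (_ * _) with (snd b i q t' x' * (wv (fst b) q (snd a i q t' x')) * Lam' (wv (fst a) q (snd a i q t' x'))) by ring.
  apply (is_derive_comp Lam (fun z => wv (fst a) q (snd a i q t' z))); auto.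
  apply (is_derive_comp (wv (fst a) q) (fun z => snd a i q t' z)); auto.
  apply is_derive_wv; auto.
Qed.

Lemma Step_derive a b : Base a -> Fib b -> deriv_rel a b -> deriv_rel (Step a) (DStep a b).
Proof.
  intros Ha Hb H. split; simpl; intros.
  - unfold Rnew, Pnew. apply (is_derive_plus (V := R_NormedModule)).
    + rewrite Rmult_comm. apply (is_derive_comp (r0 i) (Ynew a i 0 t)); auto.
      apply Ynew_derive; auto.
    + apply cint_derive; [apply Rint_UC, Ha|apply Pint_UC; auto; apply Ha|].
      intros q t' x'. unfold Rint, Pint. destruct H as [H1 H2]. rewrite Rmult_comm.
      apply (is_derive_comp (fun z => src i (fun j => fst a j q z)) (fun z => snd a i q t' z)); auto.
      apply (is_derive_src i (fun j => fst a j q) (fun j => fst b j q)); auto.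
  - apply Ynew_derive; auto.
Qed.

(** The Lipschitz constant [B] is recovered from the bound on the derivative [DStep a b]; hence the
    iteration has to carry derivatives along. *)
Lemma Step_Base a b : Base a -> Fib b -> deriv_rel a b -> Base (Step a).
Proof.
  intros Ha Hb H. split; [|split].
  - apply Step_UC; auto.
  - apply Step_bound; auto.
  - intros. apply MVT_lip with (fst (DStep a b) i t).
    + intros; apply Step_derive; auto.
    + intros; apply Pnew_bound; auto. apply Ha.
Qed.

(* Continuity of the fiber map in the base point: only uniform continuity of [b] is used,
   so no rate of convergence is available. *)
Lemma DStep_cont b e : Fib b -> 0 < e -> exists d, 0 < d /\
  forall a a', Base a -> Base a' -> close a a' d -> close (DStep a b) (DStep a' b) e.
Proof.
  intros Hb He. assert (Hb1 := Hb). destruct Hb1 as [[U1 U2] [b1 b2]].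
  destruct Base_bounds_pos as [_ [HB HB1]].
  assert (S1 := T_small1). assert (S2 := T_small2).
  set (e1 := e / (8 * (B + C + B0 + 1) * (T + 1))).
  assert (HX : 0 < 8 * (B + C + B0 + 1) * (T + 1)) by nra.
  assert (He1 : 0 < e1) by (apply Rdiv_lt_0_compat; auto).
  assert (Ee : e1 * (8 * (B + C + B0 + 1) * (T + 1)) = e) by (unfold e1; field; nra).
  destruct (HLam'u e1 He1) as [dL [HdL HL]].
  assert (HP : exists d, 0 < d /\ forall j t x x', Rabs (x - x') <= d -> Rabs (fst b j t x - fst b j t x') <= e1).
  { destruct (U1 Fwd e1 He1) as [d1 [Hd1 K1]]. destruct (U1 Bwd e1 He1) as [d2 [Hd2 K2]].
    destruct (U1 Still e1 He1) as [d3 [Hd3 K3]].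
    exists (Rmin d1 (Rmin d2 d3)). split; [repeat apply Rmin_pos; auto|].
    intros j t x x' Hx.
    rmin_bounds d1 (Rmin d2 d3).
    rmin_bounds d2 d3.
    destruct j; [apply K1|apply K2|apply K3]; try (rewrite Rminus_diag, Rabs_R0); lra. }
  destruct HP as [dP [HdP KP]].
  assert (HR : exists d, 0 < d /\ forall j x x', Rabs (x - x') <= d -> Rabs (r0' j x - r0' j x') <= e1).
  { destruct (Hr0'u Fwd e1 He1) as [d1 [Hd1 K1]]. destruct (Hr0'u Bwd e1 He1) as [d2 [Hd2 K2]].
    destruct (Hr0'u Still e1 He1) as [d3 [Hd3 K3]].
    exists (Rmin d1 (Rmin d2 d3)). split; [repeat apply Rmin_pos; auto|].
    intros j x x' Hx.
    rmin_bounds d1 (Rmin d2 d3).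
    rmin_bounds d2 d3.
    destruct j; [apply K1|apply K2|apply K3]; lra. }
  destruct HR as [dR [HdR KR]].
  set (d := Rmin (dL / (B + 1)) (Rmin dP dR)).
  assert (Hd : 0 < d).
  { repeat apply Rmin_pos; auto. apply Rdiv_lt_0_compat; lra. }
  assert (D1 : (B + 1) * d <= dL).
  { assert (d <= dL / (B + 1)) by apply Rmin_l.
    replace dL with ((B + 1) * (dL / (B + 1))) by (field; lra).
    apply Rmult_le_compat_l; lra. }
  assert (D2 : d <= dP /\ d <= dR).
  { unfold d. generalize (Rmin_r (dL / (B + 1)) (Rmin dP dR)) (Rmin_l dP dR) (Rmin_r dP dR); lra. }
  exists d; split; auto. intros a a' Ha Ha' H.
  assert (Hu := proj1 Ha). assert (Hu' := proj1 Ha').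
  assert (E : forall i s t x, Rabs (Enew a b i s t x - Enew a' b i s t x) <= T * (C * (e1 * 2) + B * 2 * e1)).
  { intros. unfold Enew.
    replace (_ - _) with (sg i * (cint T (Eint a' b i) s t x - cint T (Eint a b i) s t x)) by ring.
    apply sg_mult_le. rewrite Rabs_minus_sym. apply cint_diff; auto; try (apply Eint_UC; auto).
    clear s t x. intros s t x. unfold Eint. apply Rabs_mult_diff; auto.
    - apply Rabs_mult_le; auto. apply wv_bound; auto.
    - apply HL. eapply Rle_trans; [apply wv_diff; eauto|auto].
    - rewrite <- Rmult_minus_distr_r. apply Rabs_mult_le; auto.
      assert (KK : forall j, Rabs (fst b j s (snd a i s t x) - fst b j s (snd a' i s t x)) <= e1).
      { intros j; apply KP. eapply Rle_trans; [apply H|lra]. }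
      generalize (KK Fwd) (KK Bwd); intros a1 a2. apply Rabs_le_iff in a1, a2.
      unfold wv; apply Rabs_le_iff; lra. }
  assert (TE : T * (C * (e1 * 2) + B * 2 * e1) <= e1 * (2 * (C + B) * (T + 1))) by nra.
  split; simpl; intros.
  - unfold Pnew.
    assert (K1 : Rabs (r0' i (Ynew a i 0 t x) * Enew a b i 0 t x - r0' i (Ynew a' i 0 t x) * Enew a' b i 0 t x)
       <= B0 * (T * (C * (e1 * 2) + B * 2 * e1)) + 2 * e1).
    { apply Rabs_mult_diff; auto.
      - apply Enew_bound; auto.
      - apply KR. eapply Rle_trans; [apply Ynew_diff; eauto|].
        assert (T * (C * (B + 1)) <= / 2) by nra. nra. }
    assert (K2 : Rabs (cint T (Pint a b i) 0 t x - cint T (Pint a' b i) 0 t x) <= T * (e1 * 2)).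
    { apply cint_diff; auto; try (apply Pint_UC; auto). clear K1 t x. intros s t x. unfold Pint.
      rewrite <- Rmult_minus_distr_r. apply Rabs_mult_le; auto. apply src_diff.
      intros j; apply KP. eapply Rle_trans; [apply H|lra]. }
    assert (B0 * T <= / 2 /\ T <= / 2 /\ T * B <= /2 /\ T * C <= /2).
    { assert (0 <= B0 * C) by nra. assert (T * (B + 2) <= / 2) by nra.
      split; [|split; [|split]]; try nra. unfold B in *. nra. }
    assert (B0 * (T * (C * (e1 * 2) + B * 2 * e1)) <= e1 * (C + B)).
    { replace (_ * _) with ((B0 * T) * (e1 * (2 * (C + B)))) by ring.
      assert (0 <= e1 * (C + B)) by nra. nra. }
    assert (e1 * (C + B) + 2 * e1 + T * (e1 * 2) <= e).
    { rewrite <- Ee. assert (0 <= e1 * T) by nra. nra. }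
    abs_lra.
  - eapply Rle_trans; [apply E|]. eapply Rle_trans; [apply TE|]. rewrite <- Ee. nra.
Qed.

(** * Convergence of the iterates and of their derivatives *)

Definition a0 : state := (fun i t x => 0, fun i s t x => x).
Definition b0 : state := (fun i t x => 0, fun i s t x => 1).
Definition an (n : nat) := Nat.iter n Step a0.
Fixpoint bn (n : nat) : state := match n with O => b0 | S k => DStep (an k) (bn k) end.

Lemma iterates n : Base (an n) /\ Fib (bn n) /\ deriv_rel (an n) (bn n).
Proof.
  destruct Base_bounds_pos as [HA [HB HB1]].
  induction n.
  - simpl. split; [|split].
    + split; [|split]; simpl; intros.
      * split; simpl; intros; [apply UC2_const|apply UC3_x].
      * rewrite Rabs_R0; auto.
      * rewrite Rminus_diag, Rabs_R0. generalize (Rabs_pos (x - y)); nra.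
    + split; split; simpl; intros.
      * apply UC2_const.
      * apply UC3_const.
      * rewrite Rabs_R0; auto.
      * rewrite Rabs_R1; lra.
    + split; simpl; intros.
      * apply (is_derive_const (V := R_NormedModule) 0).
      * apply (is_derive_id x).
  - destruct IHn as [Ha [Hb H]]. simpl. fold (an n). split; [|split].
    + apply Step_Base with (bn n); auto.
    + apply DStep_Fib; auto.
    + apply Step_derive; auto.
Qed.

Lemma local_fixpoint : exists a b, Base a /\ Fib b /\ deriv_rel a b /\
  (forall i t x, fst a i t x = fst (Step a) i t x) /\
  (forall i s t x, snd a i s t x = snd (Step a) i s t x).
Proof.
  destruct Base_bounds_pos as [HA [HB HB1]].
  set (D := A + C * T + 1).
  assert (H0 : close a0 (Step a0) D).
  { assert (HB0' := proj1 (iterates 0)). split; intros.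
    - assert (K := Step_bound a0 HB0' i t x). change (fst a0 i t x) with 0.
      rewrite Rminus_0_l, Rabs_Ropp. unfold D; assert (0 <= C * T) by (apply Rmult_le_pos; auto); lra.
    - simpl. unfold Ynew. replace (_ - _) with (sg i * cint T (Yint a0 i) s t x) by ring.
      apply sg_mult_le. eapply Rle_trans; [apply cint_bound with (B := C)|]; auto.
      + apply Yint_UC, HB0'.
      + apply Yint_bound; auto.
      + unfold D; rewrite (Rmult_comm T C); lra. }
  destruct (banach (fun a => exists b, Base a /\ Fib b /\ deriv_rel a b) Step a0 D) as [a Ha]; auto.
  { exists b0. apply (iterates 0). }
  { intros a [b [H1 [H2 H3]]]. exists (DStep a b). split; [|split].
    - apply Step_Base with b; auto.
    - apply DStep_Fib; auto.
    - apply Step_derive; auto. }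
  { intros a b d [? [? _]] [? [? _]]; apply Step_contract; auto. }
  fold an in Ha.
  assert (Hlim : forall e, 0 < e -> exists N, forall n, (N <= n)%nat -> close (an n) a e).
  { intros e He. destruct (pow_half_small e (2 * D) He) as [N HN]. exists N.
    intros n Hn. eapply close_mono; [apply Ha|auto]. }
  assert (Hlim1 : forall e, 0 < e -> exists N, close (an N) a e).
  { intros e He; destruct (Hlim e He) as [N HN]; exists N; auto. }
  (* Differentiability of the iterates does not pass to the limit by itself, but the conditions in
     [Base] are closed under uniform limits. *)
  assert (HBa : Base a).
  { split; [|split].
    - apply UCS_limit with an; auto. intros n; apply (iterates n).
    - intros. apply Rnot_lt_le; intros Hlt.
      destruct (Hlim1 ((Rabs (fst a i t x) - A) / 2)) as [N [HN _]]; [lra|].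
      specialize (HN i t x). generalize (proj1 (proj2 (proj1 (iterates N))) i t x); intros K.
      revert HN K Hlt; unfold Rabs; repeat destruct Rcase_abs; lra.
    - intros. apply Rnot_lt_le; intros Hlt.
      destruct (Hlim1 ((Rabs (fst a i t x - fst a i t y) - B * Rabs (x - y)) / 4)) as [N [HN _]]; [lra|].
      assert (K1 := HN i t x). assert (K2 := HN i t y).
      generalize (proj2 (proj2 (proj1 (iterates N))) i t x y); intros K.
      revert K1 K2 K Hlt; generalize (B * Rabs (x - y)); unfold Rabs; repeat destruct Rcase_abs; intros; lra. }
  assert (Hfix : forall e, 0 < e -> close a (Step a) e).
  { intros e He. destruct (Hlim (e / 2)) as [N HN]; [lra|].
    assert (K1 := HN (S N) ltac:(lia)). assert (K2 := HN N ltac:(lia)).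
    apply Step_contract in K2; auto; [|apply (iterates N)].
    apply close_sym in K1. eapply close_mono; [eapply close_trans; [apply K1|apply K2]|]. lra. }
  destruct (banach Fib (DStep a) b0 (B + 2 + 1)) as [b Hb].
  { apply (iterates 0). }
  { intros; apply DStep_Fib; auto. }
  { intros; apply DStep_contract; auto. }
  { assert (K : Fib (DStep a b0)) by (apply DStep_Fib; auto; apply (iterates 0)).
    destruct K as [_ [K1 K2]]. split; intros.
    - specialize (K1 i t x). change (fst b0 i t x) with 0. rewrite Rminus_0_l, Rabs_Ropp. lra.
    - specialize (K2 i s t x). change (snd b0 i s t x) with 1. abs_lra. }
  assert (HFn : forall n, Fib (Nat.iter n (DStep a) b0)).
  { induction n; simpl; [apply (iterates 0)|apply DStep_Fib; auto]. }
  assert (Hblim : forall e, 0 < e -> exists N, forall n, (N <= n)%nat -> close (Nat.iter n (DStep a) b0) b e).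
  { intros e He. destruct (pow_half_small e (2 * (B + 2 + 1)) He) as [N HN]. exists N.
    intros n Hn. eapply close_mono; [apply Hb|auto]. }
  assert (HFb : Fib b).
  { assert (X : forall e, 0 < e -> exists N, close (Nat.iter N (DStep a) b0) b e).
    { intros e He; destruct (Hblim e He) as [N HN]; exists N; auto. }
    split; [apply UCS_limit with (fun n => Nat.iter n (DStep a) b0)
           |apply bounded_limit with (fun n => Nat.iter n (DStep a) b0)]; auto; intros; apply HFn. }
  assert (Hbfix : forall e, 0 < e -> close b (DStep a b) e).
  { intros e He. destruct (Hblim (e / 2)) as [N HN]; [lra|].
    assert (K1 := HN (S N) ltac:(lia)). assert (K2 := HN N ltac:(lia)).
    apply (DStep_contract a) in K2; auto.
    apply close_sym in K1. eapply close_mono; [eapply close_trans; [apply K1|apply K2]|]. lra. }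
  (* fiber contraction: the derivatives of the iterates converge to the fixed derivative *)
  assert (Hbn : forall e, 0 < e -> exists N, forall n, (N <= n)%nat -> close (bn n) b e).
  { intros e He.
    destruct (DStep_cont b (e / 8) HFb ltac:(lra)) as [d [Hd Hcont]].
    destruct (Hlim d Hd) as [N HN].
    (* Each step halves the distance and adds two errors of [e / 8]; the value [e / 2] is fixed
       under [y -> y / 2 + e / 4]. *)
    assert (Hk : forall k, close (bn (N + k)) b ((2 * B + 4) * (/ 2) ^ k + e / 2)).
    { induction k.
      - rewrite Nat.add_0_r. destruct (iterates N) as [_ [[_ [G1 G2]] _]].
        destruct HFb as [_ [G3 G4]]. simpl. split; intros.
        + specialize (G1 i t x); specialize (G3 i t x). abs_lra.
        + specialize (G2 i s t x); specialize (G4 i s t x). abs_lra.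
      - rewrite Nat.add_succ_r. simpl bn.
        assert (K1 : close (DStep (an (N + k)) (bn (N + k))) (DStep (an (N + k)) b)
           (((2 * B + 4) * (/ 2) ^ k + e / 2) / 2)) by (apply DStep_contract; auto; apply (iterates (N + k))).
        assert (K2 : close (DStep (an (N + k)) b) (DStep a b) (e / 8)).
        { apply Hcont; auto; [apply (iterates (N + k))|apply HN; lia]. }
        assert (K3 := close_sym _ _ _ (Hbfix (e / 8) ltac:(lra))).
        eapply close_mono; [eapply close_trans; [apply K1|eapply close_trans; [apply K2|apply K3]]|].
        simpl pow. lra. }
    destruct (pow_half_small (e / 2) (2 * B + 4)) as [N2 HN2]; [lra|].
    exists (N + N2)%nat. intros n Hn. replace n with (N + (n - N))%nat by lia.
    eapply close_mono; [apply Hk|]. specialize (HN2 (n - N)%nat ltac:(lia)). lra. }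
  exists a, b. split; [auto|split; [auto|split; [|split]]].
  - destruct HFb as [[U1 U2] _]. split; intros.
    + apply (derive_limit (fun n => fst (an n) i t) (fun n => fst (bn n) i t)).
      * intros n z; apply (iterates n).
      * intros e z He; destruct (Hlim e He) as [N HN]; exists N; intros n Hn; apply (HN n Hn).
      * intros e He; destruct (Hbn e He) as [N HN]; exists N; intros n Hn z; apply (HN n Hn).
      * intros e He; destruct (U1 i e He) as [d [Hd K]]; exists d; split; auto.
        intros; apply K; auto. rewrite Rminus_diag, Rabs_R0; lra.
    + apply (derive_limit (fun n => snd (an n) i s t) (fun n => snd (bn n) i s t)).
      * intros n z; apply (iterates n).
      * intros e z He; destruct (Hlim e He) as [N HN]; exists N; intros n Hn; apply (HN n Hn).
      * intros e He; destruct (Hbn e He) as [N HN]; exists N; intros n Hn z; apply (HN n Hn).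
      * intros e He; destruct (U2 i e He) as [d [Hd K]]; exists d; split; auto.
        intros; apply K; auto; rewrite Rminus_diag, Rabs_R0; lra.
  - intros. apply Rminus_diag_uniq.
    destruct (Req_dec (fst a i t x - fst (Step a) i t x) 0) as [|Hn]; auto.
    exfalso. apply Rabs_pos_lt in Hn.
    assert (K := proj1 (Hfix _ (Rdiv_lt_0_compat _ 2 Hn Rlt_0_2)) i t x). lra.
  - intros. apply Rminus_diag_uniq.
    destruct (Req_dec (snd a i s t x - snd (Step a) i s t x) 0) as [|Hn]; auto.
    exfalso. apply Rabs_pos_lt in Hn.
    assert (K := proj2 (Hfix _ (Rdiv_lt_0_compat _ 2 Hn Rlt_0_2)) i s t x). lra.
Qed.

(** Replaces a Gronwall argument: a bounded quantity whose every bound can be halved vanishes. *)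
Lemma halving_zero (f : R -> R) D : (forall s, Rabs (f s) <= D) ->
  (forall d, (forall s, Rabs (f s) <= d) -> forall s, Rabs (f s) <= d / 2) -> forall s, f s = 0.
Proof.
  intros H0 H s.
  assert (K : forall n s, Rabs (f s) <= D * (/ 2) ^ n).
  { induction n; simpl; intros.
    - rewrite Rmult_1_r; auto.
    - replace (D * (/ 2 * (/ 2) ^ n)) with (D * (/ 2) ^ n / 2) by field. apply H; auto. }
  destruct (Req_dec (f s) 0) as [|Hn]; auto. exfalso. apply Rabs_pos_lt in Hn.
  destruct (pow_half_small (Rabs (f s) / 2) D ltac:(lra)) as [N HN].
  specialize (HN N (Nat.le_refl _)). specialize (K N s). lra.
Qed.

(** Both sides, as functions of [s], follow the same speed field and agree at time [t1], so their
    difference reproduces itself with the factor [T * C * B <= / 2]. The fixed point equation ties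
    each curve only to its own endpoint, so the flow property has to be derived. *)
Lemma characteristic_flow a i t1 t2 x : Base a ->
  (forall i s t x, snd a i s t x = snd (Step a) i s t x) -> 
  forall s, snd a i s t1 (snd a i t1 t2 x) = snd a i s t2 x.
Proof.
  intros Ha Hfix s. assert (Hu := proj1 Ha).
  destruct Base_bounds_pos as [_ [HB _]].
  set (z := snd a i t1 t2 x). apply Rminus_diag_uniq.
  assert (HY : UC3 (Yint a i)) by (apply Yint_UC; auto).
  assert (HYb := Yint_bound a i Ha).
  assert (E : forall s, snd a i s t1 z - snd a i s t2 x =
    sg i * (RInt (fun q => Yint a i q t2 x) (clamp 0 T s) (clamp 0 T t1)
            - RInt (fun q => Yint a i q t1 z) (clamp 0 T s) (clamp 0 T t1))).
  { intros r. rewrite (Hfix i r t1 z), (Hfix i r t2 x). simpl. unfold Ynew, cint.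
    generalize (RInt (fun q => Yint a i q t1 z) (clamp 0 T r) (clamp 0 T t1)); intros R1.
    replace z with (x - sg i * RInt (fun q => Yint a i q t2 x) (clamp 0 T t1) (clamp 0 T t2))
      by (unfold z; rewrite (Hfix i t1 t2 x); reflexivity).
    rewrite <- (RInt_Chasles_R (fun q => Yint a i q t2 x) (clamp 0 T r) (clamp 0 T t1) (clamp 0 T t2))
      by (apply UC3_ex_RInt; auto). ring. }
  assert (HX : forall d, (forall q, Rabs (Yint a i q t2 x - Yint a i q t1 z) <= d) ->
     forall r, Rabs (snd a i r t1 z - snd a i r t2 x) <= T * d).
  { intros d Hq r. rewrite E. apply sg_mult_le.
    eapply Rle_trans; [apply RInt_diff_bound with (M := d); auto; apply UC3_ex_RInt; auto|].
    apply Rmult_le_compat_r; [eapply Rle_trans; [apply Rabs_pos|apply (Hq 0)]|apply clamp_dist; auto]. }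
  revert s.
  apply (halving_zero (fun s => snd a i s t1 z - snd a i s t2 x) (T * (2 * C))).
  - apply HX. intros q. generalize (HYb q t2 x) (HYb q t1 z). intros K1 K2.
    abs_lra.
  - intros d Hd s. assert (0 <= d) by (eapply Rle_trans; [apply Rabs_pos|apply (Hd 0)]).
    eapply Rle_trans; [apply HX with (d := C * (B * d))|].
    + intros q. eapply Rle_trans; [apply Lam_lip|]. apply Rmult_le_compat_l; auto.
      assert (KK : forall j, Rabs (fst a j q (snd a i q t2 x) - fst a j q (snd a i q t1 z)) <= B * d).
      { intros j. eapply Rle_trans; [apply Ha|]. apply Rmult_le_compat_l; auto.
        rewrite Rabs_minus_sym; auto. }
      generalize (KK Fwd) (KK Bwd); intros a1 a2. apply Rabs_le_iff in a1, a2.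
      unfold wv; apply Rabs_le_iff; lra.
    + assert (S2 := T_small2). assert (0 <= T * C) by (apply Rmult_le_pos; auto).
      replace (T * (C * (B * d))) with (T * C * B * d) by ring.
      assert (T * C * B <= / 2) by nra. nra.
Qed.

(** [Rnew] integrates from time 0. By the flow property both values have the same foot and the same
    integrand, so only the integral between [t1] and [t2] survives in the difference. *)
Lemma along_characteristic a i t1 t2 x : Base a ->
  (forall i t x, fst a i t x = fst (Step a) i t x) ->
  (forall i s t x, snd a i s t x = snd (Step a) i s t x) ->
  fst a i t2 x - fst a i t1 (snd a i t1 t2 x) =
  RInt (fun q => Rint a i q t2 x) (clamp 0 T t1) (clamp 0 T t2).
Proof.
  intros Ha Hf Hs. set (z := snd a i t1 t2 x).
  rewrite (Hf i t2 x), (Hf i t1 z). simpl. unfold Rnew, cint.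
  change (Ynew a i 0 t2 x) with (snd (Step a) i 0 t2 x).
  change (Ynew a i 0 t1 z) with (snd (Step a) i 0 t1 z).
  rewrite <- !Hs. unfold z at 1. rewrite (characteristic_flow a i t1 t2 x Ha Hs 0).
  assert (HU : UC3 (Rint a i)) by (apply Rint_UC, Ha).
  rewrite <- (RInt_Chasles_R (fun q => Rint a i q t2 x) (clamp 0 T 0) (clamp 0 T t1) (clamp 0 T t2))
      by (apply UC3_ex_RInt; auto).
  rewrite (RInt_ext (fun q => Rint a i q t1 z) (fun q => Rint a i q t2 x)); [ring|].
  intros q _. unfold Rint. unfold z. rewrite (characteristic_flow a i t1 t2 x Ha Hs q). auto.
Qed.

(** The difference quotient multiplied out: [s = t] needs no exclusion, and the derivative is
    one-sided or two-sided according to [I]. *)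
Definition pdt (I : R -> Prop) (f : R -> R -> R) (t x d : R) :=
  forall e, 0 < e -> exists dl, 0 < dl /\ forall s, I s -> Rabs (s - t) < dl ->
  Rabs (f s x - f t x - d * (s - t)) <= e * Rabs (s - t).

Lemma RInt_near F a b c e : ex_RInt F a b ->
  (forall q, Rmin a b <= q <= Rmax a b -> Rabs (F q - c) <= e) ->
  Rabs (RInt F a b - c * (b - a)) <= e * Rabs (b - a).
Proof.
  intros Hex H.
  assert (E : RInt (fun _ => c) a b = c * (b - a)).
  { rewrite (RInt_const (V := R_CompleteNormedModule)). unfold scal; simpl; unfold mult; simpl; ring. }
  rewrite <- E, Rmult_comm. apply RInt_diff_bound; auto. apply ex_RInt_const.
Qed.

(** The time increment at fixed [x] splits into the increment along the characteristic from [(t, x)]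
    to [(s, z)], which is the source integral, and the increment in space from [z] to [x] at time
    [s]. *)
Lemma solution_pdt a b i t x : Base a -> Fib b -> deriv_rel a b ->
  (forall i t x, fst a i t x = fst (Step a) i t x) ->
  (forall i s t x, snd a i s t x = snd (Step a) i s t x) ->
  0 <= t <= T ->
  pdt (fun s => 0 <= s <= T) (fst a i) t x
    (src i (fun j => fst a j t x) - sg i * Lam (wv (fst a) t x) * fst b i t x).
Proof.
  intros Ha Hb HD Hf Hs Ht e He.
  destruct Base_bounds_pos as [_ [HB _]].
  assert (Hytt : snd a i t t x = x).
  { rewrite Hs; simpl. unfold Ynew, cint. rewrite RInt_point. unfold zero; simpl; ring. }
  assert (HY : UC3 (Yint a i)) by (apply Yint_UC, Ha).
  assert (HR : UC3 (Rint a i)) by (apply Rint_UC, Ha).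
  assert (HYb := Yint_bound a i Ha).
  (* Three errors: of the source integral (weight 1), of the speed integral multiplied by [fst b]
     (weight [B]), and of [fst b] multiplied by the speed (weight [C]). *)
  set (e1 := e / (1 + B + C)).
  assert (He1 : 0 < e1) by (apply Rdiv_lt_0_compat; lra).
  assert (Ee : e1 * (1 + B + C) = e) by (unfold e1; field; lra).
  destruct (HY e1 He1) as [d1 [Hd1 K1]]. destruct (HR e1 He1) as [d2 [Hd2 K2]].
  destruct (proj1 (proj1 Hb) i e1 He1) as [d3 [Hd3 K3]].
  set (dl := Rmin (Rmin d1 d2) (d3 / (C + 1))).
  assert (Hdl : 0 < dl) by (repeat apply Rmin_pos; auto; apply Rdiv_lt_0_compat; lra).
  assert (L1 : dl <= d1 /\ dl <= d2 /\ dl <= d3 / (C + 1)).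
  { generalize (Rmin_l (Rmin d1 d2) (d3 / (C + 1))) (Rmin_r (Rmin d1 d2) (d3 / (C + 1)))
      (Rmin_l d1 d2) (Rmin_r d1 d2); fold dl; intros; lra. }
  exists dl; split; auto. intros s Is Hst.
  set (z := snd a i s t x).
  assert (Q1 : fst a i t x - fst a i s z = RInt (fun q => Rint a i q t x) s t).
  { unfold z; rewrite (along_characteristic a i s t x Ha Hf Hs), !clamp_id; auto. }
  assert (Q2 : x - z = sg i * RInt (fun q => Yint a i q t x) s t).
  { unfold z; rewrite Hs; simpl; unfold Ynew, cint; rewrite !clamp_id; auto; ring. }
  assert (Hbetween : forall q, Rmin s t <= q <= Rmax s t -> Rabs (q - t) < dl).
  { intros q; revert Hst; unfold Rmin, Rmax, Rabs; repeat destruct Rle_dec; repeat destruct Rcase_abs; lra. }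
  assert (N1 : Rabs (RInt (fun q => Rint a i q t x) s t - Rint a i t t x * (t - s)) <= e1 * Rabs (t - s)).
  { apply RInt_near; [apply UC3_ex_RInt; auto|]. intros q Hq. apply Hbetween in Hq.
    apply K2; try (rewrite Rminus_diag, Rabs_R0); lra. }
  assert (N2 : Rabs (RInt (fun q => Yint a i q t x) s t - Yint a i t t x * (t - s)) <= e1 * Rabs (t - s)).
  { apply RInt_near; [apply UC3_ex_RInt; auto|]. intros q Hq. apply Hbetween in Hq.
    apply K1; try (rewrite Rminus_diag, Rabs_R0); lra. }
  assert (N3 : Rabs (RInt (fun q => Yint a i q t x) s t) <= Rabs (t - s) * C).
  { apply RInt_le_bound; [apply UC3_ex_RInt; auto|auto]. }
  destruct (MVT_R (fst a i s) (fst b i s) z x) as [c [Hc E]]; [intros; apply HD|].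
  assert (Hcx : Rabs (c - x) <= Rabs (x - z)).
  { revert Hc; unfold Rmin, Rmax, Rabs; repeat destruct Rle_dec; repeat destruct Rcase_abs; lra. }
  assert (Hxz : Rabs (x - z) <= Rabs (t - s) * C) by (rewrite Q2; apply sg_mult_le; auto).
  rewrite (Rabs_minus_sym s t) in *.
  assert (Hcd : Rabs (c - x) <= d3).
  { assert (Rabs (t - s) * C <= dl * C) by (apply Rmult_le_compat_r; lra).
    assert (dl * (C + 1) <= d3).
    { replace d3 with (d3 / (C + 1) * (C + 1)) by (field; lra). apply Rmult_le_compat_r; lra. }
    lra. }
  assert (Hdd : dl <= d3).
  { assert (d3 / (C + 1) <= d3); [|lra]. 
    apply Rmult_le_reg_r with (C + 1); [lra|]. field_simplify; [nra|lra]. }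
  assert (N4 : Rabs (fst b i s c - fst b i t x) <= e1).
  { apply K3; [rewrite Rabs_minus_sym|]; lra. }
  set (IR := RInt (fun q => Rint a i q t x) s t) in *.
  set (IY := RInt (fun q => Yint a i q t x) s t) in *.
  unfold Rint in N1. unfold Yint in N2. rewrite Hytt in N1, N2.
  set (SR := src i (fun j => fst a j t x)) in *.
  set (L := Lam (wv (fst a) t x)) in *.
  replace (fst a i s x - fst a i t x - (SR - sg i * L * fst b i t x) * (s - t)) with
    (sg i * (fst b i s c * IY - fst b i t x * (L * (t - s))) - (IR - SR * (t - s))).
  2:{ assert (fst a i s x = fst a i s z + fst b i s c * (sg i * IY)) by (rewrite <- Q2; lra).
      rewrite H. replace (fst a i s z) with (fst a i t x - IR) by lra. ring. }
  assert (N5 : Rabs (sg i * (fst b i s c * IY - fst b i t x * (L * (t - s)))) <= B * (e1 * Rabs (t - s)) + Rabs (t - s) * C * e1).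
  { apply sg_mult_le. apply Rabs_mult_diff; auto. apply Hb. }
  rewrite <- Ee.
  eapply Rle_trans; [apply Rabs_triang|]. rewrite Rabs_Ropp. 
  replace (e1 * (1 + B + C) * Rabs (t - s)) with ((B * (e1 * Rabs (t - s)) + Rabs (t - s) * C * e1) + e1 * Rabs (t - s)) by ring.
  lra.
Qed.

(** The bound on [rho i t x - r0 i x] is there to keep [wv rho] in the interval on which a truncated
    speed [Lam] is the true one. *)
Theorem local_solution : exists rho p : fam -> R -> R -> R,
  (forall i, UC2 (rho i)) /\ (forall i, UC2 (p i)) /\
  (forall i t x, is_derive (rho i t) x (p i t x)) /\
  (forall i x, rho i 0 x = r0 i x) /\
  (forall i t x, Rabs (rho i t x - r0 i x) <= T * (B0 * C + A)) /\
  (forall i t x, 0 <= t <= T -> pdt (fun s => 0 <= s <= T) (rho i) t x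
    (src i (fun j => rho j t x) - sg i * Lam (wv rho t x) * p i t x)).
Proof.
  destruct local_fixpoint as [a [b [Ha [Hb [HD [Hf Hs]]]]]].
  exists (fst a), (fst b).
  split; [apply Ha|split; [apply Hb|split; [apply HD|]]].
  split; [|split].
  - intros i x. rewrite Hf; simpl. unfold Rnew, Ynew, cint. rewrite !RInt_point.
    unfold zero; simpl. rewrite Rmult_0_r, Rminus_0_r, Rplus_0_r; auto.
  - intros i t x. rewrite Hf; simpl. unfold Rnew.
    assert (K1 : Rabs (r0 i (Ynew a i 0 t x) - r0 i x) <= B0 * (T * C)).
    { eapply Rle_trans; [apply r0_lip|]. apply Rmult_le_compat_l; auto. unfold Ynew.
      replace (_ - _) with (sg i * - cint T (Yint a i) 0 t x) by ring. apply sg_mult_le.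
      rewrite Rabs_Ropp. apply cint_bound; auto. apply Yint_UC, Ha. apply Yint_bound; auto. }
    assert (K2 : Rabs (cint T (Rint a i) 0 t x) <= T * A).
    { apply cint_bound; auto. apply Rint_UC, Ha. apply Rint_bound; auto. }
    abs_lra.
  - intros; apply solution_pdt; auto.
Qed.
End Local.

(** * One-sided time derivatives and continuity on strips *)

Definition cto (I : R -> Prop) (f : R -> R -> R) :=
  forall t x, I t -> forall e, 0 < e -> exists d, 0 < d /\
  forall s y, I s -> Rabs (s - t) < d -> Rabs (y - x) < d -> Rabs (f s y - f t x) <= e.

Lemma cont_on_cto I f : cont_on I f <-> cto I f.
Proof.
  split.
  - intros H t x It e He.
    destruct (proj1 (filterlim_locally _ _) (H t x It) (mkposreal e He)) as [d Hd].
    exists d; split; [apply cond_pos|]. intros s y Is Hs Hy.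
    left. apply (Hd (s, y)); auto. split; auto.
  - intros H t x It. apply filterlim_locally. intros e.
    destruct (H t x It (e / 2)) as [d [Hd K]]; [destruct e; simpl; lra|].
    exists (mkposreal d Hd). intros [s y] [Hs Hy] Is. simpl in *.
    eapply Rle_lt_trans; [apply K; auto|]. destruct e; simpl; lra.
Qed.

Lemma pdt_within I f t x d : is_pdt_within I f t x d <-> pdt I f t x d.
Proof.
  split.
  - intros H e He.
    destruct (proj1 (filterlim_locally _ _) H (mkposreal e He)) as [dl Hd].
    exists dl; split; [apply cond_pos|]. intros s Is Hs.
    destruct (Req_dec s t) as [->|Hn].
    + rewrite !Rminus_diag, Rmult_0_r, Rminus_0_r, Rabs_R0; lra.
    + assert (K : Rabs ((f s x - f t x) / (s - t) - d) < e) by (apply (Hd s); auto).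
      replace (f s x - f t x - d * (s - t)) with (((f s x - f t x) / (s - t) - d) * (s - t)) by (field; lra).
      rewrite Rabs_mult. apply Rmult_le_compat_r; [apply Rabs_pos|lra].
  - intros H. apply filterlim_locally. intros [e He].
    destruct (H (e / 2)) as [dl [Hd K]]; [lra|].
    exists (mkposreal dl Hd). intros s Hs [Is Hn]. simpl.
    specialize (K s Is Hs).
    change (Rabs ((f s x - f t x) / (s - t) - d) < e).
    replace ((f s x - f t x) / (s - t) - d) with ((f s x - f t x - d * (s - t)) / (s - t)) by (field; lra).
    unfold Rdiv. rewrite Rabs_mult, Rabs_inv.
    assert (0 < Rabs (s - t)) by (apply Rabs_pos_lt; lra).
    apply Rmult_lt_reg_r with (Rabs (s - t)); auto.
    rewrite Rmult_assoc, Rinv_l by lra. nra.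
Qed.

Definition C1e (I : R -> Prop) (f ft fx : R -> R -> R) :=
  (forall t x, I t -> pdt I f t x (ft t x)) /\
  (forall t x, I t -> is_derive (f t) x (fx t x)) /\
  cont_on I f /\ cont_on I ft /\ cont_on I fx.

Lemma C1_on_C1e I f ft fx : C1_on I f ft fx <-> C1e I f ft fx.
Proof.
  split.
  - intros [H1 [H2 [H3 H4]]]. split; [|split; [|auto]].
    + intros t x It; apply pdt_within, H1; auto.
    + intros t x It; apply (proj2 (H1 t x It)).
  - intros [H1 [H2 [H3 [H4 H5]]]]. split; [|auto].
    intros t x It; split; [apply pdt_within; auto|apply H2; auto].
Qed.

Lemma cont_on_ext I f g : (forall t x, I t -> f t x = g t x) -> cont_on I f -> cont_on I g.
Proof.
  intros E H. apply cont_on_cto. apply cont_on_cto in H. intros t x It e He.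
  destruct (H t x It e He) as [d [Hd K]]. exists d; split; auto.
  intros; rewrite <- !E; auto.
Qed.

Lemma pdt_ext (I : R -> Prop) f g t x d : (forall t x, I t -> f t x = g t x) -> I t -> pdt I f t x d -> pdt I g t x d.
Proof.
  intros E It H e He. destruct (H e He) as [dl [Hd K]]; exists dl; split; auto.
  intros; rewrite <- !E; auto.
Qed.

Lemma cont_on_const (I : R -> Prop) c : cont_on I (fun _ _ => c).
Proof. intros t x _. apply filterlim_const. Qed.

Lemma cont_on_plus I f g : cont_on I f -> cont_on I g -> cont_on I (fun t x => f t x + g t x).
Proof.
  intros Hf Hg t x It.
  eapply (filterlim_comp_2 (G := locally (f t x)) (H := locally (g t x))); [apply (Hf t x It)|apply (Hg t x It)|].
  apply (filterlim_plus (V := R_NormedModule)).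
Qed.

Lemma cont_on_mult I f g : cont_on I f -> cont_on I g -> cont_on I (fun t x => f t x * g t x).
Proof.
  intros Hf Hg t x It.
  eapply (filterlim_comp_2 (G := locally (f t x)) (H := locally (g t x))); [apply (Hf t x It)|apply (Hg t x It)|].
  apply (filterlim_mult (K := R_AbsRing)).
Qed.

Lemma cont_on_comp (I : R -> Prop) g f : (forall t x, I t -> continuous g (f t x)) -> cont_on I f ->
  cont_on I (fun t x => g (f t x)).
Proof.
  intros Hg Hf t x It.
  eapply filterlim_comp; [apply (Hf t x It)|apply Hg; auto].
Qed.

Lemma cont_on_scal I c f : cont_on I f -> cont_on I (fun t x => c * f t x).
Proof. intros H; apply cont_on_mult; auto. apply cont_on_const. Qed.

Lemma cont_on_opp I f : cont_on I f -> cont_on I (fun t x => - f t x).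
Proof.
  intros H. apply (cont_on_ext I (fun t x => (-1) * f t x)); [intros; ring|apply cont_on_scal; auto].
Qed.

Lemma cont_on_minus I f g : cont_on I f -> cont_on I g -> cont_on I (fun t x => f t x - g t x).
Proof. intros Hf Hg; apply cont_on_plus; auto. apply cont_on_opp; auto. Qed.

Lemma cont_on_abs I f : cont_on I f -> cont_on I (fun t x => Rabs (f t x)).
Proof. intros H; apply (cont_on_comp I Rabs); auto. intros; apply continuous_Rabs. Qed.

Lemma Rmax_abs a b : Rmax a b = / 2 * (a + b + Rabs (a - b)).
Proof. unfold Rmax, Rabs; destruct Rle_dec, Rcase_abs; lra. Qed.

Lemma cont_on_max I f g : cont_on I f -> cont_on I g -> cont_on I (fun t x => Rmax (f t x) (g t x)).
Proof.
  intros Hf Hg. apply (cont_on_ext I (fun t x => / 2 * (f t x + g t x + Rabs (f t x - g t x)))).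
  - intros; rewrite Rmax_abs; auto.
  - apply cont_on_scal, cont_on_plus; [apply cont_on_plus; auto|apply cont_on_abs, cont_on_minus; auto].
Qed.

Lemma cont_on_time (I : R -> Prop) g : (forall t, continuous g t) -> cont_on I (fun t _ => g t).
Proof.
  intros Hg. apply (cont_on_comp I g (fun t _ => t)); auto.
  apply cont_on_cto. intros t x _ e He; exists e; split; auto. intros; lra.
Qed.

(** Serves for translations in [x] and for the retraction of a strip onto a cone in [clamp_cone], by
    which maxima over cones reduce to maxima over rectangles. *)
Lemma cont_on_subst (I : R -> Prop) f k C : 0 <= C ->
  (forall t s x y, Rabs (k s y - k t x) <= C * Rabs (s - t) + Rabs (y - x)) ->
  cont_on I f -> cont_on I (fun t x => f t (k t x)).
Proof.
  intros HC Hk Hf. apply cont_on_cto. apply cont_on_cto in Hf. intros t x It e He.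
  destruct (Hf t (k t x) It e He) as [d [Hd K]].
  assert (0 < d / (C + 1)) by (apply Rdiv_lt_0_compat; lra).
  assert (E : d / (C + 1) * (C + 1) = d) by (field; lra).
  assert (d / (C + 1) <= d) by nra.
  exists (d / (C + 1)); split; auto. intros s y Is Hs Hy. apply K; auto; [lra|].
  eapply Rle_lt_trans; [apply Hk|]. generalize (Rabs_pos (s - t)); nra.
Qed.

Lemma cont_on_sub (I J : R -> Prop) f : (forall t, J t -> I t) -> cont_on I f -> cont_on J f.
Proof.
  intros HJ H. apply cont_on_cto. apply cont_on_cto in H. intros t x Jt e He.
  destruct (H t x (HJ _ Jt) e He) as [d [Hd K]]. exists d; split; auto.
Qed.

Lemma C1e_sub (I J : R -> Prop) f ft fx : (forall t, J t -> I t) -> C1e I f ft fx -> C1e J f ft fx.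
Proof.
  intros HJ [H1 [H2 [H3 [H4 H5]]]].
  split; [|split; [|split; [|split]]]; eauto using cont_on_sub.
  intros t x Jt e He. destruct (H1 t x (HJ _ Jt) e He) as [d [Hd K]]; exists d; split; auto.
Qed.

Lemma pdt_plus I f g t x a b : pdt I f t x a -> pdt I g t x b ->
  pdt I (fun t x => f t x + g t x) t x (a + b).
Proof.
  intros Hf Hg e He. destruct (Hf (e / 2)) as [d1 [Hd1 K1]]; [lra|].
  destruct (Hg (e / 2)) as [d2 [Hd2 K2]]; [lra|].
  exists (Rmin d1 d2); split; [apply Rmin_pos; auto|]. intros s Is Hs.
  rmin_bounds d1 d2.
  specialize (K1 s Is ltac:(lra)). specialize (K2 s Is ltac:(lra)).
  abs_lra.
Qed.

Lemma pdt_comp I g f t x d dg : pdt I f t x d -> is_derive g (f t x) dg ->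
  pdt I (fun t x => g (f t x)) t x (dg * d).
Proof.
  intros Hf Hg e He. rewrite is_derive_eps in Hg.
  set (e1 := e / (2 * (Rabs d + 1))). set (e2 := Rmin 1 (e / (2 * (Rabs dg + 1)))).
  assert (P1 := Rabs_pos d). assert (P2 := Rabs_pos dg).
  assert (He1 : 0 < e1) by (apply Rdiv_lt_0_compat; lra).
  assert (He2 : 0 < e2) by (apply Rmin_pos; [lra|apply Rdiv_lt_0_compat; lra]).
  destruct (Hg e1 He1) as [d1 [Hd1 K1]]. destruct (Hf e2 He2) as [d2 [Hd2 K2]].
  set (d3 := d1 / (Rabs d + 2)).
  assert (Hd3 : 0 < d3) by (apply Rdiv_lt_0_compat; lra).
  exists (Rmin d2 d3); split; [apply Rmin_pos; auto|]. intros s Is Hs.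
  rmin_bounds d2 d3.
  specialize (K2 s Is ltac:(lra)).
  assert (E21 : e2 <= 1) by apply Rmin_l.
  assert (E22 : e2 <= e / (2 * (Rabs dg + 1))) by apply Rmin_r.
  assert (X : Rabs (f s x - f t x) <= (Rabs d + 1) * Rabs (s - t)).
  { replace (f s x - f t x) with ((f s x - f t x - d * (s - t)) + d * (s - t)) by ring.
    eapply Rle_trans; [apply Rabs_triang|]. rewrite Rabs_mult. generalize (Rabs_pos (s - t)); nra. }
  assert (E3 : d3 * (Rabs d + 2) = d1) by (unfold d3; field; lra).
  specialize (K1 (f s x)). 
  assert (Rabs (f s x - f t x) < d1) by (generalize (Rabs_pos (s - t)); nra).
  specialize (K1 H).
  replace (g (f s x) - g (f t x) - dg * d * (s - t)) with
    ((g (f s x) - g (f t x) - dg * (f s x - f t x)) + dg * (f s x - f t x - d * (s - t))) by ring.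
  eapply Rle_trans; [apply Rabs_triang|].
  assert (Y : Rabs (dg * (f s x - f t x - d * (s - t))) <= Rabs dg * (e2 * Rabs (s - t))).
  { rewrite Rabs_mult. apply Rmult_le_compat_l; auto. }
  assert (Ee1 : e1 * (2 * (Rabs d + 1)) = e) by (unfold e1; field; lra).
  assert (Ee2 : e / (2 * (Rabs dg + 1)) * (2 * (Rabs dg + 1)) = e) by (field; lra).
  assert (e1 * Rabs (f s x - f t x) <= e1 * ((Rabs d + 1) * Rabs (s - t))) by (apply Rmult_le_compat_l; lra).
  assert (Rabs dg * e2 <= e / 2) by nra.
  assert (P3 := Rabs_pos (s - t)).
  assert (Rabs dg * e2 * Rabs (s - t) <= e / 2 * Rabs (s - t)) by (apply Rmult_le_compat_r; auto).
  nra.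
Qed.

Lemma pdt_scal I c f t x d : pdt I f t x d -> pdt I (fun t x => c * f t x) t x (c * d).
Proof.
  intros H. apply (pdt_comp I (fun z => c * z)); auto.
  auto_derive; auto; ring.
Qed.

Lemma C1e_ext (I : R -> Prop) f ft fx g gt gx : (forall t x, I t -> f t x = g t x) ->
  (forall t x, I t -> ft t x = gt t x) -> (forall t x, I t -> fx t x = gx t x) ->
  C1e I f ft fx -> C1e I g gt gx.
Proof.
  intros E Et Ex [H1 [H2 [H3 [H4 H5]]]].
  split; [|split; [|split; [|split]]]; eauto using cont_on_ext.
  - intros t x It. rewrite <- Et; auto. eapply pdt_ext; eauto.
  - intros t x It. rewrite <- Ex; auto. eapply is_derive_ext; [|apply H2; auto]. intros; auto.
Qed.

Lemma C1e_plus I f ft fx g gt gx : C1e I f ft fx -> C1e I g gt gx ->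
  C1e I (fun t x => f t x + g t x) (fun t x => ft t x + gt t x) (fun t x => fx t x + gx t x).
Proof.
  intros [H1 [H2 [H3 [H4 H5]]]] [G1 [G2 [G3 [G4 G5]]]].
  split; [|split; [|split; [|split]]]; auto using cont_on_plus.
  - intros; apply pdt_plus; auto.
  - intros; apply (is_derive_plus (V := R_NormedModule)); auto.
Qed.

Lemma C1e_comp (I : R -> Prop) g g' f ft fx :
  (forall t x, I t -> is_derive g (f t x) (g' (f t x))) ->
  (forall t x, I t -> continuous g' (f t x)) -> C1e I f ft fx ->
  C1e I (fun t x => g (f t x)) (fun t x => g' (f t x) * ft t x) (fun t x => g' (f t x) * fx t x).
Proof.
  intros D K [H1 [H2 [H3 [H4 H5]]]].
  assert (Q : cont_on I (fun t x => g' (f t x))) by (apply cont_on_comp; auto).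
  split; [|split; [|split; [|split]]]; auto using cont_on_mult.
  - intros; apply pdt_comp; auto.
  - intros. rewrite Rmult_comm. apply (is_derive_comp g (f t)); auto.
  - apply cont_on_comp; auto. intros. apply ex_derive_cont.
    exists (g' (f t x)); auto.
Qed.

Lemma C1e_scal I c f ft fx : C1e I f ft fx ->
  C1e I (fun t x => c * f t x) (fun t x => c * ft t x) (fun t x => c * fx t x).
Proof.
  intros H. apply (C1e_comp I (fun z => c * z) (fun _ => c)); auto.
  - intros. auto_derive; auto; ring.
  - intros. apply continuous_const.
Qed.

Lemma C1e_sqr I f ft fx : C1e I f ft fx ->
  C1e I (fun t x => f t x * f t x) (fun t x => 2 * f t x * ft t x) (fun t x => 2 * f t x * fx t x).
Proof.
  intros H. apply (C1e_comp I (fun z => z * z) (fun z => 2 * z)); auto.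
  - intros. auto_derive; auto. ring.
  - intros. apply ex_derive_cont. auto_derive; auto.
Qed.

(** Polarization: a product is a combination of squares of [f], [g] and [f + g], and a square is a
    composition with a function of one variable. *)
Lemma C1e_mult I f ft fx g gt gx : C1e I f ft fx -> C1e I g gt gx ->
  C1e I (fun t x => f t x * g t x) (fun t x => ft t x * g t x + f t x * gt t x)
    (fun t x => fx t x * g t x + f t x * gx t x).
Proof.
  intros Hf Hg.
  assert (S1 := C1e_sqr _ _ _ _ Hf). assert (S2 := C1e_sqr _ _ _ _ Hg).
  assert (S3 := C1e_sqr _ _ _ _ (C1e_plus _ _ _ _ _ _ _ Hf Hg)).
  assert (S4 := C1e_scal _ (-1) _ _ _ (C1e_plus _ _ _ _ _ _ _ S1 S2)).
  assert (S5 := C1e_scal _ (/ 2) _ _ _ (C1e_plus _ _ _ _ _ _ _ S3 S4)).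
  revert S5. apply C1e_ext; intros; field.
Qed.

Lemma cto_clamp_2d T f : 0 <= T -> cont_on (fun t => 0 <= t <= T) f ->
  forall t x, continuity_2d_pt (fun t x => f (clamp 0 T t) x) t x.
Proof.
  intros HT Hf t x [e He]. apply cont_on_cto in Hf.
  destruct (Hf (clamp 0 T t) x (clamp_in 0 T t HT) (e / 2)) as [d [Hd K]]; [lra|].
  exists (mkposreal d Hd). intros s y Hs Hy. simpl in *.
  eapply Rle_lt_trans; [apply K; auto|lra].
  - apply clamp_in; auto.
  - eapply Rle_lt_trans; [apply clamp_lip|auto].
Qed.

Lemma rect_unif T f a b e : 0 <= T -> cont_on (fun t => 0 <= t <= T) f -> 0 < e ->
  exists d, 0 < d /\ forall t s x y, 0 <= t <= T -> 0 <= s <= T -> a <= x <= b -> a <= y <= b ->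
  Rabs (t - s) < d -> Rabs (x - y) < d -> Rabs (f t x - f s y) < e.
Proof.
  intros HT Hf He.
  destruct (uniform_continuity_2d (fun t x => f (clamp 0 T t) x) 0 T a b
    (fun t x _ _ => cto_clamp_2d T f HT Hf t x) (mkposreal e He)) as [[d Hd] K].
  exists d; split; auto. intros t s x y Ht Hs Hx Hy H1 H2.
  specialize (K s y t x Hs Hy Ht Hx H1 H2). rewrite !clamp_id in K; auto.
Qed.

(** The maximizers [X t] on the time slices are chosen without any regularity in [t]; the maximal
    value is still continuous in [t], by uniform continuity of [f]. *)
Lemma rect_max T f a b : 0 <= T -> a <= b -> cont_on (fun t => 0 <= t <= T) f ->
  exists t x, 0 <= t <= T /\ a <= x <= b /\ forall s y, 0 <= s <= T -> a <= y <= b -> f s y <= f t x.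
Proof.
  intros HT Hab Hf.
  assert (H1 : forall t, exists x, a <= x <= b /\ forall y, a <= y <= b -> f (clamp 0 T t) y <= f (clamp 0 T t) x).
  { intros t. destruct (continuity_ab_maj (f (clamp 0 T t)) a b Hab) as [m [Hm1 Hm2]].
    - intros c _. apply continuity_pt_filterlim. 
      apply filterlim_locally. intros eps.
      destruct (cto_clamp_2d T f HT Hf t c eps) as [d Hd].
      exists d. intros y Hy. apply Hd; auto. rewrite Rminus_diag, Rabs_R0. apply cond_pos.
    - exists m; auto. }
  apply functional_choice in H1. destruct H1 as [X HX].
  destruct (continuity_ab_maj (fun t => f (clamp 0 T t) (X t)) 0 T HT) as [m [Hm1 Hm2]].
  { intros c _ e He. destruct (rect_unif T f a b e HT Hf He) as [d [Hd K]].
    exists d; split; auto. intros s [_ Hs]. unfold dist in *; simpl in *; unfold R_dist in *.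
    assert (Hcs : Rabs (clamp 0 T s - clamp 0 T c) < d) by (eapply Rle_lt_trans; [apply clamp_lip|auto]).
    assert (G1 := clamp_in 0 T s HT). assert (G2 := clamp_in 0 T c HT).
    destruct (HX s) as [S1 S2]. destruct (HX c) as [C1 C2].
    assert (K1 := K (clamp 0 T s) (clamp 0 T c) (X s) (X s) G1 G2 S1 S1 Hcs ltac:(rewrite Rminus_diag, Rabs_R0; auto)).
    assert (K2 := K (clamp 0 T s) (clamp 0 T c) (X c) (X c) G1 G2 C1 C1 Hcs ltac:(rewrite Rminus_diag, Rabs_R0; auto)).
    specialize (S2 (X c) C1). specialize (C2 (X s) S1).
    apply Rabs_def2 in K1. apply Rabs_def2 in K2. apply Rabs_def1; lra. }
  exists m, (X m). split; auto. destruct (HX m) as [M1 M2]. split; auto.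
  intros s y Hs Hy. specialize (Hm1 s Hs). rewrite !clamp_id in Hm1; auto.
  destruct (HX s) as [S1 S2]. specialize (S2 y Hy). rewrite clamp_id in S2; auto. lra.
Qed.

(** * Riemann invariants, finite propagation and the maximum principle *)

Lemma is_derive_Rpower a x : 0 < x -> is_derive (fun x => Rpower x a) x (a * Rpower x (a - 1)).
Proof. intros Hx. apply is_derive_Reals, derivable_pt_lim_power; auto. Qed.

Lemma continuous_Rpower a x : 0 < x -> continuous (fun x => Rpower x a) x.
Proof.
  intros Hx. apply ex_derive_cont.
  eexists; apply is_derive_Rpower; auto.
Qed.

Lemma Rpower_2 x : 0 < x -> Rpower x 2 = x ^ 2.
Proof. intros Hx. replace 2 with (INR 2) by (simpl; ring). apply Rpower_pow; auto. Qed.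

Lemma aw_sqr g h : 0 < h -> Rpower h ((g - 3) / 2) * h ^ 2 = Rpower h ((g + 1) / 2).
Proof.
  intros Hh. rewrite <- Rpower_2, <- Rpower_plus by auto. f_equal; field.
Qed.

Lemma aw_lam g h : Rpower h ((g + 1) / 2) * Rpower h ((g - 3) / 2) = Rpower h (g - 1).
Proof. rewrite <- Rpower_plus. f_equal; field. Qed.

(** The equations sit in the time derivative slots of [C1e], so that each [C1e] fact states
    regularity and an equation at once. *)
Definition csol (g : R) (I : R -> Prop) (h u v hx ux vx : R -> R -> R) :=
  C1e I h (fun t x => - (h t x) ^ 2 * ux t x) hx /\
  C1e I u (fun t x => v t x - Rpower (h t x) (g - 1) * hx t x) ux /\
  C1e I v (fun t x => - u t x) vx /\
  (forall t x, I t -> 0 < h t x).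

Lemma Derive_pressure g (h : R -> R) hx x : g <> 0 -> 0 < h x -> is_derive h x hx ->
  Derive (fun y => Rpower (h y) g / g) x = Rpower (h x) (g - 1) * hx.
Proof.
  intros Hg Hh D. apply is_derive_unique.
  replace (Rpower (h x) (g - 1) * hx) with (/ g * (hx * (g * Rpower (h x) (g - 1)))) by (field; auto).
  apply (is_derive_ext (fun y => / g * Rpower (h y) g)); [intros; simpl; field; auto|].
  apply (is_derive_scal (fun y => Rpower (h y) g)).
  apply (is_derive_comp (fun z => Rpower z g) h); auto. apply is_derive_Rpower; auto.
Qed.

Lemma classical_csol g I h u v : g <> 0 ->
  (classical_sol g I h u v <-> exists hx ux vx, csol g I h u v hx ux vx).
Proof.
  intros Hg. split.
  - intros [ht [hx [ut [ux [vt [vx [H1 [H2 [H3 [H4 H5]]]]]]]]]].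
    apply C1_on_C1e in H1, H2, H3. exists hx, ux, vx.
    split; [|split; [|split]]; auto.
    + revert H1; apply C1e_ext; auto. intros t x It. destruct (H5 t x It) as [E _]. simpl in *; lra.
    + assert (HD := H1). destruct HD as [_ [HD _]].
      revert H2; apply C1e_ext; auto. intros t x It. destruct (H5 t x It) as [_ [E _]].
      rewrite (Derive_pressure g (h t) (hx t x)) in E; auto. lra.
    + revert H3; apply C1e_ext; auto. intros t x It. destruct (H5 t x It) as [_ [_ E]]. lra.
  - intros [hx [ux [vx [H1 [H2 [H3 H4]]]]]].
    exists (fun t x => - (h t x) ^ 2 * ux t x), hx,
      (fun t x => v t x - Rpower (h t x) (g - 1) * hx t x), ux, (fun t x => - u t x), vx.
    split; [apply C1_on_C1e; auto|]. split; [apply C1_on_C1e; auto|]. split; [apply C1_on_C1e; auto|].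
    split; auto. intros t x It. split; [ring|]. split; [|ring].
    rewrite (Derive_pressure g (h t) (hx t x)); auto; [ring|]. apply H1; auto.
Qed.

(* The Riemann invariants are [u + phi h] and [u - phi h]. *)
Definition phi (g h : R) : R :=
  if Req_EM_T g 1 then ln h else 2 / (g - 1) * (Rpower h ((g - 1) / 2) - 1).

Definition hinv (g w : R) : R :=
  if Req_EM_T g 1 then exp w else Rpower (1 + (g - 1) / 2 * w) (2 / (g - 1)).

Lemma is_derive_phi g h : 0 < h -> is_derive (phi g) h (Rpower h ((g - 3) / 2)).
Proof.
  intros Hh. unfold phi. destruct (Req_EM_T g 1) as [->|Hg].
  - replace ((1 - 3) / 2) with (- (1)) by field. rewrite Rpower_Ropp, Rpower_1 by auto.
    apply is_derive_Reals, derivable_pt_lim_ln; auto.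
  - replace (Rpower h ((g - 3) / 2)) with
      (2 / (g - 1) * ((g - 1) / 2 * Rpower h ((g - 1) / 2 - 1) - 0)).
    + apply (is_derive_scal (fun h => Rpower h ((g - 1) / 2) - 1)).
      apply (is_derive_minus (V := R_NormedModule)); [apply is_derive_Rpower; auto|].
      apply (is_derive_const (V := R_NormedModule)).
    + replace ((g - 1) / 2 - 1) with ((g - 3) / 2) by field. field. lra.
Qed.

Lemma phi_1 g : phi g 1 = 0.
Proof.
  unfold phi. destruct Req_EM_T; [apply ln_1|]. unfold Rpower. rewrite ln_1, Rmult_0_r, exp_0. ring.
Qed.

Lemma hinv_phi g h : 0 < h -> hinv g (phi g h) = h.
Proof.
  intros Hh. unfold hinv, phi. destruct (Req_EM_T g 1) as [|Hg]; [apply exp_ln; auto|].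
  replace (1 + (g - 1) / 2 * (2 / (g - 1) * (Rpower h ((g - 1) / 2) - 1))) with (Rpower h ((g - 1) / 2)) by (field; lra).
  rewrite Rpower_mult. replace ((g - 1) / 2 * (2 / (g - 1))) with 1 by (field; lra). apply Rpower_1; auto.
Qed.

Lemma hinv_0 g : hinv g 0 = 1.
Proof. rewrite <- (phi_1 g). apply hinv_phi; lra. Qed.

(* away from [g = 1] the range of [phi] is bounded below *)
Definition inrange (g w : R) := g = 1 \/ 0 < 1 + (g - 1) / 2 * w.

Lemma phi_hinv g w : inrange g w -> phi g (hinv g w) = w.
Proof.
  intros Hw. unfold hinv, phi. destruct (Req_EM_T g 1) as [|Hg]; [apply ln_exp|].
  destruct Hw as [|Hw]; [contradiction|].
  rewrite Rpower_mult. replace (2 / (g - 1) * ((g - 1) / 2)) with 1 by (field; lra).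
  rewrite Rpower_1 by auto. field; lra.
Qed.

Lemma hinv_pos g w : 0 < hinv g w.
Proof. unfold hinv. destruct Req_EM_T; apply exp_pos. Qed.

Lemma inrange_phi g h : 0 < h -> inrange g (phi g h).
Proof.
  intros Hh. unfold inrange, phi. destruct (Req_EM_T g 1) as [|Hg]; [left; auto|right].
  replace (1 + (g - 1) / 2 * (2 / (g - 1) * (Rpower h ((g - 1) / 2) - 1))) with (Rpower h ((g - 1) / 2)) by (field; lra).
  apply exp_pos.
Qed.

Lemma inrange_mono g w w' : 1 <= g -> inrange g w -> w <= w' -> inrange g w'.
Proof. intros Hg [->|Hw] H; [left; auto|right]. nra. Qed.

Lemma inrange_pos g w : 1 <= g -> 0 <= w -> inrange g w.
Proof. intros Hg H; right; nra. Qed.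

Lemma phi_incr g h h' : 0 < h -> h < h' -> phi g h < phi g h'.
Proof.
  intros Hh Hlt.
  destruct (MVT_gen (phi g) h h' (fun z => Rpower z ((g - 3) / 2))) as [c [Hc E]].
  - rewrite Rmin_left, Rmax_right by lra. intros; apply is_derive_phi; lra.
  - rewrite Rmin_left, Rmax_right by lra. intros. apply continuity_pt_filterlim.
    apply ex_derive_cont. eexists; apply is_derive_phi; lra.
  - assert (0 < Rpower c ((g - 3) / 2)) by apply exp_pos. nra.
Qed.

Lemma phi_le_inv g h h' : 0 < h' -> phi g h <= phi g h' -> 0 < h -> h <= h'.
Proof.
  intros H0 H Hh. destruct (Rle_dec h h'); auto. exfalso.
  assert (phi g h' < phi g h) by (apply phi_incr; lra). lra.
Qed.

Definition riem (g : R) (h u v : R -> R -> R) (i : fam) (t x : R) : R :=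
  match i with Fwd => u t x + phi g (h t x) | Bwd => u t x - phi g (h t x) | Still => v t x end.

Definition riemx (g : R) (h hx ux vx : R -> R -> R) (i : fam) (t x : R) : R :=
  match i with
  | Fwd => ux t x + Rpower (h t x) ((g - 3) / 2) * hx t x
  | Bwd => ux t x - Rpower (h t x) ((g - 3) / 2) * hx t x
  | Still => vx t x
  end.

Definition dsol (I : R -> Prop) (lam : R -> R -> R) (r rx : fam -> R -> R -> R) :=
  forall i, C1e I (r i) (fun t x => src i (fun j => r j t x) - sg i * lam t x * rx i t x) (rx i).

Definition speed (g : R) (h : R -> R -> R) (t x : R) := Rpower (h t x) ((g + 1) / 2).

Lemma csol_dsol g I h u v hx ux vx : csol g I h u v hx ux vx ->
  dsol I (speed g h) (riem g h u v) (riemx g h hx ux vx).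
Proof.
  intros [H1 [H2 [H3 H4]]].
  assert (HP := C1e_comp I (phi g) (fun z => Rpower z ((g - 3) / 2)) _ _ _
    (fun t x It => is_derive_phi g _ (H4 t x It))
    (fun t x It => continuous_Rpower _ _ (H4 t x It)) H1).
  intros [| |].
  - generalize (C1e_plus _ _ _ _ _ _ _ H2 HP). apply C1e_ext; intros t x It; simpl; auto.
    unfold speed. rewrite <- (aw_lam g), <- (aw_sqr g _ (H4 t x It)). simpl. ring.
  - generalize (C1e_plus _ _ _ _ _ _ _ H2 (C1e_scal _ (-1) _ _ _ HP)).
    apply C1e_ext; intros t x It; simpl; try ring.
    unfold speed. rewrite <- (aw_lam g), <- (aw_sqr g _ (H4 t x It)). simpl. ring.
  - revert H3. apply C1e_ext; intros t x It; simpl; auto. field.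
Qed.

(** The displacement is split into a move in [x] at time [t - d] and a move in time at fixed [x];
    the first is a mean value of [fx], controlled by its joint continuity. *)
Lemma directional I f ft fx t x c e : C1e I f ft fx -> I t -> 0 < t -> (forall s, 0 <= s <= t -> I s) -> 0 < e ->
  exists d0, 0 < d0 /\ forall d, 0 < d < d0 ->
  Rabs (f (t - d) (x - c * d) - f t x + d * (ft t x + c * fx t x)) <= e * d.
Proof.
  intros [H1 [H2 [H3 [H4 H5]]]] It Ht HI He. apply cont_on_cto in H5.
  assert (Pc := Rabs_pos c).
  set (e1 := e / (2 * (Rabs c + 1))). assert (He1 : 0 < e1) by (apply Rdiv_lt_0_compat; lra).
  assert (Ee1 : e1 * (2 * (Rabs c + 1)) = e) by (unfold e1; field; lra).
  destruct (H1 t x It (e / 2) ltac:(lra)) as [d1 [Hd1 K1]].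
  destruct (H5 t x It e1 He1) as [d2 [Hd2 K2]].
  set (d3 := d2 / (Rabs c + 1)). assert (Hd3 : 0 < d3) by (apply Rdiv_lt_0_compat; lra).
  assert (Ed3 : d3 * (Rabs c + 1) = d2) by (unfold d3; field; lra).
  exists (Rmin t (Rmin d1 d3)). split; [repeat apply Rmin_pos; auto|].
  intros d Hd.
  rmin_bounds t (Rmin d1 d3).
  rmin_bounds d1 d3.
  assert (Is : I (t - d)) by (apply HI; lra).
  specialize (K1 (t - d) Is). replace (t - d - t) with (- d) in K1 by ring.
  rewrite Rabs_Ropp, (Rabs_right d) in K1 by lra. specialize (K1 ltac:(lra)).
  destruct (MVT_gen (f (t - d)) x (x - c * d) (fx (t - d))) as [z [Hz E]].
  { intros; apply H2; auto. }
  { intros. apply continuity_pt_filterlim.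
    apply ex_derive_cont. eexists; apply H2; auto. }
  assert (Hzx : Rabs (z - x) <= Rabs c * d).
  { replace (Rabs c * d) with (Rabs (c * d)) by (rewrite Rabs_mult, (Rabs_right d); lra).
    revert Hz; unfold Rmin, Rmax, Rabs; repeat destruct Rle_dec; repeat destruct Rcase_abs; lra. }
  assert (K3 : Rabs (fx (t - d) z - fx t x) <= e1).
  { apply K2; auto.
    - replace (t - d - t) with (- d) by ring. rewrite Rabs_Ropp, Rabs_right by lra. nra.
    - nra. }
  replace (f (t - d) (x - c * d) - f t x + d * (ft t x + c * fx t x)) with
    ((f (t - d) (x - c * d) - f (t - d) x + c * d * fx t x) + (f (t - d) x - f t x - ft t x * - d)) by ring.
  rewrite E.
  replace (fx (t - d) z * (x - c * d - x) + c * d * fx t x) with (- (c * d) * (fx (t - d) z - fx t x)) by ring.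
  eapply Rle_trans; [apply Rabs_triang|].
  assert (Rabs (- (c * d) * (fx (t - d) z - fx t x)) <= Rabs c * d * e1).
  { rewrite Rabs_mult, Rabs_Ropp, Rabs_mult, (Rabs_right d) by lra. apply Rmult_le_compat_l; auto.
    apply Rmult_le_pos; lra. }
  nra.
Qed.

Definition norm3 (r : fam -> R) := Rmax (Rabs (r Fwd)) (Rmax (Rabs (r Bwd)) (Rabs (r Still))).

Lemma norm3_le r i : Rabs (r i) <= norm3 r.
Proof.
  unfold norm3. destruct i; unfold Rmax; repeat destruct Rle_dec; lra.
Qed.

Lemma norm3_att r : exists i, norm3 r = Rabs (r i).
Proof.
  unfold norm3, Rmax at 1. destruct Rle_dec.
  - unfold Rmax. destruct Rle_dec; [exists Still|exists Bwd]; auto.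
  - exists Fwd; auto.
Qed.

Lemma cont_on_norm3 I r : (forall i, cont_on I (r i)) -> cont_on I (fun t x => norm3 (fun i => r i t x)).
Proof. intros H. unfold norm3. repeat apply cont_on_max; apply cont_on_abs; auto. Qed.

Lemma exp_opp_le y : 0 <= y -> exp (- y) * (1 + y) <= 1.
Proof.
  intros Hy. rewrite exp_Ropp. assert (0 < exp y) by apply exp_pos.
  assert (1 + y <= exp y).
  { destruct (Req_dec y 0) as [->|]; [rewrite exp_0; lra|]. left; apply exp_ineq1; lra. }
  apply Rmult_le_reg_l with (exp y); auto. rewrite <- Rmult_assoc, Rinv_r by lra. lra.
Qed.

(* At a positive time, a maximum point of the exponentially weighted norm could be left
   backwards along the characteristic of the maximal component. *)
Lemma max_principle T lam r rx (Om : R -> R -> Prop) ts xs m :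
  dsol (fun t => 0 <= t <= T) lam r rx ->
  (forall t x, Om t x -> 0 <= t <= T) ->
  Om ts xs ->
  (forall t x, Om t x -> exp (- (2 * t)) * norm3 (fun i => r i t x) <=
                         exp (- (2 * ts)) * norm3 (fun i => r i ts xs)) ->
  (forall t x c, Om t x -> 0 < t -> Rabs c <= Rabs (lam t x) ->
     exists d0, 0 < d0 /\ forall d, 0 < d < d0 -> Om (t - d) (x - c * d)) ->
  0 <= m -> (forall x, Om 0 x -> norm3 (fun i => r i 0 x) <= m) ->
  forall t x, Om t x -> norm3 (fun i => r i t x) <= m * exp (2 * t).
Proof.
  intros Hr HOT HOs Hmax Hback Hm Hinit t x HO.
  assert (Hconc : exp (- (2 * ts)) * norm3 (fun i => r i ts xs) <= m ->
     norm3 (fun i => r i t x) <= m * exp (2 * t)).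
  { intros H. specialize (Hmax t x HO).
    assert (0 < exp (2 * t)) by apply exp_pos.
    rewrite exp_Ropp in Hmax at 1.
    apply Rmult_le_reg_l with (/ exp (2 * t)); [apply Rinv_0_lt_compat; auto|].
    replace (/ exp (2 * t) * (m * exp (2 * t))) with m by (field; lra). lra. }
  apply Hconc. destruct (HOT _ _ HOs) as [Hts1 Hts2].
  destruct (Req_dec ts 0) as [->|Hts].
  { rewrite Rmult_0_r, Ropp_0, exp_0, Rmult_1_l. auto. }
  destruct (norm3_att (fun i => r i ts xs)) as [i Hi].
  destruct (Rle_dec (norm3 (fun i => r i ts xs)) 0) as [|Hpos].
  { assert (0 < exp (- (2 * ts))) by apply exp_pos. nra. }
  exfalso. apply Rnot_le_lt in Hpos. set (G := norm3 (fun i => r i ts xs)) in *.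
  assert (Hc : Rabs (sg i * lam ts xs) <= Rabs (lam ts xs)).
  { rewrite Rabs_mult. rewrite <- (Rmult_1_l (Rabs (lam ts xs))) at 2.
    apply Rmult_le_compat_r; [apply Rabs_pos|apply Rabs_sg]. }
  destruct (Hback ts xs (sg i * lam ts xs) HOs ltac:(lra) Hc) as [d1 [Hd1 K1]].
  destruct (directional _ _ _ _ ts xs (sg i * lam ts xs) (G / 4) (Hr i) ltac:(lra) ltac:(lra)
     ltac:(intros; lra) ltac:(lra)) as [d2 [Hd2 K2]].
  (* Over the time [d] the source changes the component by at most [G * d], the expansion error is
     [G / 4 * d], and the weight decays at rate 2. Since [(1 - 5 / 4 * d) * (1 + 2 * d) > 1] for
     [0 < d < / 8], maximality is contradicted. *)
  set (d := Rmin (/ 8) (Rmin d1 d2) / 2).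
  rmin_bounds (/ 8) (Rmin d1 d2).
  rmin_bounds d1 d2.
  assert (0 < Rmin (/ 8) (Rmin d1 d2)) by (repeat apply Rmin_pos; lra).
  assert (Hd : 0 < d /\ d < / 8 /\ d < d1 /\ d < d2) by (unfold d; lra).
  specialize (K1 d ltac:(lra)). specialize (K2 d ltac:(lra)).
  replace (src i (fun j => r j ts xs) - sg i * lam ts xs * rx i ts xs + sg i * lam ts xs * rx i ts xs)
    with (src i (fun j => r j ts xs)) in K2 by ring.
  assert (HS : Rabs (src i (fun j => r j ts xs)) <= G) by (apply src_bound; intros; apply (norm3_le (fun i => r i ts xs))).
  specialize (Hmax _ _ K1).
  set (N := norm3 (fun j => r j (ts - d) (xs - sg i * lam ts xs * d))) in *.
  assert (HN : N <= exp (- (2 * d)) * G).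
  { assert (E : exp (- (2 * ts)) = exp (- (2 * (ts - d))) * exp (- (2 * d))).
    { rewrite <- exp_plus. f_equal; ring. }
    rewrite E in Hmax. eapply Rmult_le_reg_l; [apply (exp_pos (- (2 * (ts - d))))|rewrite <- Rmult_assoc]. exact Hmax. }
  assert (HrN : Rabs (r i (ts - d) (xs - sg i * lam ts xs * d)) <= N).
  { unfold N. apply (norm3_le (fun j => r j (ts - d) (xs - sg i * lam ts xs * d)) i). }
  assert (Hexp := exp_opp_le (2 * d) ltac:(lra)).
  assert (HG : G * (1 - d) - G / 4 * d <= Rabs (r i (ts - d) (xs - sg i * lam ts xs * d))).
  { revert K2 HS Hi. generalize (src i (fun j => r j ts xs)) (r i (ts - d) (xs - sg i * lam ts xs * d)) (r i ts xs).
    intros S1 R1 R2 K2 HS Hi. apply Rabs_le_iff in K2, HS.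
    assert (- (d * G) <= d * S1 <= d * G) by nra.
    revert Hi; unfold Rabs; repeat destruct Rcase_abs; lra. }
  assert (X : (G * (1 - d) - G / 4 * d) * (1 + 2 * d) <= G).
  { apply Rle_trans with (exp (- (2 * d)) * G * (1 + 2 * d)); [apply Rmult_le_compat_r; lra|].
    replace (exp (- (2 * d)) * G * (1 + 2 * d)) with (G * (exp (- (2 * d)) * (1 + 2 * d))) by ring. nra. }
  assert (0 < G * d) by nra. nra.
Qed.

Lemma clamp_cone a b t s x y :
  Rabs (clamp (a + 2 * s) (b - 2 * s) y - clamp (a + 2 * t) (b - 2 * t) x) <= 2 * Rabs (s - t) + Rabs (y - x).
Proof.
  unfold clamp, Rmax, Rmin; repeat destruct Rle_dec; unfold Rabs; repeat destruct Rcase_abs; lra.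
Qed.

Section Cone.
Variables (T : R) (lam : R -> R -> R) (r rx : fam -> R -> R -> R).
Hypothesis HT : 0 <= T.
Hypothesis Hr : dsol (fun t => 0 <= t <= T) lam r rx.
Hypothesis Hlam : cont_on (fun t => 0 <= t <= T) lam.
Hypothesis Hlam1 : forall t x, 0 <= t <= T -> (forall i, r i t x = 0) -> lam t x = 1.

(** Where the speed is at most 2, backward characteristics do not leave a cone with sides of slope
    2, so the maximum principle applies with the initial bound 0. *)
Lemma cone_step a b t1 : 0 <= t1 <= T -> a + 2 * t1 <= b - 2 * t1 ->
  (forall x i, a <= x <= b -> r i 0 x = 0) ->
  (forall t x, 0 <= t <= t1 -> a + 2 * t <= x <= b - 2 * t -> Rabs (lam t x) <= 2) ->
  forall t x, 0 <= t <= t1 -> a + 2 * t <= x <= b - 2 * t -> forall i, r i t x = 0.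
Proof.
  intros Ht1 Hab Hinit Hl.
  set (Om := fun t x => 0 <= t <= t1 /\ a + 2 * t <= x <= b - 2 * t).
  set (G := fun t x => exp (- (2 * t)) * norm3 (fun i => r i t x)).
  assert (HG : cont_on (fun t => 0 <= t <= t1) G).
  { apply cont_on_sub with (fun t => 0 <= t <= T); [intros; lra|].
    apply cont_on_mult; [|apply cont_on_norm3; intros i; apply (Hr i)].
    apply (cont_on_time _ (fun t => exp (- (2 * t)))). intros t.
    apply ex_derive_cont. auto_derive; auto. }
  assert (HG2 := cont_on_subst _ _ (fun t x => clamp (a + 2 * t) (b - 2 * t) x) 2 ltac:(lra)
    (fun t s x y => clamp_cone a b t s x y) HG).
  destruct (rect_max t1 _ a b ltac:(lra) ltac:(lra) HG2) as [ts [xs [Hts [Hxs Hmax]]]].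
  set (zs := clamp (a + 2 * ts) (b - 2 * ts) xs).
  assert (Hzs : a + 2 * ts <= zs <= b - 2 * ts) by (apply clamp_in; lra).
  assert (Hmp : forall t x, Om t x -> norm3 (fun i => r i t x) <= 0 * exp (2 * t)).
  { apply (max_principle T lam r rx Om ts zs 0); auto.
    - intros t x [H _]; lra.
    - split; auto.
    - intros t x [H1 H2]. generalize (Hmax t x H1 ltac:(lra)). simpl. rewrite (clamp_id _ _ x H2). auto.
    - intros t x c [H1 H2] Ht Hc. exists t; split; auto. intros d Hd. split; [lra|].
      assert (Rabs c <= 2) by (generalize (Hl t x H1 H2); lra).
      apply Rabs_le_iff in H. nra.
    - lra.
    - intros x [_ H]. destruct (norm3_att (fun i => r i 0 x)) as [j Hj]. rewrite Hj, Hinit, Rabs_R0; lra. }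
  intros t x H1 H2 i. specialize (Hmp t x (conj H1 H2)). rewrite Rmult_0_l in Hmp.
  generalize (norm3_le (fun i => r i t x) i); simpl. intros.
  destruct (Req_dec (r i t x) 0) as [|Hn]; auto. apply Rabs_pos_lt in Hn. lra.
Qed.

(** Real induction resolves the circularity between the speed bound and the vanishing of the
    solution: where the solution vanishes the speed is 1, so by uniform continuity it stays below 2
    for a short time, which is what [cone_step] requires. The slope 2 provides this margin. *)
Lemma cone a b : (forall x i, a <= x <= b -> r i 0 x = 0) ->
  forall t, 0 <= t <= T -> forall x, a + 2 * t <= x <= b - 2 * t -> forall i, r i t x = 0.
Proof.
  intros Hinit. apply (real_induction 0 T (fun t => forall x, a + 2 * t <= x <= b - 2 * t -> forall i, r i t x = 0)).
  - intros x Hx i; apply Hinit; lra.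
  - intros t Ht IH.
    destruct (rect_unif T lam a b 1 HT Hlam Rlt_0_1) as [d [Hd K]].
    exists d; split; auto. intros s Hs HsT x Hx i.
    apply (cone_step a b s); auto; try lra.
    intros q z Hq Hz.
    assert (L : lam (Rmin q t) z = 1).
    { apply Hlam1; [unfold Rmin; destruct Rle_dec; lra|].
      intros j; apply IH; unfold Rmin; destruct Rle_dec; lra. }
    assert (Rabs (lam q z - lam (Rmin q t) z) < 1).
    { apply K; try lra; try (unfold Rmin; destruct Rle_dec; lra).
      - unfold Rmin; destruct Rle_dec; rewrite Rabs_right; lra.
      - rewrite Rminus_diag, Rabs_R0; lra. }
    rewrite L in H. apply Rabs_def2 in H. apply Rabs_le_iff; lra.
  - intros t Ht IH x Hx i.
    destruct (Req_dec (r i t x) 0) as [|Hn]; auto. exfalso. apply Rabs_pos_lt in Hn.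
    assert (Hc : cont_on (fun t => 0 <= t <= T) (r i)) by apply (Hr i).
    apply cont_on_cto in Hc. destruct (Hc t x ltac:(lra) (Rabs (r i t x) / 2)) as [d [Hd K]]; [lra|].
    set (s := Rmax 0 (t - d / 2)).
    assert (0 <= s < t /\ t - d / 2 <= s) by (unfold s, Rmax; destruct Rle_dec; lra).
    specialize (K s x ltac:(lra)).
    rewrite (IH s ltac:(lra) x ltac:(lra) i), Rminus_diag, Rabs_R0, Rminus_0_l, Rabs_Ropp in K.
    assert (Rabs (s - t) < d) by (apply Rabs_def1; lra). specialize (K H0 Hd). lra.
Qed.

Lemma finite_propagation M0 : (forall x i, M0 < Rabs x -> r i 0 x = 0) ->
  forall t x i, 0 <= t <= T -> M0 + 2 * t < Rabs x -> r i t x = 0.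
Proof.
  intros Hinit t x i Ht Hx. assert (0 <= Rabs x) by apply Rabs_pos.
  destruct (Rle_dec 0 x) as [H0|H0].
  - rewrite Rabs_right in Hx by lra.
    apply (cone (x - 2 * t) (x + 2 * t)); auto; try lra.
    intros y j Hy. apply Hinit. unfold Rabs; destruct Rcase_abs; lra.
  - rewrite Rabs_left in Hx by lra.
    apply (cone (x - 2 * t) (x + 2 * t)); auto; try lra.
    intros y j Hy. apply Hinit. unfold Rabs; destruct Rcase_abs; lra.
Qed.

(** By finite propagation the weighted norm vanishes outside [[-K, K]], so its maximum over the
    whole strip is attained on a rectangle. *)
Lemma global_bound M0 m : (forall x i, M0 < Rabs x -> r i 0 x = 0) ->
  0 <= m -> (forall x, norm3 (fun i => r i 0 x) <= m) ->
  forall t x, 0 <= t <= T -> norm3 (fun i => r i t x) <= m * exp (2 * t).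
Proof.
  intros Hsupp Hm Hinit.
  set (K := Rabs M0 + 2 * T + 1).
  assert (HK : M0 + 2 * T < K /\ 0 < K) by (unfold K; generalize (Rle_abs M0) (Rabs_pos M0); lra).
  set (G := fun t x => exp (- (2 * t)) * norm3 (fun i => r i t x)).
  assert (HG : cont_on (fun t => 0 <= t <= T) G).
  { apply cont_on_mult; [|apply cont_on_norm3; intros i; apply (Hr i)].
    apply (cont_on_time _ (fun t => exp (- (2 * t)))). intros t.
    apply ex_derive_cont. auto_derive; auto. }
  destruct (rect_max T G (- K) K HT ltac:(lra) HG) as [ts [xs [Hts [Hxs Hmax]]]].
  intros t x Ht. revert t x Ht.
  apply (max_principle T lam r rx (fun t x => 0 <= t <= T) ts xs m); auto.
  - intros t x Ht. destruct (Rle_dec (Rabs x) K) as [Hx|Hx].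
    + apply Rabs_le_iff in Hx. apply (Hmax t x Ht Hx).
    + apply Rnot_le_lt in Hx.
      destruct (norm3_att (fun i => r i t x)) as [j Hj]. rewrite Hj.
      rewrite (finite_propagation M0) by (auto; lra). rewrite Rabs_R0, Rmult_0_r.
      apply Rmult_le_pos; [left; apply exp_pos|].
      eapply Rle_trans; [apply Rabs_pos|apply (norm3_le (fun i => r i ts xs) Fwd)].
  - intros t x c Ht Ht' _. exists t; split; auto. intros; lra.
Qed.
End Cone.

(** * The Riccati equations *)

(** The derivative [d] is not assumed continuous, so the estimate is obtained by real induction with
    the slope [B + e] rather than by integration. *)
Lemma pdt_growth T f d B x : (forall t, 0 <= t <= T -> pdt (fun t => 0 <= t <= T) f t x (d t)) ->
  (forall t, 0 <= t <= T -> d t <= B) -> forall t, 0 <= t <= T -> f t x <= f 0 x + B * t.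
Proof.
  intros Hp HB t Ht.
  apply Rnot_lt_le; intros Hlt.
  assert (HTt : 0 < t). { destruct (Req_dec t 0) as [->|]; lra. }
  set (e := (f t x - (f 0 x + B * t)) / (2 * t)).
  assert (He : 0 < e) by (apply Rdiv_lt_0_compat; lra).
  assert (Ee : e * (2 * t) = f t x - (f 0 x + B * t)) by (unfold e; field; lra).
  assert (K : f t x <= f 0 x + (B + e) * t); [|nra].
  revert Ht. apply (real_induction 0 T (fun t => f t x <= f 0 x + (B + e) * t)).
  - lra.
  - intros s Hs IH. destruct (Hp s ltac:(lra) e He) as [dl [Hd K]].
    exists dl; split; auto. intros r Hr HrT.
    specialize (K r ltac:(lra) ltac:(rewrite Rabs_right; lra)).
    rewrite (Rabs_right (r - s)) in K by lra. apply Rabs_le_iff in K.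
    specialize (IH s ltac:(lra)). specialize (HB s ltac:(lra)). nra.
  - intros s Hs IH. apply Rnot_lt_le; intros Hgt.
    set (gap := f s x - (f 0 x + (B + e) * s)) in *.
    destruct (Hp s ltac:(lra) 1 Rlt_0_1) as [dl [Hd K]].
    set (C := Rabs (d s) + 1 + Rabs (B + e)).
    assert (HC : 0 < C) by (unfold C; generalize (Rabs_pos (d s)) (Rabs_pos (B + e)); lra).
    set (k := Rmin (Rmin (s / 2) (dl / 2)) (gap / (2 * C))).
    assert (Hk : 0 < k /\ k <= s / 2 /\ k <= dl / 2 /\ k <= gap / (2 * C)).
    { split; [repeat apply Rmin_pos; try lra; apply Rdiv_lt_0_compat; unfold gap; lra|].
      generalize (Rmin_l (Rmin (s / 2) (dl / 2)) (gap / (2 * C))) (Rmin_r (Rmin (s / 2) (dl / 2)) (gap / (2 * C)))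
       (Rmin_l (s / 2) (dl / 2)) (Rmin_r (s / 2) (dl / 2)); fold k; lra. }
    assert (Eg : gap / (2 * C) * (2 * C) = gap) by (field; lra).
    specialize (K (s - k) ltac:(lra)). replace (s - k - s) with (- k) in K by ring.
    rewrite Rabs_Ropp, (Rabs_right k) in K by lra. specialize (K ltac:(lra)).
    specialize (IH (s - k) ltac:(lra)).
    assert (D1 : - (k * Rabs (d s)) <= d s * k <= k * Rabs (d s)).
    { generalize (Rle_abs (d s)) (Rle_abs (- d s)). rewrite Rabs_Ropp. nra. }
    assert (D2 : - (k * Rabs (B + e)) <= (B + e) * k <= k * Rabs (B + e)).
    { generalize (Rle_abs (B + e)) (Rle_abs (- (B + e))). rewrite Rabs_Ropp. nra. }
    apply Rabs_le_iff in K.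
    assert (k * C <= gap / 2) by nra.
    unfold C in *. unfold gap in *. nra.
Qed.

Definition opp (i : fam) : fam := match i with Fwd => Bwd | Bwd => Fwd | Still => Still end.

(** * Uniform limits of difference quotients on a strip *)

Section Uniform.
Variables (T K : R).
Hypothesis HT : 0 <= T.
Let I := fun t => 0 <= t <= T.

(** Being constant outside [[-K, K]] makes the strip behave like a compact set: such functions are
    bounded, uniformly continuous and attain their maxima. *)
Definition CK (f : R -> R -> R) := cont_on I f /\ exists c, forall t x, I t -> K < Rabs x -> f t x = c.

Lemma CK_plus f g : CK f -> CK g -> CK (fun t x => f t x + g t x).
Proof.
  intros [H1 [c H2]] [H3 [d H4]]; split; [apply cont_on_plus; auto|].
  exists (c + d); intros; rewrite H2, H4; auto.
Qed.

Lemma CK_mult f g : CK f -> CK g -> CK (fun t x => f t x * g t x).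
Proof.
  intros [H1 [c H2]] [H3 [d H4]]; split; [apply cont_on_mult; auto|].
  exists (c * d); intros; rewrite H2, H4; auto.
Qed.

Lemma CK_const c : CK (fun _ _ => c).
Proof. split; [apply cont_on_const|exists c; auto]. Qed.

Lemma CK_comp g f : (forall t x, I t -> continuous g (f t x)) -> CK f -> CK (fun t x => g (f t x)).
Proof.
  intros Hg [H1 [c H2]]; split; [apply cont_on_comp; auto|].
  exists (g c); intros; rewrite H2; auto.
Qed.

Lemma CK_range f : CK f -> forall t x, I t ->
  exists y, - (Rabs K + 1) <= y <= Rabs K + 1 /\ f t x = f t y.
Proof.
  intros [_ [c H2]] t x It.
  assert (KK := Rle_abs K). assert (KP := Rabs_pos K).
  destruct (Rle_dec (Rabs x) (Rabs K + 1)) as [Hx|Hx].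
  - apply Rabs_le_iff in Hx. exists x; auto.
  - exists (Rabs K + 1). split; [lra|]. rewrite !H2; auto; [|lra].
    rewrite (Rabs_right (Rabs K + 1)); lra.
Qed.

Lemma CK_max f : CK f -> exists ts xs, I ts /\ forall t x, I t -> f t x <= f ts xs.
Proof.
  intros H. assert (KP := Rabs_pos K).
  destruct (rect_max T f (- (Rabs K + 1)) (Rabs K + 1) HT ltac:(lra) (proj1 H)) as [ts [xs [H1 [_ H3]]]].
  exists ts, xs; split; auto. intros t x It.
  destruct (CK_range f H t x It) as [y [Hy ->]]. apply H3; auto.
Qed.

Lemma CK_slice_max f t : CK f -> I t -> exists xs, forall x, f t x <= f t xs.
Proof.
  intros H It. assert (KP := Rabs_pos K).
  assert (Hc : cont_on (fun s => 0 <= s <= 0) (fun _ x => f t x)).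
  { apply cont_on_cto. destruct H as [H _]. apply cont_on_cto in H. intros s x _ e He.
    destruct (H t x It e He) as [d [Hd Q]]. exists d; split; auto.
    intros r y _ _ Hy. apply Q; auto. rewrite Rminus_diag, Rabs_R0; auto. }
  destruct (rect_max 0 _ (- (Rabs K + 1)) (Rabs K + 1) ltac:(lra) ltac:(lra) Hc) as [s [xs [_ [_ H3]]]].
  exists xs. intros x.
  destruct (CK_range f H t x It) as [y [Hy ->]]. apply (H3 0); auto; lra.
Qed.

Lemma CK_bdd f : CK f -> exists C, forall t x, I t -> Rabs (f t x) <= C.
Proof.
  intros H.
  destruct (CK_max (fun t x => Rabs (f t x))) as [ts [xs [_ H2]]].
  { apply (CK_comp Rabs); auto. intros; apply continuous_Rabs. }
  eexists; eauto.
Qed.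

Lemma CK_unif f e : CK f -> 0 < e -> exists d, 0 < d /\ forall t s x y, I t -> I s ->
  Rabs (t - s) < d -> Rabs (x - y) < d -> Rabs (f t x - f s y) <= e.
Proof.
  intros [H1 [c H2]] He.
  set (a := Rabs K + 2). assert (KK := Rle_abs K). assert (KP := Rabs_pos K).
  destruct (rect_unif T f (- a) a e HT H1 He) as [d [Hd Q]].
  exists (Rmin d 1); split; [apply Rmin_pos; lra|]. intros t s x y It Is Hts Hxy.
  rmin_bounds d 1.
  destruct (Rle_dec (Rabs x) (Rabs K + 1)) as [Hx|Hx].
  - left. apply Q; auto; try lra.
    + apply Rabs_le_iff in Hx. unfold a; lra.
    + assert (Rabs y <= a).
      { replace y with (x - (x - y)) by ring. eapply Rle_trans; [apply Rabs_triang|].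
        rewrite Rabs_Ropp. unfold a; lra. }
      apply Rabs_le_iff in H; auto.
  - assert (K < Rabs y).
    { assert (Rabs x <= Rabs y + Rabs (x - y)).
      { replace x with (y + (x - y)) at 1 by ring. apply Rabs_triang. }
      lra. }
    rewrite !H2 by (auto; lra). rewrite Rminus_diag, Rabs_R0; lra.
Qed.

Definition ulim (A : R -> R -> R -> R) (B : R -> R -> R) := forall e, 0 < e -> exists d, 0 < d /\
  forall eps, 0 < eps < d -> forall t x, I t -> Rabs (A eps t x - B t x) <= e.

Lemma ulim_const B : ulim (fun _ => B) B.
Proof. intros e He; exists 1; split; [lra|]. intros; rewrite Rminus_diag, Rabs_R0; lra. Qed.

Lemma ulim_plus A B A' B' : ulim A B -> ulim A' B' ->
  ulim (fun eps t x => A eps t x + A' eps t x) (fun t x => B t x + B' t x).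
Proof.
  intros H1 H2 e He. destruct (H1 (e / 2)) as [d1 [Hd1 Q1]]; [lra|].
  destruct (H2 (e / 2)) as [d2 [Hd2 Q2]]; [lra|].
  exists (Rmin d1 d2); split; [apply Rmin_pos; auto|]. intros eps Heps t x It.
  rmin_bounds d1 d2.
  specialize (Q1 eps ltac:(lra) t x It). specialize (Q2 eps ltac:(lra) t x It).
  abs_lra.
Qed.

Lemma ulim_mult A B A' B' : CK B -> CK B' -> ulim A B -> ulim A' B' ->
  ulim (fun eps t x => A eps t x * A' eps t x) (fun t x => B t x * B' t x).
Proof.
  intros HB HB' H1 H2 e He.
  destruct (CK_bdd _ HB) as [C HC]. destruct (CK_bdd _ HB') as [C' HC'].
  assert (I0 : I 0) by (unfold I; lra).
  assert (C0 : 0 <= C) by (eapply Rle_trans; [apply Rabs_pos|apply (HC 0 0 I0)]).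
  assert (C0' : 0 <= C') by (eapply Rle_trans; [apply Rabs_pos|apply (HC' 0 0 I0)]).
  set (e1 := Rmin 1 (e / (C + C' + 1))).
  assert (He1 : 0 < e1) by (apply Rmin_pos; [lra|apply Rdiv_lt_0_compat; lra]).
  assert (L1 : e1 <= 1) by apply Rmin_l.
  assert (L2 : e1 * (C + C' + 1) <= e).
  { replace e with (e / (C + C' + 1) * (C + C' + 1)) by (field; lra).
    apply Rmult_le_compat_r; [lra|apply Rmin_r]. }
  destruct (H1 e1 He1) as [d1 [Hd1 Q1]]. destruct (H2 e1 He1) as [d2 [Hd2 Q2]].
  exists (Rmin d1 d2); split; [apply Rmin_pos; auto|]. intros eps Heps t x It.
  rmin_bounds d1 d2.
  specialize (Q1 eps ltac:(lra) t x It). specialize (Q2 eps ltac:(lra) t x It).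
  eapply Rle_trans; [apply Rabs_mult_diff with (a := C) (b := C' + 1) (dx := e1) (dy := e1); auto|].
  - specialize (HC' t x It). abs_lra.
  - lra.
Qed.

Lemma ulim_scal c A B : ulim A B -> CK B -> ulim (fun eps t x => c * A eps t x) (fun t x => c * B t x).
Proof.
  intros H HB. apply (ulim_mult (fun _ _ _ => c) (fun _ _ => c) A B); auto.
  - apply CK_const.
  - apply ulim_const.
Qed.

Lemma ulim_ext A A' B B' : (forall eps t x, 0 < eps -> I t -> A eps t x = A' eps t x) ->
  (forall t x, I t -> B t x = B' t x) -> ulim A B -> ulim A' B'.
Proof.
  intros E1 E2 H e He. destruct (H e He) as [d [Hd Q]]. exists d; split; auto.
  intros eps Heps t x It. rewrite <- E1, <- E2 by (auto; lra). auto.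
Qed.

Lemma ulim_shift f : CK f -> ulim (fun eps t x => f t (x + eps)) f.
Proof.
  intros Hf e He. destruct (CK_unif f e Hf He) as [d [Hd Q]]. exists d; split; auto.
  intros eps Heps t x It. apply Q; auto.
  - rewrite Rminus_diag, Rabs_R0; auto.
  - replace (x + eps - x) with eps by ring. rewrite Rabs_right; lra.
Qed.

(** The form [+ -1 *] is chosen to match [C1e_plus] and [C1e_scal]. *)
Definition dq (f : R -> R -> R) (eps t x : R) := / eps * (f t (x + eps) + -1 * f t x).

Lemma ulim_dq f fx : (forall t x, I t -> is_derive (f t) x (fx t x)) -> CK fx -> ulim (dq f) fx.
Proof.
  intros HD Hf e He. destruct (CK_unif fx e Hf He) as [d [Hd Q]]. exists d; split; auto.
  intros eps Heps t x It. unfold dq.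
  destruct (MVT_R (f t) (fx t) x (x + eps)) as [c [Hc E]]; [intros; apply HD; auto|].
  assert (E2 : f t (x + eps) + -1 * f t x = fx t c * eps) by lra.
  rewrite E2. assert (E3 : / eps * (fx t c * eps) = fx t c) by (field; lra). rewrite E3.
  apply Q; auto.
  - rewrite Rminus_diag, Rabs_R0; auto.
  - rewrite Rmin_left, Rmax_right in Hc by lra. rewrite Rabs_right; lra.
Qed.

Lemma CK_derive f ft fx : C1e I f ft fx -> (exists c, forall t x, I t -> K < Rabs x -> f t x = c) ->
  CK fx /\ forall t x, I t -> K < Rabs x -> fx t x = 0.
Proof.
  intros [_ [H2 [_ [_ H5]]]] [c Hc].
  assert (Z : forall t x, I t -> K < Rabs x -> fx t x = 0).
  { intros t x It Hx. assert (HD := H2 t x It). apply is_derive_unique in HD. rewrite <- HD.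
    apply is_derive_unique. apply (is_derive_ext_loc (fun _ => c)).
    - exists (mkposreal (Rabs x - K) ltac:(lra)). intros y Hy. symmetry. apply Hc; auto.
      change (Rabs (y - x) < Rabs x - K) in Hy.
      assert (Rabs x <= Rabs y + Rabs (y - x)).
      { rewrite (Rabs_minus_sym y x). replace x with (y + (x - y)) at 1 by ring. apply Rabs_triang. }
      lra.
    - apply (is_derive_const (V := R_NormedModule)). }
  split; auto. split; auto. exists 0; auto.
Qed.

Lemma C1e_shift f ft fx c : C1e I f ft fx ->
  C1e I (fun t x => f t (x + c)) (fun t x => ft t (x + c)) (fun t x => fx t (x + c)).
Proof.
  intros [H1 [H2 [H3 [H4 H5]]]].
  assert (HS : forall q, cont_on I q -> cont_on I (fun t x => q t (x + c))).
  { intros q Hq. apply (cont_on_subst I q (fun _ x => x + c) 0); auto; [lra|].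
    intros. rewrite Rmult_0_l, Rplus_0_l. right; f_equal; ring. }
  split; [|split; [|split; [|split]]]; auto.
  - intros t x It e He. destruct (H1 t (x + c) It e He) as [d [Hd Q]]. exists d; split; auto.
  - intros t x It. replace (fx t (x + c)) with (1 * fx t (x + c)) by ring.
    apply (is_derive_comp (f t) (fun x => x + c)); [apply H2; auto|]. auto_derive; auto.
Qed.

Lemma C1e_dq f ft fx eps : C1e I f ft fx -> C1e I (dq f eps) (dq ft eps) (dq fx eps).
Proof.
  intros H. unfold dq. apply C1e_scal, C1e_plus; [apply C1e_shift; auto|apply C1e_scal; auto].
Qed.

Section Riccati.
Variables (g : R) (h u v hx ux vx : R -> R -> R).
Hypothesis Hsol : csol g I h u v hx ux vx.
Hypothesis Hout : forall t x, I t -> K < Rabs x -> h t x = 1 /\ u t x = 0 /\ v t x = 0.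

Let r := riem g h u v.
Let rx := riemx g h hx ux vx.

Definition Zw (i : fam) t x := sqrt (h t x) * rx i t x.

(* Right-hand side of the Riccati equation; [b] stands for [v_x = omega - 1 / h]. *)
Definition Fr (hh b z z' : R) := sqrt hh * (- (z * z) / 2 - (g - 1) / 4 * (z * (z - z')) + b).

Lemma CK_h : CK h.
Proof.
  split; [apply Hsol|]. exists 1. intros; apply Hout; auto.
Qed.

Lemma CK_hx_ux_vx : CK hx /\ CK ux /\ CK vx.
Proof.
  destruct Hsol as [H1 [H2 [H3 _]]]. split; [|split].
  - apply (CK_derive _ _ _ H1). exists 1; intros; apply Hout; auto.
  - apply (CK_derive _ _ _ H2). exists 0; intros; apply Hout; auto.
  - apply (CK_derive _ _ _ H3). exists 0; intros; apply Hout; auto.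
Qed.

Lemma hpos t x : I t -> 0 < h t x.
Proof. intros; apply Hsol; auto. Qed.

Lemma r_out i t x : I t -> K < Rabs x -> r i t x = 0.
Proof.
  intros It Hx. destruct (Hout t x It Hx) as [E1 [E2 E3]].
  destruct i; simpl; rewrite ?E1, ?E2, ?E3, ?phi_1; ring.
Qed.

Lemma CK_rx i : CK (rx i).
Proof.
  apply (CK_derive (r i) _ _ (csol_dsol _ _ _ _ _ _ _ _ Hsol i)). exists 0; intros; apply r_out; auto.
Qed.

Lemma CK_sqrt : CK (fun t x => sqrt (h t x)).
Proof. apply (CK_comp sqrt); [intros; apply continuous_sqrt|apply CK_h]. Qed.

Lemma CK_Zw i : CK (Zw i).
Proof. apply CK_mult; [apply CK_sqrt|apply CK_rx]. Qed.

Lemma C1e_sqrt : C1e I (fun t x => sqrt (h t x))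
  (fun t x => / (2 * sqrt (h t x)) * (- (h t x) ^ 2 * ux t x))
  (fun t x => / (2 * sqrt (h t x)) * hx t x).
Proof.
  apply (C1e_comp I sqrt (fun z => / (2 * sqrt z))); [| |apply Hsol].
  - intros t x It. apply is_derive_Reals, derivable_pt_lim_sqrt, hpos; auto.
  - intros t x It. apply ex_derive_cont.
    assert (0 < h t x) by (apply hpos; auto). assert (0 < sqrt (h t x)) by (apply sqrt_lt_R0; auto).
    auto_derive. split; [auto|]. split; [lra|auto].
Qed.

Definition speedx t x := (g + 1) / 2 * Rpower (h t x) ((g + 1) / 2 - 1) * hx t x.

Lemma C1e_speed : C1e I (speed g h)
  (fun t x => (g + 1) / 2 * Rpower (h t x) ((g + 1) / 2 - 1) * (- (h t x) ^ 2 * ux t x)) speedx.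
Proof.
  apply (C1e_comp I (fun z => Rpower z ((g + 1) / 2)) (fun z => (g + 1) / 2 * Rpower z ((g + 1) / 2 - 1)));
    [| |apply Hsol].
  - intros t x It. apply is_derive_Rpower, hpos; auto.
  - intros t x It. apply ex_derive_cont.
    eexists. apply (is_derive_scal (fun z => Rpower z ((g + 1) / 2 - 1))), is_derive_Rpower, hpos; auto.
Qed.

Lemma CK_speedx : CK speedx.
Proof.
  apply (CK_derive _ _ _ C1e_speed). exists (Rpower 1 ((g + 1) / 2)).
  intros t x It Hx. unfold speed. destruct (Hout t x It Hx) as [-> _]; auto.
Qed.

Lemma sg_speedx i t x : I t -> i <> Still ->
  sg i * speedx t x = (g + 1) / 4 * (h t x * (rx i t x - rx (opp i) t x)).
Proof.
  intros It Hi. unfold speedx.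
  replace ((g + 1) / 2 - 1) with (1 + (g - 3) / 2) by field.
  rewrite Rpower_plus, Rpower_1 by (apply hpos; auto).
  destruct i; [| |congruence]; unfold rx; simpl; field.
Qed.

(** Since the speed is [h^2 * phi'], the derivative of [h] along the [i]-characteristics is
    [- h^2 * rx (opp i)]: only the opposite family enters. *)
Lemma sqrt_transport i t x : I t -> i <> Still ->
  / (2 * sqrt (h t x)) * (- (h t x) ^ 2 * ux t x) + sg i * speed g h t x * (/ (2 * sqrt (h t x)) * hx t x)
  = - / 2 * (h t x * (sqrt (h t x) * rx (opp i) t x)).
Proof.
  intros It Hi. unfold speed. rewrite <- (aw_sqr g) by (apply hpos; auto).
  assert (Hh := hpos t x It). assert (Hs : 0 < sqrt (h t x)) by (apply sqrt_lt_R0; auto).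
  assert (E : h t x = sqrt (h t x) * sqrt (h t x)) by (rewrite sqrt_sqrt; lra).
  assert (X : / (2 * sqrt (h t x)) * (h t x) ^ 2 = / 2 * (h t x * sqrt (h t x))).
  { rewrite E at 2 3. set (s := sqrt (h t x)) in *. field; lra. }
  unfold rx, riemx.
  set (w := Rpower (h t x) ((g - 3) / 2)). set (s := sqrt (h t x)) in *.
  destruct i; simpl opp; simpl sg; cbv iota beta; [| |congruence].
  - transitivity (/ (2 * s) * h t x ^ 2 * (- ux t x + w * hx t x)); [ring|rewrite X; ring].
  - transitivity (/ (2 * s) * h t x ^ 2 * (- ux t x - w * hx t x)); [ring|rewrite X; ring].
Qed.

Definition zq (eps : R) (i : fam) (t x : R) := sqrt (h t x) * dq (r i) eps t x.

(* The derivative of [zq eps i] along the [i]-characteristics; no error term in [eps] occurs. *)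
Definition zqD (eps : R) (i : fam) (t x : R) :=
  - / 2 * (h t x * (sqrt (h t x) * rx (opp i) t x)) * dq (r i) eps t x +
  sqrt (h t x) * (dq v eps t x + -1 * (sg i * (dq (speed g h) eps t x * rx i t (x + eps)))).

(** The discrete product rule, which turns the quotient of [a * b] at [x] into [a(x)] times the
    quotient of [b] plus the quotient of [a] times [b(x + eps)], is exact; it is the origin of the
    shifted factor in [zqD]. *)
Lemma zq_transport eps i : 0 < eps -> i <> Still -> exists zt zx, C1e I (zq eps i) zt zx /\
  forall t x, I t -> zt t x + sg i * speed g h t x * zx t x = zqD eps i t x.
Proof.
  intros He Hi.
  assert (HR := csol_dsol _ _ _ _ _ _ _ _ Hsol i). fold r rx in HR.
  assert (HM := C1e_mult _ _ _ _ _ _ _ C1e_sqrt (C1e_dq _ _ _ eps HR)).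
  do 2 eexists. split; [apply HM|]. intros t x It. cbv beta.
  unfold zqD. rewrite <- (sqrt_transport i t x It Hi).
  assert (Es : forall y, src i (fun j => r j t y) = v t y) by (intros; destruct i; [| |congruence]; reflexivity).
  unfold dq. rewrite !Es. field. split; [lra|].
  assert (0 < sqrt (h t x)) by (apply sqrt_lt_R0, hpos; auto). lra.
Qed.

Lemma zq_ulim i : ulim (fun eps => zq eps i) (Zw i).
Proof.
  apply (ulim_mult (fun _ t x => sqrt (h t x))).
  - apply CK_sqrt.
  - apply CK_rx.
  - apply ulim_const.
  - apply ulim_dq; [apply (csol_dsol _ _ _ _ _ _ _ _ Hsol i)|apply CK_rx].
Qed.

Definition LD (i : fam) (t x : R) :=
  - / 2 * (h t x * (sqrt (h t x) * rx (opp i) t x)) * rx i t x +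
  sqrt (h t x) * (vx t x + -1 * (sg i * (speedx t x * rx i t x))).

Lemma zqD_ulim i : ulim (fun eps => zqD eps i) (LD i).
Proof.
  assert (Ha : CK (fun t x => - / 2 * (h t x * (sqrt (h t x) * rx (opp i) t x)))).
  { apply (CK_mult (fun _ _ => - / 2)); [apply CK_const|].
    apply CK_mult; [apply CK_h|]. apply CK_mult; [apply CK_sqrt|apply CK_rx]. }
  assert (Hsr : CK (fun t x => speedx t x * rx i t x)) by (apply CK_mult; [apply CK_speedx|apply CK_rx]).
  assert (Hssr : CK (fun t x => sg i * (speedx t x * rx i t x))) by (apply (CK_mult (fun _ _ => sg i)); [apply CK_const|auto]).
  assert (Hv : CK vx) by apply CK_hx_ux_vx.
  apply ulim_plus.
  - apply (ulim_mult (fun _ t x => - / 2 * (h t x * (sqrt (h t x) * rx (opp i) t x)))); auto.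
    + apply CK_rx.
    + apply ulim_const.
    + apply ulim_dq; [apply (csol_dsol _ _ _ _ _ _ _ _ Hsol i)|apply CK_rx].
  - apply (ulim_mult (fun _ t x => sqrt (h t x))).
    + apply CK_sqrt.
    + apply CK_plus; auto. apply (CK_mult (fun _ _ => -1)); [apply CK_const|auto].
    + apply ulim_const.
    + apply ulim_plus.
      * apply ulim_dq; [apply Hsol|auto].
      * apply ulim_scal; auto. apply ulim_scal; auto.
        apply ulim_mult; [apply CK_speedx|apply CK_rx| |].
        -- apply ulim_dq; [apply C1e_speed|apply CK_speedx].
        -- apply ulim_shift, CK_rx.
Qed.

(** With [z'] the opposite component, the weight contributes [- z * z' / 2] and the speed
    [- (g + 1) / 4 * z * (z - z')]. Their sum is [- z^2 / 2 - (g - 1) / 4 * z * (z - z')], whose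
    mixed coefficient is nonnegative up to sign exactly for [g >= 1]. *)
Lemma LD_Fr i t x : I t -> i <> Still -> LD i t x = Fr (h t x) (vx t x) (Zw i t x) (Zw (opp i) t x).
Proof.
  intros It Hi. unfold LD, Fr, Zw.
  assert (E := sg_speedx i t x It Hi).
  assert (Hh := hpos t x It).
  replace (sg i * (speedx t x * rx i t x)) with (sg i * speedx t x * rx i t x) by ring.
  rewrite E. 
  assert (Es : sqrt (h t x) * sqrt (h t x) = h t x) by (apply sqrt_sqrt; lra).
  set (s := sqrt (h t x)) in *. rewrite <- Es. field.
Qed.

Lemma Fr_ulim i : ulim (fun eps t x => Fr (h t x) (vx t x) (zq eps i t x) (zq eps (opp i) t x))
  (fun t x => Fr (h t x) (vx t x) (Zw i t x) (Zw (opp i) t x)).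
Proof.
  assert (H1 := CK_Zw i). assert (H2 := CK_Zw (opp i)).
  assert (U1 := zq_ulim i). assert (U2 := zq_ulim (opp i)).
  assert (Hv : CK vx) by apply CK_hx_ux_vx.
  assert (HZZ := CK_mult _ _ H1 H1). assert (HZZ' := CK_mult _ _ H1 H2).
  assert (E : forall hh b z z', sqrt hh * ((- / 2 - (g - 1) / 4) * (z * z) + (g - 1) / 4 * (z * z') + b) = Fr hh b z z')
    by (intros; unfold Fr; field).
  apply (ulim_ext (fun eps t x => sqrt (h t x) * ((- / 2 - (g - 1) / 4) * (zq eps i t x * zq eps i t x)
     + (g - 1) / 4 * (zq eps i t x * zq eps (opp i) t x) + vx t x)) _
     (fun t x => sqrt (h t x) * ((- / 2 - (g - 1) / 4) * (Zw i t x * Zw i t x)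
     + (g - 1) / 4 * (Zw i t x * Zw (opp i) t x) + vx t x))); [intros; apply E|intros; apply E|].
  apply (ulim_mult (fun _ t x => sqrt (h t x))); [apply CK_sqrt| |apply ulim_const|].
  - apply CK_plus; auto. apply CK_plus; apply (CK_mult (fun _ _ => _)); auto; apply CK_const.
  - apply ulim_plus; [|apply (ulim_const vx)].
    apply ulim_plus; apply ulim_scal; auto; apply ulim_mult; auto.
Qed.

(* The [Zw i] are only continuous; the rescaled difference quotients of the Riemann
   invariants are C^1 approximate solutions of the Riccati equations. *)
Lemma riccati_approx eta : 0 < eta -> exists z zt zx : fam -> R -> R -> R, forall i, i <> Still ->
  C1e I (z i) (zt i) (zx i) /\
  forall t x, I t -> Rabs (z i t x - Zw i t x) <= eta /\
    Rabs (zt i t x + sg i * speed g h t x * zx i t x - Fr (h t x) (vx t x) (z i t x) (z (opp i) t x)) <= eta /\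
    (Rabs K + 1 < Rabs x -> z i t x = 0).
Proof.
  intros He.
  assert (Hi : forall i, i <> Still -> exists d, 0 < d /\ forall eps, 0 < eps < d -> forall t x, I t ->
     Rabs (zq eps i t x - Zw i t x) <= eta /\
     Rabs (zqD eps i t x - Fr (h t x) (vx t x) (zq eps i t x) (zq eps (opp i) t x)) <= eta).
  { intros i Hi. destruct (zq_ulim i eta He) as [d1 [Hd1 Q1]].
    destruct (zqD_ulim i (eta / 2)) as [d2 [Hd2 Q2]]; [lra|].
    destruct (Fr_ulim i (eta / 2)) as [d3 [Hd3 Q3]]; [lra|].
    exists (Rmin d1 (Rmin d2 d3)); split; [repeat apply Rmin_pos; auto|]. intros eps Heps t x It.
    rmin_bounds d1 (Rmin d2 d3).
    rmin_bounds d2 d3.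
    split; [apply Q1; auto; lra|].
    specialize (Q2 eps ltac:(lra) t x It). specialize (Q3 eps ltac:(lra) t x It).
    rewrite LD_Fr in Q2 by auto. abs_lra. }
  destruct (Hi Fwd ltac:(discriminate)) as [d1 [Hd1 Q1]]. destruct (Hi Bwd ltac:(discriminate)) as [d2 [Hd2 Q2]].
  (* A shift below [/ 2] enlarges the support by less than 1, whence [Rabs K + 1] in the
     statement. *)
  set (eps := Rmin (/ 2) (Rmin d1 d2) / 2).
  rmin_bounds (/ 2) (Rmin d1 d2).
  rmin_bounds d1 d2.
  assert (0 < Rmin (/ 2) (Rmin d1 d2)) by (repeat apply Rmin_pos; lra).
  assert (Heps : 0 < eps /\ eps < / 2 /\ eps < d1 /\ eps < d2) by (unfold eps; lra).
  destruct (zq_transport eps Fwd ltac:(lra) ltac:(discriminate)) as [ztP [zxP [CP TP]]].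
  destruct (zq_transport eps Bwd ltac:(lra) ltac:(discriminate)) as [ztM [zxM [CM TM]]].
  exists (zq eps), (fun i => match i with Fwd => ztP | _ => ztM end), (fun i => match i with Fwd => zxP | _ => zxM end).
  assert (Hz : forall i t x, I t -> Rabs K + 1 < Rabs x -> zq eps i t x = 0).
  { intros i t x It Hx. unfold zq, dq. assert (KK := Rle_abs K).
    rewrite !r_out; auto; [ring|lra|].
    assert (Rabs x <= Rabs (x + eps) + eps); [|lra].
    replace x with ((x + eps) - eps) at 1 by ring. eapply Rle_trans; [apply Rabs_triang|].
    rewrite Rabs_Ropp, (Rabs_right eps); lra. }
  intros [| |] Hne; [| |congruence]; (split; [auto|]); intros t x It.
  - rewrite TP by auto. destruct (Q1 eps ltac:(lra) t x It). split; [|split]; auto.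
  - rewrite TM by auto. destruct (Q2 eps ltac:(lra) t x It). split; [|split]; auto.
Qed.

(** Formally [(1 / h)_t = u_x] cancels [v_xt = - u_x], but [v_x] need not be differentiable in time.
    With [dq v] in its place the time derivative is [u_x - dq u], uniformly small in [eps], and
    [pdt_growth] applies to both signs. *)
Lemma omega_const t x : I t -> / h t x + vx t x = / h 0 x + vx 0 x.
Proof.
  intros It. assert (I0 : I 0) by (unfold I; lra).
  assert (Hux : CK ux) by apply CK_hx_ux_vx. assert (Hvx : CK vx) by apply CK_hx_ux_vx.
  assert (Hw : forall eps, 0 < eps -> forall s, I s ->
    pdt I (fun t x => / h t x + dq v eps t x) s x (ux s x + -1 * dq u eps s x)).
  { intros eps Heps s Is. apply pdt_plus.
    - assert (Hh := hpos s x Is).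
      replace (ux s x) with (- / (h s x) ^ 2 * (- (h s x) ^ 2 * ux s x)) by (field; lra).
      apply (pdt_comp I (fun z => / z) h s x); [apply Hsol; auto|].
      auto_derive; [lra|field; lra].
    - destruct Hsol as [_ [_ [Hv _]]].
      assert (HD := C1e_dq _ _ _ eps Hv). destruct HD as [HD _].
      specialize (HD s x Is). unfold dq in *.
      match goal with |- pdt _ _ _ _ ?d => match type of HD with pdt _ _ _ _ ?d' =>
        replace d with d' by ring end end. exact HD. }
  apply Rminus_diag_uniq. apply NNPP. intros Hn. apply Rabs_pos_lt in Hn.
  set (gap := Rabs (/ h t x + vx t x - (/ h 0 x + vx 0 x))) in *.
  set (e := gap / (4 * (T + 1))).
  assert (He : 0 < e) by (apply Rdiv_lt_0_compat; lra).
  assert (Ee : e * (4 * (T + 1)) = gap) by (unfold e; field; lra).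
  destruct (ulim_dq u ux ltac:(intros; apply Hsol; auto) Hux e He) as [d1 [Hd1 Q1]].
  destruct (ulim_dq v vx ltac:(intros; apply Hsol; auto) Hvx e He) as [d2 [Hd2 Q2]].
  set (eps := Rmin d1 d2 / 2).
  rmin_bounds d1 d2.
  assert (0 < Rmin d1 d2) by (repeat apply Rmin_pos; lra).
  assert (Heps : 0 < eps /\ eps < d1 /\ eps < d2) by (unfold eps; lra).
  specialize (Q1 eps ltac:(lra)). specialize (Q2 eps ltac:(lra)).
  assert (G1 := pdt_growth T _ _ e x (Hw eps ltac:(lra))).
  assert (G2 := pdt_growth T _ _ e x (fun s Is => pdt_scal I (-1) _ s x _ (Hw eps ltac:(lra) s Is))).
  specialize (G1 ltac:(intros s Is; specialize (Q1 s x Is); apply Rabs_le_iff in Q1; lra) t It).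
  specialize (G2 ltac:(intros s Is; specialize (Q1 s x Is); apply Rabs_le_iff in Q1; lra) t It).
  cbv beta in G1, G2.
  assert (R1 := Q2 t x It). assert (R2 := Q2 0 x I0).
  apply Rabs_le_iff in R1, R2.
  assert (e * t <= e * T) by (apply Rmult_le_compat_l; unfold I in *; lra).
  assert (gap <= e * T + 2 * e) by (unfold gap; apply Rabs_le_iff; lra).
  nra.
Qed.
End Riccati.
End Uniform.

(** * Bounds along the flow and blow-up *)

Lemma max_derive_0 f x l : is_derive f x l -> (forall y, f y <= f x) -> l = 0.
Proof.
  intros HD Hm. destruct (Req_dec l 0) as [|Hn]; auto. exfalso.
  apply Rabs_pos_lt in Hn. rewrite is_derive_eps in HD.
  destruct (HD (Rabs l / 2)) as [d [Hd Q]]; [lra|].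
  destruct (Rle_dec 0 l) as [Hl|Hl].
  - specialize (Q (x + d / 2)). specialize (Hm (x + d / 2)).
    replace (x + d / 2 - x) with (d / 2) in Q by ring.
    rewrite (Rabs_right l), (Rabs_right (d / 2)) in * by lra. specialize (Q ltac:(lra)).
    apply Rabs_le_iff in Q. nra.
  - specialize (Q (x - d / 2)). specialize (Hm (x - d / 2)).
    replace (x - d / 2 - x) with (- (d / 2)) in Q by ring.
    rewrite Rabs_Ropp, (Rabs_right (d / 2)), (Rabs_left l) in * by lra. specialize (Q ltac:(lra)).
    apply Rabs_le_iff in Q. nra.
Qed.

Lemma max_pdt_nonneg T f t x d : pdt (fun t => 0 <= t <= T) f t x d -> 0 < t <= T ->
  (forall s, 0 <= s <= T -> f s x <= f t x) -> 0 <= d.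
Proof.
  intros Hp Ht Hm. apply Rnot_lt_le; intros Hd.
  destruct (Hp (- d / 2)) as [dl [Hdl Q]]; [lra|].
  set (k := Rmin t dl / 2).
  rmin_bounds t dl.
  assert (0 < Rmin t dl) by (apply Rmin_pos; lra).
  assert (0 < k /\ k < t /\ k < dl) by (unfold k; lra).
  specialize (Q (t - k) ltac:(lra)). specialize (Hm (t - k) ltac:(lra)).
  replace (t - k - t) with (- k) in Q by ring. rewrite Rabs_Ropp, (Rabs_right k) in Q by lra.
  specialize (Q ltac:(lra)). apply Rabs_le_iff in Q. nra.
Qed.

Section Consequences.
Variables (T K g W Mh : R) (h u v hx ux vx : R -> R -> R).
Hypothesis HT : 0 <= T.
Hypothesis Hg : 1 <= g.
Hypothesis Hsol : csol g (fun t => 0 <= t <= T) h u v hx ux vx.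
Hypothesis Hout : forall t x, 0 <= t <= T -> K < Rabs x -> h t x = 1 /\ u t x = 0 /\ v t x = 0.
Hypothesis HW0 : 0 < W.
Hypothesis HW : forall t x, 0 <= t <= T -> / h t x + vx t x <= W.
Hypothesis HMh : forall t x, 0 <= t <= T -> h t x <= Mh.

Let I := fun t => 0 <= t <= T.
Let Zt := Zw g h hx ux vx.

Lemma Mh_pos : 0 < Mh.
Proof.
  apply Rlt_le_trans with (h 0 0); [|apply HMh; lra]. apply Hsol; lra.
Qed.

Lemma g0_pos : 0 < / sqrt Mh.
Proof. apply Rinv_0_lt_compat, sqrt_lt_R0, Mh_pos. Qed.

(** The condition [0 <= z * (z - z')] holds at a positive maximum and at a negative minimum over
    both families. The loss [/ sqrt Mh] comes from [v_x <= W - 1 / h] and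
    [sqrt h * / h = / sqrt h]. *)
Lemma Fr_le t x z z' : I t -> 0 <= z * (z - z') ->
  Fr g (h t x) (vx t x) z z' <= sqrt (h t x) * (W - z * z / 2) - / sqrt Mh.
Proof.
  intros It Hz. unfold Fr.
  assert (Hh : 0 < h t x) by (apply Hsol; auto).
  assert (Hs : 0 < sqrt (h t x)) by (apply sqrt_lt_R0; auto).
  assert (Hss : sqrt (h t x) <= sqrt Mh) by (apply sqrt_le_1_alt, HMh; auto).
  assert (E : sqrt (h t x) * / h t x = / sqrt (h t x)).
  { replace (h t x) with (sqrt (h t x) * sqrt (h t x)) at 2 by (apply sqrt_sqrt; lra). field; lra. }
  assert (Hinv : / sqrt Mh <= / sqrt (h t x)) by (apply Rinv_le_contravar; auto).
  specialize (HW t x It).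
  set (s := sqrt (h t x)) in *.
  assert (0 <= (g - 1) / 4 * (z * (z - z'))) by (apply Rmult_le_pos; lra).
  apply Rle_trans with (s * (W - z * z / 2) - s * / h t x); [|lra].
  rewrite <- Rmult_minus_distr_l. apply Rmult_le_compat_l; lra.
Qed.

Definition approx eta (z zt zx : fam -> R -> R -> R) := forall i, i <> Still ->
  C1e I (z i) (zt i) (zx i) /\
  forall t x, I t -> 
    Rabs (zt i t x + sg i * speed g h t x * zx i t x - Fr g (h t x) (vx t x) (z i t x) (z (opp i) t x)) <= eta /\
    (Rabs K + 1 < Rabs x -> z i t x = 0).

Lemma approx_CK eta z zt zx i : approx eta z zt zx -> i <> Still -> CK T (Rabs K + 1) (z i).
Proof.
  intros H Hi. split; [apply (H i Hi)|]. exists 0. intros t x It Hx. apply (proj2 (H i Hi)); auto.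
Qed.

Lemma CK_Rmax K' f f' : CK T K' f -> CK T K' f' -> CK T K' (fun t x => Rmax (f t x) (f' t x)).
Proof.
  intros [H1 [c H2]] [H3 [d H4]]. split; [apply cont_on_max; auto|].
  exists (Rmax c d). intros. rewrite H2, H4; auto.
Qed.

Lemma opp_ne i : i <> Still -> opp i <> Still.
Proof. destruct i; simpl; congruence. Qed.

Lemma CK_max_pair (f : fam -> R -> R -> R) K' : CK T K' (f Fwd) -> CK T K' (f Bwd) ->
  exists i ts xs, i <> Still /\ I ts /\ forall j t x, j <> Still -> I t -> f j t x <= f i ts xs.
Proof.
  intros H1 H2.
  destruct (CK_max T K' HT _ (CK_Rmax _ _ _ H1 H2)) as [ts [xs [Its Hm]]].
  assert (Hj : forall j t x, j <> Still -> I t -> f j t x <= Rmax (f Fwd ts xs) (f Bwd ts xs)).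
  { intros j t x Hj It. eapply Rle_trans; [|apply (Hm t x It)].
    destruct j; [apply Rmax_l|apply Rmax_r|congruence]. }
  unfold Rmax in Hj at 1; destruct Rle_dec in Hj.
  - exists Bwd, ts, xs; split; [discriminate|auto].
  - exists Fwd, ts, xs; split; [discriminate|auto].
Qed.

Lemma CK_slice_max_pair (f : fam -> R -> R -> R) K' t : CK T K' (f Fwd) -> CK T K' (f Bwd) -> I t ->
  exists i xs, i <> Still /\ forall j x, j <> Still -> f j t x <= f i t xs.
Proof.
  intros H1 H2 It.
  destruct (CK_slice_max T K' _ t (CK_Rmax _ _ _ H1 H2) It) as [xs Hm].
  assert (Hj : forall j x, j <> Still -> f j t x <= Rmax (f Fwd t xs) (f Bwd t xs)).
  { intros j x Hj. eapply Rle_trans; [|apply (Hm x)].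
    destruct j; [apply Rmax_l|apply Rmax_r|congruence]. }
  unfold Rmax in Hj at 1; destruct Rle_dec in Hj.
  - exists Bwd, xs; split; [discriminate|auto].
  - exists Fwd, xs; split; [discriminate|auto].
Qed.

Lemma Z_upper b : sqrt (2 * W) <= b -> (forall i x, i <> Still -> Zt i 0 x <= b) ->
  forall i t x, i <> Still -> I t -> Zt i t x <= b.
Proof.
  intros Hb Hinit i t x Hi It. apply Rnot_lt_le; intros Hlt.
  assert (Hb0 : 0 <= b) by (eapply Rle_trans; [apply sqrt_pos|eauto]).
  assert (Hbb : 2 * W <= b * b).
  { rewrite <- (sqrt_sqrt (2 * W)) by lra. apply Rmult_le_compat; auto using sqrt_pos. }
  set (gap := Zt i t x - b) in *.
  (* [gap / 4] keeps the maximum of [z] above [b + 2 * eta], hence away from time 0; [/ sqrt Mh / 2]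
     keeps the right-hand side negative at the maximum. *)
  set (eta := Rmin (gap / 4) (/ sqrt Mh / 2)).
  assert (G0 := g0_pos).
  assert (B1 := Rmin_l (gap / 4) (/ sqrt Mh / 2)). assert (B2 := Rmin_r (gap / 4) (/ sqrt Mh / 2)).
  fold eta in B1, B2.
  assert (Heta : 0 < eta) by (apply Rmin_pos; unfold gap; lra).
  destruct (riccati_approx T K HT g h u v hx ux vx Hsol Hout eta Heta) as [z [zt [zx Hz]]].
  assert (Ha : approx eta z zt zx).
  { intros j Hj. destruct (Hz j Hj) as [C H]. split; auto. intros; apply H; auto. }
  destruct (CK_max_pair z (Rabs K + 1)) as [j [ts [xs [Hj [Its Hm]]]]];
    try (eapply approx_CK; eauto; discriminate).
  assert (H1 := Hm i t x Hi It). assert (H2 := proj1 (proj2 (Hz i Hi) t x It)). fold Zt in H2.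
  apply Rabs_le_iff in H2.
  assert (Hbig : b + 2 * eta < z j ts xs) by (unfold gap in *; lra).
  assert (Hts : 0 < ts).
  { destruct (Req_dec ts 0) as [E|]; [|unfold I in Its; lra]. exfalso. rewrite E in *.
    assert (H3 := proj1 (proj2 (Hz j Hj) 0 xs Its)). fold Zt in H3.
    specialize (Hinit j xs Hj). apply Rabs_le_iff in H3. lra. }
  destruct (Ha j Hj) as [[HP [HX _]] HE].
  assert (Ex : zx j ts xs = 0).
  { apply (max_derive_0 (z j ts) xs); [apply HX; auto|intros; apply Hm; auto]. }
  assert (Et : 0 <= zt j ts xs).
  { apply (max_pdt_nonneg T (z j) ts xs); [apply HP; auto|unfold I in Its; lra|intros; apply Hm; auto]. }
  destruct (HE ts xs Its) as [HE1 _]. rewrite Ex in HE1.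
  assert (Hopp : z (opp j) ts xs <= z j ts xs) by (apply Hm; auto using opp_ne).
  assert (F := Fr_le ts xs (z j ts xs) (z (opp j) ts xs) Its ltac:(apply Rmult_le_pos; lra)).
  assert (sqrt (h ts xs) * (W - z j ts xs * z j ts xs / 2) <= 0).
  { assert (0 <= sqrt (h ts xs)) by apply sqrt_pos. assert (b * b <= z j ts xs * z j ts xs) by nra. nra. }
  apply Rabs_le_iff in HE1. lra.
Qed.

(** A strict supersolution [beta] of the Riccati inequality stays above the minimum over both
    families. At a contact [z = beta] the spatial derivative vanishes and the mixed term has a sign,
    so [zt < beta'] and the point can be kept fixed while time advances. *)
Lemma barrier eta z zt zx t0 t1 beta beta' : approx eta z zt zx -> 0 <= t0 -> t1 <= T ->
  (forall t, t0 <= t <= t1 -> beta t <= 0 /\ is_derive beta t (beta' t) /\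
     forall x, sqrt (h t x) * (W - beta t * beta t / 2) - / sqrt Mh + eta < beta' t) ->
  (exists x i, i <> Still /\ z i t0 x <= beta t0) ->
  forall t, t0 <= t <= t1 -> exists x i, i <> Still /\ z i t x <= beta t.
Proof.
  intros Ha Ht0 Ht1 Hbeta Hinit.
  assert (Hmin : forall t, I t -> exists i xs, i <> Still /\ forall j x, j <> Still -> z i t xs <= z j t x).
  { intros t It.
    destruct (CK_slice_max_pair (fun i t x => -1 * z i t x) (Rabs K + 1) t) as [i [xs [Hi Hm]]]; auto.
    - apply (CK_mult T _ (fun _ _ => -1)); [apply CK_const|eapply approx_CK; eauto; discriminate].
    - apply (CK_mult T _ (fun _ _ => -1)); [apply CK_const|eapply approx_CK; eauto; discriminate].
    - exists i, xs; split; auto. intros j x Hj; specialize (Hm j x Hj); lra. }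
  assert (Hneg : forall t, I t -> z Fwd t (Rabs K + 2) = 0).
  { intros t It. apply (proj2 (Ha Fwd ltac:(discriminate)) t (Rabs K + 2) It).
    generalize (Rabs_pos K); intros. rewrite (Rabs_right (Rabs K + 2)); lra. }
  assert (Hbd : forall t, t0 <= t <= t1 -> forall e, 0 < e -> exists d, 0 < d /\ forall s, Rabs (s - t) < d ->
     Rabs (beta s - beta t - beta' t * (s - t)) <= e * Rabs (s - t)).
  { intros t Ht. apply is_derive_eps, Hbeta; auto. }
  apply (real_induction t0 t1 (fun t => exists x i, i <> Still /\ z i t x <= beta t)); auto.
  - intros t Ht IH. destruct (IH t ltac:(lra)) as [x0 [i0 [Hi0 Hx0]]].
    assert (It : I t) by (unfold I; lra).
    destruct (Hmin t It) as [i [xs [Hi Hm]]].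
    destruct (Hbeta t ltac:(lra)) as [Hb0 [_ Hb2]].
    destruct (Ha i Hi) as [[HP [HX _]] HE].
    assert (Hle : z i t xs <= beta t) by (specialize (Hm i0 x0 Hi0); lra).
    (* Two ways to stay below [beta] for a short time at the same position: contact with a strictly
       smaller slope, or a strict inequality of the values. *)
    assert (Hfor : forall e, 0 < e -> zt i t xs + 2 * e <= beta' t \/ z i t xs < beta t ->
      exists d, 0 < d /\ forall s, t < s < t + d -> s <= t1 -> z i s xs <= beta s).
    { intros e He Hor. destruct (HP t xs It e He) as [d1 [Hd1 Q1]].
      destruct (Hbd t ltac:(lra) e He) as [d2 [Hd2 Q2]].
      assert (Hgen : forall s, t < s < t + Rmin d1 d2 -> s <= t1 ->
        z i s xs <= z i t xs + (zt i t xs + e) * (s - t) /\ beta t + (beta' t - e) * (s - t) <= beta s).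
      { intros s Hs Hs1. rmin_bounds d1 d2.
        specialize (Q1 s ltac:(unfold I; lra) ltac:(rewrite Rabs_right; lra)).
        specialize (Q2 s ltac:(rewrite Rabs_right; lra)).
        rewrite (Rabs_right (s - t)) in Q1, Q2 by lra. apply Rabs_le_iff in Q1, Q2. lra. }
      destruct Hor as [Hor|Hor].
      - exists (Rmin d1 d2); split; [apply Rmin_pos; auto|]. intros s Hs Hs1.
        destruct (Hgen s Hs Hs1). nra.
      - set (c := Rabs (zt i t xs + e - (beta' t - e)) + 1).
        assert (Hc : 0 < c) by (unfold c; generalize (Rabs_pos (zt i t xs + e - (beta' t - e))); lra).
        set (d3 := (beta t - z i t xs) / c).
        assert (Hd3 : 0 < d3) by (apply Rdiv_lt_0_compat; lra).
        assert (Ed3 : d3 * c = beta t - z i t xs) by (unfold d3; field; lra).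
        exists (Rmin (Rmin d1 d2) d3); split; [repeat apply Rmin_pos; auto|]. intros s Hs Hs1.
        rmin_bounds (Rmin d1 d2) d3.
        destruct (Hgen s ltac:(lra) Hs1).
        assert ((zt i t xs + e - (beta' t - e)) * (s - t) <= c * d3).
        { generalize (Rle_abs (zt i t xs + e - (beta' t - e))); intros.
          apply Rle_trans with (c * (s - t)); [apply Rmult_le_compat_r; unfold c; lra|apply Rmult_le_compat_l; lra]. }
        lra. }
    assert (Hgo : exists d, 0 < d /\ forall s, t < s < t + d -> s <= t1 -> z i s xs <= beta s).
    { destruct Hle as [Hlt|Heq]; [apply (Hfor 1); auto; lra|].
      assert (Ex : zx i t xs = 0).
      { assert (HX' := HX t xs It).
        assert (X : -1 * zx i t xs = 0); [|lra].
        apply (max_derive_0 (fun y => -1 * z i t y) xs).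
        - apply (is_derive_scal (z i t)); auto.
        - intros y. specialize (Hm i y Hi). lra. }
      destruct (HE t xs It) as [HE1 _]. rewrite Ex in HE1.
      assert (Hopp : z i t xs <= z (opp i) t xs) by (apply Hm; auto using opp_ne).
      assert (F := Fr_le t xs (z i t xs) (z (opp i) t xs) It ltac:(nra)).
      specialize (Hb2 xs). rewrite Heq in *. apply Rabs_le_iff in HE1.
      apply (Hfor ((beta' t - zt i t xs) / 2)); [lra|left; lra]. }
    destruct Hgo as [d [Hd Hgo]]. exists d; split; auto. intros s Hs Hs1. exists xs, i; auto.
  - intros t Ht IH. apply NNPP; intros Hno.
    assert (It : I t) by (unfold I; lra).
    destruct (Hmin t It) as [i [xs [Hi Hm]]].
    assert (Hgt : beta t < z i t xs).
    { apply Rnot_le_lt; intros Hle. apply Hno; exists xs, i; auto. }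
    set (gap := z i t xs - beta t) in *.
    (* No limit of minimizing positions is taken: a point below the barrier at time [t - k] is
       reused at time [t], where uniform continuity in time costs [gap / 4] and the motion of [beta]
       another [gap / 4]. *)
    assert (Hgap : 0 < gap / 4) by (unfold gap; lra).
    destruct (CK_unif T (Rabs K + 1) HT (z Fwd) (gap / 4)) as [d1 [Hd1 Q1]]; [eapply approx_CK; eauto; discriminate|auto|].
    destruct (CK_unif T (Rabs K + 1) HT (z Bwd) (gap / 4)) as [d2 [Hd2 Q2]]; [eapply approx_CK; eauto; discriminate|auto|].
    destruct (Hbd t ltac:(lra) 1 Rlt_0_1) as [d3 [Hd3 Q3]].
    set (c := Rabs (beta' t) + 1). assert (Hc : 1 <= c) by (unfold c; generalize (Rabs_pos (beta' t)); lra).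
    set (d4 := gap / 4 / c).
    assert (Hd4 : 0 < d4) by (apply Rdiv_lt_0_compat; lra).
    assert (Ed4 : d4 * c = gap / 4) by (unfold d4; field; lra).
    set (k := Rmin (Rmin (t - t0) d1) (Rmin (Rmin d2 d3) d4) / 2).
    rmin_bounds (Rmin (t - t0) d1) (Rmin (Rmin d2 d3) d4).
    rmin_bounds (t - t0) d1.
    rmin_bounds (Rmin d2 d3) d4.
    rmin_bounds d2 d3.
    assert (0 < Rmin (Rmin (t - t0) d1) (Rmin (Rmin d2 d3) d4)) by (repeat apply Rmin_pos; lra).
    assert (Hk : 0 < k /\ k < t - t0 /\ k < d1 /\ k < d2 /\ k < d3 /\ k < d4) by (unfold k; lra).
    assert (Ek : Rabs (t - k - t) = k).
    { replace (t - k - t) with (- k) by ring. rewrite Rabs_Ropp, Rabs_right; lra. }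
    destruct (IH (t - k) ltac:(lra)) as [y [j [Hj Hy]]].
    specialize (Q3 (t - k)). rewrite Ek in Q3. specialize (Q3 ltac:(lra)).
    replace (t - k - t) with (- k) in Q3 by ring.
    assert (Hbs : beta (t - k) <= beta t + gap / 4).
    { apply Rabs_le_iff in Q3. generalize (Rle_abs (- beta' t)). rewrite Rabs_Ropp. intros.
      assert (k * c <= gap / 4) by (rewrite <- Ed4; apply Rmult_le_compat_r; lra).
      unfold c in *. nra. }
    assert (Hzy : Rabs (z j (t - k) y - z j t y) <= gap / 4).
    { destruct j; [apply Q1|apply Q2|congruence]; auto; try (unfold I; lra);
        try (rewrite Rminus_diag, Rabs_R0; lra); rewrite Ek; lra. }
    specialize (Hm j y Hj). apply Rabs_le_iff in Hzy. unfold gap in *. lra.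
Qed.

Lemma Z_decline t0 x0 i0 b0 : i0 <> Still -> I t0 -> Zt i0 t0 x0 <= b0 -> b0 <= - sqrt (2 * W) ->
  forall t eta, t0 <= t <= T -> 0 < eta -> exists x i, i <> Still /\ Zt i t x <= b0 - / sqrt Mh / 2 * (t - t0) + eta.
Proof.
  intros Hi0 It0 HZ Hb0 t eta Ht Heta.
  assert (G0 := g0_pos). set (g0 := / sqrt Mh) in *.
  assert (MP := Mh_pos).
  assert (SM : 0 < sqrt Mh) by (apply sqrt_lt_R0; auto).
  assert (Hb0' : b0 <= 0) by (generalize (sqrt_pos (2 * W)); lra).
  assert (Hsq : 2 * W <= b0 * b0).
  { rewrite <- (sqrt_sqrt (2 * W)) by lra.
    replace (b0 * b0) with ((- b0) * (- b0)) by ring. apply Rmult_le_compat; auto using sqrt_pos; lra. }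
  (* The barrier starts at [b0 + e1] instead of [b0], so [W - beta^2 / 2] may be positive, but at
     most [- b0 * e1]. The constant [c] collects this error, multiplied by [sqrt Mh], and the
     approximation error [e1]; [e1 * c <= g0 / 8] leaves the slope [- g0 / 2] admissible. *)
  set (c := 1 + sqrt Mh * (1 - b0)).
  assert (Hc : 1 <= c) by (unfold c; nra).
  assert (Hnz : b0 < 0) by (generalize (sqrt_lt_R0 (2 * W)); lra).
  set (e1 := Rmin (Rmin (eta / 2) (g0 / (8 * c))) (Rmin (- b0 / 2) (/ 2))).
  assert (B1 := Rmin_l (Rmin (eta / 2) (g0 / (8 * c))) (Rmin (- b0 / 2) (/ 2))).
  assert (B2 := Rmin_r (Rmin (eta / 2) (g0 / (8 * c))) (Rmin (- b0 / 2) (/ 2))). fold e1 in B1, B2.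
  rmin_bounds (eta / 2) (g0 / (8 * c)).
  rmin_bounds (- b0 / 2) (/ 2).
  assert (He1 : 0 < e1) by (repeat apply Rmin_pos; try lra; apply Rdiv_lt_0_compat; lra).
  assert (Ec : g0 / (8 * c) * (8 * c) = g0) by (field; lra).
  assert (e1c : e1 * c <= g0 / 8).
  { apply Rle_trans with (g0 / (8 * c) * c); [apply Rmult_le_compat_r; lra|]. right; field; lra. }
  destruct (riccati_approx T K HT g h u v hx ux vx Hsol Hout e1 He1) as [z [zt [zx Hz]]].
  assert (Ha : approx e1 z zt zx).
  { intros j Hj. destruct (Hz j Hj) as [C H]. split; auto. intros; apply H; auto. }
  destruct (barrier e1 z zt zx t0 T (fun t => b0 + e1 - g0 / 2 * (t - t0)) (fun _ => - (g0 / 2)) Ha)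
    with (t := t) as [x [i [Hi Hx]]]; auto.
  - apply It0.
  - lra.
  - intros s Hs. split; [nra|]. split.
    + auto_derive; auto. ring.
    + intros y.
      set (bb := b0 + e1 - g0 / 2 * (s - t0)).
      assert (bb <= b0 + e1) by (unfold bb; nra).
      assert ((b0 + e1) * (b0 + e1) <= bb * bb) by nra.
      assert (W - bb * bb / 2 <= - b0 * e1) by nra.
      assert (0 <= sqrt (h s y) <= sqrt Mh).
      { split; [apply sqrt_pos|]. apply sqrt_le_1_alt, HMh. unfold I in *; lra. }
      assert (sqrt (h s y) * (W - bb * bb / 2) <= sqrt Mh * (- b0 * e1)).
      { apply Rle_trans with (sqrt (h s y) * (- b0 * e1)); [apply Rmult_le_compat_l; lra|apply Rmult_le_compat_r; [nra|lra]]. }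
      fold g0. unfold c in e1c. nra.
  - exists x0, i0; split; auto.
    assert (H2 := proj1 (proj2 (Hz i0 Hi0) t0 x0 It0)). fold Zt in H2. apply Rabs_le_iff in H2. lra.
  - exists x, i; split; auto.
    assert (H2 := proj1 (proj2 (Hz i Hi) t x ltac:(unfold I in *; lra))). fold Zt in H2. apply Rabs_le_iff in H2.
    unfold g0 in *; lra.
Qed.

(* The barrier is [- / D] with [D' = - k / (p + q * t)]. *)
Lemma Z_blowup t0 x0 i0 n1 k p q : i0 <> Still -> I t0 -> Zt i0 t0 x0 < - n1 -> 0 < n1 -> 0 < k -> 0 < p -> 0 < q ->
  W <= (/ 2 - k) * (n1 * n1) -> k < / 2 ->
  (forall t x, I t -> / (p + q * t) <= sqrt (h t x)) ->
  T < ((p + q * t0) * exp (q / (k * n1)) - p) / q.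
Proof.
  intros Hi0 It0 HZ Hn1 Hk Hp Hq HWk Hk2 Hh. apply Rnot_le_lt; intros Hbig.
  assert (G0 := g0_pos).
  set (e1 := Rmin (- n1 - Zt i0 t0 x0) (/ sqrt Mh / 2)).
  assert (B1 := Rmin_l (- n1 - Zt i0 t0 x0) (/ sqrt Mh / 2)).
  assert (B2 := Rmin_r (- n1 - Zt i0 t0 x0) (/ sqrt Mh / 2)). fold e1 in B1, B2.
  assert (He1 : 0 < e1) by (apply Rmin_pos; lra).
  destruct (riccati_approx T K HT g h u v hx ux vx Hsol Hout e1 He1) as [z [zt [zx Hz]]].
  assert (Ha : approx e1 z zt zx).
  { intros j Hj. destruct (Hz j Hj) as [C H]. split; auto. intros; apply H; auto. }
  destruct (CK_bdd T _ HT (z Fwd) (approx_CK _ _ _ _ Fwd Ha ltac:(discriminate))) as [CP HCP].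
  destruct (CK_bdd T _ HT (z Bwd) (approx_CK _ _ _ _ Bwd Ha ltac:(discriminate))) as [CM HCM].
  (* [L] exceeds all values of [Rabs z] on the strip, so a barrier that reaches [- L] by time [T] is
     a contradiction. *)
  set (L := Rabs CP + Rabs CM + n1 + 1).
  assert (HL : Rabs CP + Rabs CM < L /\ n1 < L).
  { unfold L; generalize (Rabs_pos CP) (Rabs_pos CM); lra. }
  set (c := / L).
  assert (Hc : 0 < c < / n1).
  { unfold c. split; [apply Rinv_0_lt_compat; lra|apply Rinv_lt_contravar; [nra|lra]]. }
  set (D := fun t => / n1 - k / q * (ln (p + q * t) - ln (p + q * t0))).
  assert (Ht0 : 0 <= t0) by apply It0.
  (* Solution of [D ts = c]. The bound in the statement is the solution of [D t = 0], the blow-up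
     time of the barrier, and is therefore later than [ts]. *)
  set (ts := ((p + q * t0) * exp (q / k * (/ n1 - c)) - p) / q).
  assert (Hqk : 0 < q / k) by (apply Rdiv_lt_0_compat; auto).
  assert (Hpt0 : 0 < p + q * t0) by nra.
  assert (Hts1 : t0 <= ts).
  { assert (1 <= exp (q / k * (/ n1 - c))).
    { rewrite <- exp_0. left; apply exp_increasing. apply Rmult_lt_0_compat; lra. }
    assert (E : ts * q = (p + q * t0) * exp (q / k * (/ n1 - c)) - p) by (unfold ts; field; lra).
    nra. }
  assert (Hts2 : ts <= T).
  { eapply Rle_trans; [|apply Hbig]. unfold ts. apply Rmult_le_compat_r; [left; apply Rinv_0_lt_compat; auto|].
    apply Rplus_le_compat_r, Rmult_le_compat_l; [lra|]. left; apply exp_increasing.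
    replace (q / (k * n1)) with (q / k * / n1) by (field; lra). apply Rmult_lt_compat_l; lra. }
  assert (HDts : D ts = c).
  { unfold D. replace (p + q * ts) with ((p + q * t0) * exp (q / k * (/ n1 - c))) by (unfold ts; field; lra).
    rewrite ln_mult, ln_exp by (auto; apply exp_pos). field; lra. }
  assert (HDc : forall t, t0 <= t <= ts -> c <= D t).
  { intros t Ht. rewrite <- HDts. unfold D.
    assert (ln (p + q * t) <= ln (p + q * ts)).
    { destruct (Req_dec t ts) as [->|]; [lra|]. left; apply ln_increasing; nra. }
    assert (0 < k / q) by (apply Rdiv_lt_0_compat; auto). nra. }
  assert (HDn : forall t, t0 <= t <= ts -> D t <= / n1).
  { intros t Ht. unfold D.
    assert (ln (p + q * t0) <= ln (p + q * t)).
    { destruct (Req_dec t t0) as [->|]; [lra|]. left; apply ln_increasing; nra. }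
    assert (0 < k / q) by (apply Rdiv_lt_0_compat; auto). nra. }
  destruct (barrier e1 z zt zx t0 ts (fun t => - / D t) (fun t => - (k / (p + q * t)) * (/ D t * / D t)) Ha)
    with (t := ts) as [x [i [Hi Hx]]]; auto.
  - intros t Ht. assert (HD := HDc t Ht). assert (HD2 := HDn t Ht).
    assert (HDi : n1 <= / D t).
    { rewrite <- (Rinv_inv n1). apply Rinv_le_contravar; lra. }
    assert (Hpt : 0 < p + q * t) by nra.
    split; [lra|]. split.
    + assert (HDd : is_derive D t (- (k / (p + q * t)))).
      { unfold D. auto_derive; [lra|field; lra]. }
      auto_derive; [split; [eexists; apply HDd|split; [lra|auto]]|].
      replace (Derive (fun x : R => D x) t) with (- (k / (p + q * t))) by (symmetry; apply is_derive_unique, HDd).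
      generalize dependent (D t). intros. field. lra.
    + intros y. assert (Hs := Hh t y ltac:(unfold I in *; lra)).
      set (w := / D t) in *. set (s := sqrt (h t y)) in *.
      assert (H0 : W - - w * - w / 2 <= - k * (w * w)).
      { assert (n1 * n1 <= w * w) by nra.
        assert ((/ 2 - k) * (n1 * n1) <= (/ 2 - k) * (w * w)) by (apply Rmult_le_compat_l; lra). lra. }
      assert (H1 : 0 < / (p + q * t)) by (apply Rinv_0_lt_compat; auto).
      assert (s * (W - - w * - w / 2) <= / (p + q * t) * (- k * (w * w))).
      { apply Rle_trans with (s * (- k * (w * w))); [apply Rmult_le_compat_l; lra|].
        assert (0 <= k * (w * w)) by nra. nra. }
      replace (- (k / (p + q * t)) * (w * w)) with (/ (p + q * t) * (- k * (w * w))) by (field; lra).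
      lra.
  - exists x0, i0; split; auto.
    assert (H2 := proj1 (proj2 (Hz i0 Hi0) t0 x0 It0)). fold Zt in H2. apply Rabs_le_iff in H2.
    unfold D. rewrite Rminus_diag, Rmult_0_r, Rminus_0_r, Rinv_inv. lra.
  - lra.
  - rewrite HDts in Hx. unfold c in Hx. rewrite Rinv_inv in Hx.
    assert (Rabs (z i ts x) <= Rabs CP + Rabs CM).
    { assert (Its : I ts) by (unfold I in *; lra).
      destruct i; [specialize (HCP ts x Its)|specialize (HCM ts x Its)|congruence];
      generalize (Rle_abs CP) (Rle_abs CM) (Rabs_pos CP) (Rabs_pos CM); lra. }
    apply Rabs_le_iff in H. lra.
Qed.

(** From the first equation [(h ^ (-1/2))_t = sqrt h * u_x / 2], which is a quarter of the sum of
    the two [Zt], hence at most [b / 2]. *)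
Lemma h_lower b c0 : 0 < c0 -> (forall x, c0 <= h 0 x) -> 0 <= b ->
  (forall i t x, i <> Still -> I t -> Zt i t x <= b) ->
  forall t x, I t -> / (/ sqrt c0 + b / 2 * t) <= sqrt (h t x).
Proof.
  intros Hc0 Hinit Hb HZ t x It.
  assert (Hpos : forall s, I s -> 0 < sqrt (h s x)) by (intros; apply sqrt_lt_R0, Hsol; auto).
  assert (G := pdt_growth T (fun t x => / sqrt (h t x))
     (fun t => / 4 * (Zt Fwd t x + Zt Bwd t x)) (b / 2) x).
  assert (Hder : forall s, I s -> pdt I (fun t x => / sqrt (h t x)) s x (/ 4 * (Zt Fwd s x + Zt Bwd s x))).
  { intros s Is. assert (Hs := Hpos s Is). assert (Hh : 0 < h s x) by (apply Hsol; auto).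
    assert (E : h s x = sqrt (h s x) * sqrt (h s x)) by (rewrite sqrt_sqrt; lra).
    replace (/ 4 * (Zt Fwd s x + Zt Bwd s x)) with
      (- (/ (2 * sqrt (h s x))) / (sqrt (h s x)) ^ 2 * (- (h s x) ^ 2 * ux s x)).
    - apply (pdt_comp I (fun z => / sqrt z) h s x); [apply Hsol; auto|].
      auto_derive; [split; [auto|split; [lra|auto]]|field; lra].
    - unfold Zt, Zw. simpl riemx. rewrite E at 3.
      set (ss := sqrt (h s x)) in *. field. lra. }
  specialize (G Hder ltac:(intros s Is; generalize (HZ Fwd s x ltac:(discriminate) Is) (HZ Bwd s x ltac:(discriminate) Is); lra) t It).
  assert (Hs := Hpos t It).
  rewrite <- (Rinv_inv (sqrt (h t x))). apply Rinv_le_contravar.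
  - apply Rinv_0_lt_compat; auto.
  - eapply Rle_trans; [apply G|]. apply Rplus_le_compat_r.
    apply Rinv_le_contravar; [apply sqrt_lt_R0; auto|apply sqrt_le_1_alt; auto].
Qed.
End Consequences.

(** * Extension in time *)

Lemma UC1_clamp f a b : a <= b -> (forall x, a <= x <= b -> continuous f x) -> UC1 (fun x => f (clamp a b x)).
Proof.
  intros Hab Hf e He.
  destruct (Heine f (fun x => a <= x <= b) (compact_P3 a b)
    (fun x Hx => proj2 (continuity_pt_filterlim f x) (Hf x Hx)) (mkposreal e He)) as [d Hd].
  exists (d / 2). split; [generalize (cond_pos d); lra|]. intros x x' Hx.
  left. apply Hd; try apply clamp_in; auto.
  eapply Rle_lt_trans; [apply clamp_lip|]. generalize (cond_pos d); lra.
Qed.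

Lemma UC1_continuous f x : UC1 f -> continuous f x.
Proof.
  intros H. apply continuity_pt_filterlim. intros e He. destruct (H (e / 2)) as [d [Hd Q]]; [lra|].
  exists d; split; auto. intros y [_ Hy]. unfold dist in *; simpl in *; unfold R_dist in *.
  eapply Rle_lt_trans; [apply Q|]; lra.
Qed.

Lemma UC2_cont_on I f : UC2 f -> cont_on I f.
Proof.
  intros H. apply cont_on_cto. intros t x _ e He. destruct (H e He) as [d [Hd Q]].
  exists d; split; auto. intros; apply Q; lra.
Qed.

Lemma is_derive_hinv g w : inrange g w -> is_derive (hinv g) w (Rpower (hinv g w) ((3 - g) / 2)).
Proof.
  intros Hw. unfold hinv. destruct (Req_EM_T g 1) as [->|Hg].
  - replace ((3 - 1) / 2) with 1 by field. rewrite Rpower_1 by apply exp_pos.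
    apply is_derive_Reals, derivable_pt_lim_exp.
  - destruct Hw as [|Hw]; [contradiction|].
    rewrite Rpower_mult.
    replace (Rpower (1 + (g - 1) / 2 * w) (2 / (g - 1) * ((3 - g) / 2))) with
      ((g - 1) / 2 * (2 / (g - 1) * Rpower (1 + (g - 1) / 2 * w) (2 / (g - 1) - 1))).
    + apply (is_derive_comp (fun y => Rpower y (2 / (g - 1))) (fun w => 1 + (g - 1) / 2 * w)).
      * apply is_derive_Rpower; auto.
      * auto_derive; auto. ring.
    + replace (2 / (g - 1) - 1) with (2 / (g - 1) * ((3 - g) / 2)) by (field; lra). field; lra.
Qed.

Lemma continuous_hinv g w : inrange g w -> continuous (hinv g) w.
Proof.
  intros Hw. apply ex_derive_cont. eexists; apply is_derive_hinv; auto.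
Qed.

Lemma is_derive_lam g w : inrange g w ->
  is_derive (fun w => Rpower (hinv g w) ((g + 1) / 2)) w ((g + 1) / 2 * hinv g w).
Proof.
  intros Hw.
  assert (E : (g + 1) / 2 * hinv g w = Rpower (hinv g w) ((3 - g) / 2) * ((g + 1) / 2 * Rpower (hinv g w) ((g + 1) / 2 - 1))).
  { replace (hinv g w) with (Rpower (hinv g w) 1) at 1 by (apply Rpower_1, hinv_pos).
    replace 1 with ((3 - g) / 2 + ((g + 1) / 2 - 1)) at 2 by field. rewrite Rpower_plus. ring. }
  rewrite E. apply (is_derive_comp (fun h => Rpower h ((g + 1) / 2)) (hinv g)).
  - apply is_derive_Rpower, hinv_pos.
  - apply is_derive_hinv; auto.
Qed.

(** As a function of [w = phi h] the speed has derivative [(g + 1) / 2 * h]. Clamping this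
    derivative and integrating, rather than clamping the speed, keeps the extension C^1 with a
    bounded and uniformly continuous derivative. *)
Lemma speed_extension g a b : 1 <= g -> 0 < a -> a <= b -> exists Lam Lam' C, 0 <= C /\
  (forall w, is_derive Lam w (Lam' w)) /\ (forall w, Rabs (Lam' w) <= C) /\ UC1 Lam' /\
  (forall w, phi g a <= w <= phi g b -> Lam w = Rpower (hinv g w) ((g + 1) / 2)).
Proof.
  intros Hg Ha Hab.
  assert (Hphi : phi g a <= phi g b).
  { destruct (Req_dec a b) as [->|]; [lra|]. left; apply phi_incr; lra. }
  set (w1 := phi g a) in *. set (w2 := phi g b) in *.
  assert (Hr : forall w, w1 <= w -> inrange g w).
  { intros w Hw. apply inrange_mono with w1; auto. apply inrange_phi; auto. }
  set (Lam' := fun w => (g + 1) / 2 * hinv g (clamp w1 w2 w)).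
  assert (HU : UC1 Lam').
  { apply (UC1_clamp (fun w => (g + 1) / 2 * hinv g w)); auto. intros w Hw.
    apply ex_derive_cont. eexists.
    apply (is_derive_scal (hinv g)), is_derive_hinv, Hr; lra. }
  set (L0 := fun w => Rpower (hinv g w) ((g + 1) / 2)).
  exists (fun w => L0 w1 + RInt Lam' w1 w), Lam', ((g + 1) / 2 * b).
  split; [nra|]. split; [|split; [|split]]; auto.
  - intros w. replace (Lam' w) with (0 + Lam' w) by ring.
    apply (is_derive_plus (V := R_NormedModule)); [apply (is_derive_const (V := R_NormedModule))|].
    apply (is_derive_RInt (V := R_NormedModule) Lam' _ w1).
    + exists (mkposreal 1 Rlt_0_1). intros y _. apply (RInt_correct (V := R_CompleteNormedModule)).
      apply (ex_RInt_continuous (V := R_CompleteNormedModule)). intros; apply UC1_continuous; auto.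
    + apply UC1_continuous; auto.
  - intros w. unfold Lam'. assert (Hc := clamp_in w1 w2 w Hphi).
    assert (hinv g (clamp w1 w2 w) <= b).
    { apply (phi_le_inv g); [lra| |apply hinv_pos]. rewrite phi_hinv by (apply Hr; lra). exact (proj2 Hc). }
    assert (P1 := hinv_pos g (clamp w1 w2 w)).
    rewrite Rabs_right by nra. apply Rmult_le_compat_l; lra.
  - intros w Hw.
    assert (E : RInt Lam' w1 w = L0 w - L0 w1); [|change (L0 w1 + RInt Lam' w1 w = L0 w :> R); lra].
    apply is_RInt_unique.
    apply (is_RInt_ext (fun w => (g + 1) / 2 * hinv g w)).
    + intros y. rewrite Rmin_left, Rmax_right by lra. intros Hy. unfold Lam'. rewrite clamp_id; auto; lra.
    + apply (is_RInt_derive (V := R_CompleteNormedModule) L0).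
      * intros y. rewrite Rmin_left, Rmax_right by lra. intros Hy. apply is_derive_lam, Hr; lra.
      * intros y. rewrite Rmin_left, Rmax_right by lra. intros Hy.
        apply ex_derive_cont. eexists.
        apply (is_derive_scal (hinv g)), is_derive_hinv, Hr; lra.
Qed.

Lemma small_time a b c e : 0 <= a -> 0 <= b -> 0 <= c -> 0 < e ->
  exists T, 0 < T /\ T * a <= / 2 /\ T * b <= 1 /\ T * c <= e.
Proof.
  intros Ha Hb Hc He.
  exists (Rmin (/ (2 * (a + 1))) (Rmin (/ (b + 1)) (e / (c + 1)))).
  assert (P1 : 0 < / (2 * (a + 1))) by (apply Rinv_0_lt_compat; lra).
  assert (P2 : 0 < / (b + 1)) by (apply Rinv_0_lt_compat; lra).
  assert (P3 : 0 < e / (c + 1)) by (apply Rdiv_lt_0_compat; lra).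
  assert (E1 : / (2 * (a + 1)) * (2 * (a + 1)) = 1) by (field; lra).
  assert (E2 : / (b + 1) * (b + 1) = 1) by (field; lra).
  assert (E3 : e / (c + 1) * (c + 1) = e) by (field; lra).
  set (T := Rmin _ _).
  assert (Q1 : T <= / (2 * (a + 1))) by apply Rmin_l.
  assert (Q2 : T <= / (b + 1)) by (eapply Rle_trans; [apply Rmin_r|apply Rmin_l]).
  assert (Q3 : T <= e / (c + 1)) by (eapply Rle_trans; [apply Rmin_r|apply Rmin_r]).
  split; [repeat apply Rmin_pos; auto|]. split; [nra|split; nra].
Qed.

Definition init_ok (g c Mb B : R) (h0 u0 v0 h0' u0' v0' : R -> R) :=
  (forall x, is_derive h0 x (h0' x) /\ is_derive u0 x (u0' x) /\ is_derive v0 x (v0' x)) /\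
  (forall i, UC1 (riemx g (fun _ => h0) (fun _ => h0') (fun _ => u0') (fun _ => v0') i 0)) /\
  (forall x, c <= h0 x <= Mb) /\
  (forall i x, Rabs (riem g (fun _ => h0) (fun _ => u0) (fun _ => v0) i 0 x) <= B) /\
  (forall i x, Rabs (riemx g (fun _ => h0) (fun _ => h0') (fun _ => u0') (fun _ => v0') i 0 x) <= B).

Lemma local_existence g c Mb B : 1 <= g -> 0 < c -> c <= Mb -> 0 <= B -> exists tau, 0 < tau /\
  forall h0 u0 v0 h0' u0' v0', init_ok g c Mb B h0 u0 v0 h0' u0' v0' ->
  exists h u v hx ux vx, csol g (fun t => 0 <= t <= tau) h u v hx ux vx /\
  forall x, h 0 x = h0 x /\ u 0 x = u0 x /\ v 0 x = v0 x.
Proof.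
  intros Hg Hc HcM HB.
  destruct (speed_extension g (c / 2) (2 * Mb) Hg ltac:(lra) ltac:(lra)) as [Lam [Lam' [C0 [HC0 [HL [HLb [HLu HLe]]]]]]].
  (* The room between the data range [[phi c, phi Mb]] and the range [[phi (c / 2), phi (2 * Mb)]]
     on which the extended speed is exact; [tau] is chosen so that [wv rho] moves by at most
     [th]. *)
  set (th := Rmin (phi g c - phi g (c / 2)) (phi g (2 * Mb) - phi g Mb)).
  assert (B1 := Rmin_l (phi g c - phi g (c / 2)) (phi g (2 * Mb) - phi g Mb)).
  assert (B2 := Rmin_r (phi g c - phi g (c / 2)) (phi g (2 * Mb) - phi g Mb)). fold th in B1, B2.
  assert (Hth : 0 < th).
  { apply Rmin_pos; [assert (phi g (c / 2) < phi g c)|assert (phi g Mb < phi g (2 * Mb))]; try (apply phi_incr); lra. }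
  (* Bounds [Lam] on [Rabs w <= B + 1], the value of [A] in the local theory when [A0 = B]. *)
  set (C := C0 * (B + 2) + Rabs (Lam 0)).
  assert (HC : C0 <= C) by (unfold C; generalize (Rabs_pos (Lam 0)); nra).
  assert (HCb : forall w, Rabs w <= B + 1 -> Rabs (Lam w) <= C).
  { intros w Hw. replace (Lam w) with ((Lam w - Lam 0) + Lam 0) by ring.
    eapply Rle_trans; [apply Rabs_triang|]. unfold C. apply Rplus_le_compat_r.
    eapply Rle_trans; [apply (MVT_lip Lam Lam' C0); auto|]. rewrite Rminus_0_r. nra. }
  destruct (small_time ((C + 1) * (B + 1) * (2 * B + 1 + 2)) (B + 1) (B * C + (B + 1)) th) as [tau [Ht [H1 [H2 H3]]]];
    try nra.
  exists tau; split; auto.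
  intros h0 u0 v0 h0' u0' v0' [HD [HU [Hh [Hr Hrx]]]].
  set (r0 := fun i => riem g (fun _ => h0) (fun _ => u0) (fun _ => v0) i 0) in *.
  set (r0' := fun i => riemx g (fun _ => h0) (fun _ => h0') (fun _ => u0') (fun _ => v0') i 0) in *.
  assert (Hr0 : forall i x, is_derive (r0 i) x (r0' i x)).
  { intros i x. destruct (HD x) as [D1 [D2 D3]].
    assert (DP : is_derive (fun x => phi g (h0 x)) x (Rpower (h0 x) ((g - 3) / 2) * h0' x)).
    { rewrite Rmult_comm. apply (is_derive_comp (phi g) h0); auto. apply is_derive_phi.
      destruct (Hh x); lra. }
    destruct i; unfold r0, r0', riem, riemx; auto.
    - apply (is_derive_plus (V := R_NormedModule)); auto.
    - apply (is_derive_minus (V := R_NormedModule)); auto. }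
  destruct (local_solution Lam Lam' C B B tau r0 r0') as [rho [p [U1 [U2 [Dx [E0 [Hclose Hpdt]]]]]]]; auto; try lra.
  { intros w; eapply Rle_trans; [apply HLb|auto]. }
  set (I := fun t => 0 <= t <= tau) in *.
  assert (Hw : forall t x, phi g (c / 2) <= wv rho t x <= phi g (2 * Mb)).
  { intros t x. assert (K1 := Hclose Fwd t x). assert (K2 := Hclose Bwd t x).
    assert (E : phi g (h0 x) = (r0 Fwd x - r0 Bwd x) / 2) by (unfold r0; simpl; field).
    destruct (Hh x) as [Hh1 Hh2].
    assert (phi g c <= phi g (h0 x)).
    { destruct (Req_dec c (h0 x)) as [<-|]; [lra|]. left; apply phi_incr; lra. }
    assert (phi g (h0 x) <= phi g Mb).
    { destruct (Req_dec (h0 x) Mb) as [->|]; [lra|]. left; apply phi_incr; lra. }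
    apply Rabs_le_iff in K1, K2. unfold wv. lra. }
  assert (Hrange : forall t x, inrange g (wv rho t x)).
  { intros t x. apply inrange_mono with (phi g (c / 2)); auto; [|apply Hw]. apply inrange_phi; lra. }
  assert (Cr : forall i, cont_on I (rho i)) by (intros; apply UC2_cont_on; auto).
  assert (Cp : forall i, cont_on I (p i)) by (intros; apply UC2_cont_on; auto).
  assert (Cwv : cont_on I (wv rho)).
  { apply (cont_on_ext I (fun t x => / 2 * (rho Fwd t x - rho Bwd t x))); [intros; unfold wv; field|].
    apply cont_on_scal, cont_on_minus; auto. }
  assert (CL : cont_on I (fun t x => Lam (wv rho t x))).
  { apply cont_on_comp; auto. intros. apply ex_derive_cont. eexists; apply HL. }
  assert (C1 : forall i, C1e I (rho i) (fun t x => src i (fun j => rho j t x) - sg i * Lam (wv rho t x) * p i t x) (p i)).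
  { intros i. split; [|split; [|split; [|split]]]; auto.
    apply cont_on_minus.
    - destruct i; simpl; auto.
      apply (cont_on_ext I (fun t x => - / 2 * (rho Fwd t x + rho Bwd t x))); [intros; field|].
      apply cont_on_scal, cont_on_plus; auto.
    - apply cont_on_mult; auto. apply cont_on_scal; auto. }
  assert (CU : C1e I (fun t x => / 2 * (rho Fwd t x + rho Bwd t x))
     (fun t x => rho Still t x - Lam (wv rho t x) * wv p t x) (fun t x => / 2 * (p Fwd t x + p Bwd t x))).
  { generalize (C1e_scal I (/ 2) _ _ _ (C1e_plus _ _ _ _ _ _ _ (C1 Fwd) (C1 Bwd))).
    apply C1e_ext; auto. intros; simpl; unfold wv; field. }
  assert (CW : C1e I (wv rho) (fun t x => - Lam (wv rho t x) * (/ 2 * (p Fwd t x + p Bwd t x))) (wv p)).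
  { generalize (C1e_scal I (/ 2) _ _ _ (C1e_plus _ _ _ _ _ _ _ (C1 Fwd) (C1e_scal _ (-1) _ _ _ (C1 Bwd)))).
    apply C1e_ext; intros; simpl; unfold wv; field. }
  assert (CH := C1e_comp I (hinv g) (fun w => Rpower (hinv g w) ((3 - g) / 2)) _ _ _
    (fun t x _ => is_derive_hinv g _ (Hrange t x))
    (fun t x _ => continuous_comp (hinv g) (fun h => Rpower h ((3 - g) / 2)) _
       (continuous_hinv g _ (Hrange t x)) (continuous_Rpower _ _ (hinv_pos g _))) CW).
  cbv beta in CH.
  exists (fun t x => hinv g (wv rho t x)), (fun t x => / 2 * (rho Fwd t x + rho Bwd t x)), (rho Still),
    (fun t x => Rpower (hinv g (wv rho t x)) ((3 - g) / 2) * wv p t x),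
    (fun t x => / 2 * (p Fwd t x + p Bwd t x)), (p Still).
  split; [split; [|split; [|split]]|].
  - revert CH. apply C1e_ext; auto. intros t x It. rewrite HLe by auto.
    rewrite <- Rpower_2 by apply hinv_pos.
    assert (X : Rpower (hinv g (wv rho t x)) 2 =
      Rpower (hinv g (wv rho t x)) ((3 - g) / 2) * Rpower (hinv g (wv rho t x)) ((g + 1) / 2)).
    { rewrite <- Rpower_plus. f_equal; field. }
    rewrite X. ring.
  - revert CU. apply C1e_ext; auto. intros t x It. rewrite HLe by auto.
    replace ((g + 1) / 2) with ((g - 1) + (3 - g) / 2) by field. rewrite Rpower_plus. ring.
  - generalize (C1 Still). apply C1e_ext; auto. intros t x It. simpl. field.
  - intros; apply hinv_pos.
  - intros x. unfold wv. rewrite !E0. unfold r0; simpl.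
    replace ((u0 x + phi g (h0 x) - (u0 x - phi g (h0 x))) / 2) with (phi g (h0 x)) by field.
    rewrite hinv_phi by (destruct (Hh x); lra). split; [auto|split; [field|auto]].
Qed.

(** * Gluing two solutions in time *)

Definition glue (T : R) (f f2 : R -> R -> R) (t x : R) : R := if Rle_dec t T then f t x else f2 (t - T) x.

Lemma glue_l T f f2 t x : t <= T -> glue T f f2 t x = f t x.
Proof. intros H; unfold glue; destruct Rle_dec; auto; lra. Qed.

Lemma glue_r T f f2 t x : (forall y, f2 0 y = f T y) -> T <= t -> glue T f f2 t x = f2 (t - T) x.
Proof.
  intros E H; unfold glue; destruct Rle_dec; auto.
  replace t with T by lra. rewrite Rminus_diag; auto.
Qed.

Section Glue.
Variables (T tau : R).
Hypothesis HT : 0 <= T.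
Hypothesis Htau : 0 < tau.
Let I1 := fun t => 0 <= t <= T.
Let I2 := fun t => 0 <= t <= tau.
Let I := fun t => 0 <= t <= T + tau.

Lemma glue_cont f f2 : (forall y, f2 0 y = f T y) -> cont_on I1 f -> cont_on I2 f2 -> cont_on I (glue T f f2).
Proof.
  intros E H1 H2. apply cont_on_cto in H1, H2. apply cont_on_cto. intros t x It e He. unfold I in It.
  assert (HL : t <= T -> exists d, 0 < d /\ forall s y, 0 <= s <= T -> Rabs (s - t) < d -> Rabs (y - x) < d ->
     Rabs (glue T f f2 s y - glue T f f2 t x) <= e).
  { intros Ht. destruct (H1 t x ltac:(unfold I1; lra) e He) as [d [Hd Q]]. exists d; split; auto.
    intros s y Hs Hst Hy. rewrite !glue_l by lra. apply Q; auto. }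
  assert (HR : T <= t -> exists d, 0 < d /\ forall s y, T <= s <= T + tau -> Rabs (s - t) < d -> Rabs (y - x) < d ->
     Rabs (glue T f f2 s y - glue T f f2 t x) <= e).
  { intros Ht. destruct (H2 (t - T) x ltac:(unfold I2; lra) e He) as [d [Hd Q]]. exists d; split; auto.
    intros s y Hs Hst Hy. rewrite !glue_r by (auto; lra). apply Q; [unfold I2; lra| |auto].
    replace (s - T - (t - T)) with (s - t) by ring; auto. }
  destruct (Rtotal_order t T) as [Hlt|[Heq|Hgt]].
  - destruct (HL ltac:(lra)) as [d [Hd Q]]. exists (Rmin d (T - t)); split; [apply Rmin_pos; lra|].
    intros s y Is Hs Hy. rmin_bounds d (T - t).
    apply Q; try lra. unfold I in Is. apply Rabs_def2 in Hs. lra.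
  - destruct (HL ltac:(lra)) as [d1 [Hd1 Q1]]. destruct (HR ltac:(lra)) as [d2 [Hd2 Q2]].
    exists (Rmin d1 d2); split; [apply Rmin_pos; lra|].
    intros s y Is Hs Hy. rmin_bounds d1 d2. unfold I in Is.
    destruct (Rle_dec s T); [apply Q1|apply Q2]; lra.
  - destruct (HR ltac:(lra)) as [d [Hd Q]]. exists (Rmin d (t - T)); split; [apply Rmin_pos; lra|].
    intros s y Is Hs Hy. rmin_bounds d (t - T).
    apply Q; try lra. unfold I in Is. apply Rabs_def2 in Hs. lra.
Qed.

Lemma glue_pdt f f2 ft ft2 : (forall y, f2 0 y = f T y) -> (forall y, ft2 0 y = ft T y) ->
  (forall t x, I1 t -> pdt I1 f t x (ft t x)) -> (forall t x, I2 t -> pdt I2 f2 t x (ft2 t x)) ->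
  forall t x, I t -> pdt I (glue T f f2) t x (glue T ft ft2 t x).
Proof.
  intros E Et H1 H2 t x It e He. unfold I in It.
  assert (HL : t <= T -> exists d, 0 < d /\ forall s, 0 <= s <= T -> Rabs (s - t) < d ->
     Rabs (glue T f f2 s x - glue T f f2 t x - glue T ft ft2 t x * (s - t)) <= e * Rabs (s - t)).
  { intros Ht. destruct (H1 t x ltac:(unfold I1; lra) e He) as [d [Hd Q]]. exists d; split; auto.
    intros s Hs Hst. rewrite !glue_l by lra. apply Q; auto. }
  assert (HR : T <= t -> exists d, 0 < d /\ forall s, T <= s <= T + tau -> Rabs (s - t) < d ->
     Rabs (glue T f f2 s x - glue T f f2 t x - glue T ft ft2 t x * (s - t)) <= e * Rabs (s - t)).
  { intros Ht. destruct (H2 (t - T) x ltac:(unfold I2; lra) e He) as [d [Hd Q]]. exists d; split; auto.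
    intros s Hs Hst. rewrite !glue_r by (auto; lra).
    replace (s - t) with (s - T - (t - T)) by ring. apply Q; [unfold I2; lra|].
    replace (s - T - (t - T)) with (s - t) by ring; auto. }
  destruct (Rtotal_order t T) as [Hlt|[Heq|Hgt]].
  - destruct (HL ltac:(lra)) as [d [Hd Q]]. exists (Rmin d (T - t)); split; [apply Rmin_pos; lra|].
    intros s Is Hs. rmin_bounds d (T - t).
    apply Q; try lra. unfold I in Is. apply Rabs_def2 in Hs. lra.
  - destruct (HL ltac:(lra)) as [d1 [Hd1 Q1]]. destruct (HR ltac:(lra)) as [d2 [Hd2 Q2]].
    exists (Rmin d1 d2); split; [apply Rmin_pos; lra|].
    intros s Is Hs. rmin_bounds d1 d2. unfold I in Is.
    destruct (Rle_dec s T); [apply Q1|apply Q2]; lra.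
  - destruct (HR ltac:(lra)) as [d [Hd Q]]. exists (Rmin d (t - T)); split; [apply Rmin_pos; lra|].
    intros s Is Hs. rmin_bounds d (t - T).
    apply Q; try lra. unfold I in Is. apply Rabs_def2 in Hs. lra.
Qed.

Lemma glue_C1e f ft fx f2 ft2 fx2 : (forall y, f2 0 y = f T y) -> (forall y, ft2 0 y = ft T y) ->
  C1e I1 f ft fx -> C1e I2 f2 ft2 fx2 -> C1e I (glue T f f2) (glue T ft ft2) (glue T fx fx2).
Proof.
  intros E Et [H1 [H2 [H3 [H4 H5]]]] [G1 [G2 [G3 [G4 G5]]]].
  assert (Ex : forall y, fx2 0 y = fx T y).
  { intros y. assert (A1 := G2 0 y ltac:(unfold I2; lra)). assert (A2 := H2 T y ltac:(unfold I1; lra)).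
    apply is_derive_unique in A1, A2. rewrite <- A1, <- A2. apply Derive_ext; auto. }
  split; [|split; [|split; [|split]]]; try (apply glue_cont; auto).
  - apply glue_pdt; auto.
  - intros t x It. unfold I in It. unfold glue. destruct (Rle_dec t T).
    + apply H2. unfold I1; lra.
    + apply G2. unfold I2; lra.
Qed.

(** Agreement of the values at time [T] suffices: it forces agreement of the [x]-derivatives, and
    the equations then give agreement of the time derivatives. *)
Lemma glue_csol g h u v hx ux vx h2 u2 v2 hx2 ux2 vx2 :
  csol g I1 h u v hx ux vx -> csol g I2 h2 u2 v2 hx2 ux2 vx2 ->
  (forall x, h2 0 x = h T x /\ u2 0 x = u T x /\ v2 0 x = v T x) ->
  csol g I (glue T h h2) (glue T u u2) (glue T v v2) (glue T hx hx2) (glue T ux ux2) (glue T vx vx2).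
Proof.
  intros [H1 [H2 [H3 H4]]] [G1 [G2 [G3 G4]]] E.
  assert (D : forall f fx f2 fx2 ft ft2, C1e I1 f ft fx -> C1e I2 f2 ft2 fx2 -> (forall x, f2 0 x = f T x) -> forall y, fx2 0 y = fx T y).
  { intros f fx f2 fx2 ft ft2 [_ [A1 _]] [_ [A2 _]] Ef y.
    specialize (A1 T y ltac:(unfold I1; lra)). specialize (A2 0 y ltac:(unfold I2; lra)).
    apply is_derive_unique in A1, A2. rewrite <- A1, <- A2. apply Derive_ext; auto. }
  assert (Eh : forall x, h2 0 x = h T x) by apply E.
  assert (Eu : forall x, u2 0 x = u T x) by apply E.
  assert (Ev : forall x, v2 0 x = v T x) by apply E.
  assert (Dh := D _ _ _ _ _ _ H1 G1 Eh). assert (Du := D _ _ _ _ _ _ H2 G2 Eu).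
  assert (T1 : forall y, - h2 0 y ^ 2 * ux2 0 y = - h T y ^ 2 * ux T y) by (intros; rewrite Eh, Du; auto).
  assert (T2 : forall y, v2 0 y - Rpower (h2 0 y) (g - 1) * hx2 0 y = v T y - Rpower (h T y) (g - 1) * hx T y)
    by (intros; rewrite Eh, Ev, Dh; auto).
  assert (T3 : forall y, - u2 0 y = - u T y) by (intros; rewrite Eu; auto).
  split; [|split; [|split]].
  - generalize (glue_C1e _ _ _ _ _ _ Eh T1 H1 G1).
    apply C1e_ext; auto. intros t x _. unfold glue. destruct Rle_dec; auto.
  - generalize (glue_C1e _ _ _ _ _ _ Eu T2 H2 G2).
    apply C1e_ext; auto. intros t x _. unfold glue. destruct Rle_dec; auto.
  - generalize (glue_C1e _ _ _ _ _ _ Ev T3 H3 G3).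
    apply C1e_ext; auto. intros t x _. unfold glue. destruct Rle_dec; auto.
  - intros t x It. unfold I in It. unfold glue. destruct (Rle_dec t T); [apply H4|apply G4]; unfold I1, I2; lra.
Qed.
End Glue.

Lemma csol_sub g (I J : R -> Prop) h u v hx ux vx : (forall t, J t -> I t) ->
  csol g I h u v hx ux vx -> csol g J h u v hx ux vx.
Proof.
  intros HJ [H1 [H2 [H3 H4]]]. split; [|split; [|split]]; eauto using C1e_sub.
Qed.

Lemma C1e_slice_UC1 (I : R -> Prop) f K t c : I t -> cont_on I f -> (forall x, K < Rabs x -> f t x = c) -> UC1 (f t).
Proof.
  intros It Hc Hout. set (a := Rabs K + 1). assert (KK := Rle_abs K). assert (KP := Rabs_pos K).
  assert (H : UC1 (fun x => f t (clamp (- a) a x))).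
  { apply UC1_clamp; [unfold a; lra|]. intros x _. apply continuity_pt_filterlim. intros e He.
    apply cont_on_cto in Hc. destruct (Hc t x It (e / 2)) as [d [Hd Q]]; [lra|].
    exists d; split; auto. intros y [_ Hy]. unfold dist in *; simpl in *; unfold R_dist in *.
    eapply Rle_lt_trans; [apply Q; auto; rewrite Rminus_diag, Rabs_R0; auto|lra]. }
  assert (E : forall x, f t (clamp (- a) a x) = f t x).
  { intros x. destruct (Rle_dec (Rabs x) a) as [Hx|Hx].
    - apply Rabs_le_iff in Hx. rewrite clamp_id; auto.
    - apply Rnot_le_lt in Hx. rewrite (Hout x) by (unfold a in *; lra).
      apply Hout. unfold clamp, Rmax, Rmin. unfold a in *. revert Hx.
      repeat destruct Rle_dec; unfold Rabs at 1 2; repeat destruct Rcase_abs; unfold Rabs; repeat destruct Rcase_abs; lra. }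
  intros e He. destruct (H e He) as [d [Hd Q]]. exists d; split; auto. intros x x' Hx.
  rewrite <- (E x), <- (E x'). auto.
Qed.

Lemma extension g c Mb B : 1 <= g -> 0 < c -> c <= Mb -> 0 <= B -> exists tau, 0 < tau /\
  forall T K h u v hx ux vx tau', 0 <= T -> csol g (fun t => 0 <= t <= T) h u v hx ux vx ->
  (forall x, K < Rabs x -> h T x = 1 /\ u T x = 0 /\ v T x = 0) ->
  (forall x, c <= h T x <= Mb) -> (forall i x, Rabs (riem g h u v i T x) <= B) ->
  (forall i x, Rabs (riemx g h hx ux vx i T x) <= B) -> 0 < tau' <= tau ->
  exists H U V Hx Ux Vx, csol g (fun t => 0 <= t <= T + tau') H U V Hx Ux Vx /\
  forall t x, 0 <= t <= T -> H t x = h t x /\ U t x = u t x /\ V t x = v t x.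
Proof.
  intros Hg Hc HcM HB.
  destruct (local_existence g c Mb B Hg Hc HcM HB) as [tau [Htau HE]].
  exists tau; split; auto. intros T K h u v hx ux vx tau' HT Hsol Hout Hh Hr Hrx Ht'.
  assert (IT : 0 <= T <= T) by lra.
  assert (HC := csol_dsol _ _ _ _ _ _ _ _ Hsol).
  destruct (HE (h T) (u T) (v T) (hx T) (ux T) (vx T)) as [h2 [u2 [v2 [hx2 [ux2 [vx2 [Hs2 E2]]]]]]].
  { split; [|split; [|split; [|split]]]; auto.
    - intros x. destruct Hsol as [[_ [D1 _]] [[_ [D2 _]] [[_ [D3 _]] _]]]. split; [|split]; auto.
    - intros i. destruct (HC i) as [_ [D [_ [_ C]]]].
      apply (C1e_slice_UC1 (fun t => 0 <= t <= T) (riemx g h hx ux vx i) (Rabs K) T 0 IT C).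
      intros x Hx.
      assert (Z : forall y, K < Rabs y -> riem g h u v i T y = 0).
      { intros y Hy. destruct (Hout y Hy) as [E1 [E2 E3]].
        destruct i; simpl; rewrite ?E1, ?E2, ?E3, ?phi_1; ring. }
      assert (HD := D T x IT). apply is_derive_unique in HD. rewrite <- HD.
      apply is_derive_unique. apply (is_derive_ext_loc (fun _ => 0)).
      + assert (KK := Rle_abs K). exists (mkposreal (Rabs x - Rabs K) ltac:(lra)). intros y Hy. symmetry. apply Z.
        change (Rabs (y - x) < Rabs x - Rabs K) in Hy.
        assert (Rabs x <= Rabs y + Rabs (y - x)).
        { rewrite (Rabs_minus_sym y x). replace x with (y + (x - y)) at 1 by ring. apply Rabs_triang. }
        lra.
      + apply (is_derive_const (V := R_NormedModule)). }
  exists (glue T h h2), (glue T u u2), (glue T v v2), (glue T hx hx2), (glue T ux ux2), (glue T vx vx2).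
  split.
  - apply glue_csol; auto; [lra|]. revert Hs2; apply csol_sub. intros; lra.
  - intros; rewrite !glue_l by lra; auto.
Qed.

(** * The maximal solution *)

(** With derivatives as functions of [f], a solution is given by three functions alone, and
    solutions that agree at a time have the same derivatives in [x] there. *)
Definition pdx (f : R -> R -> R) (t x : R) : R := Derive (f t) x.

Definition csolD g I h u v := csol g I h u v (pdx h) (pdx u) (pdx v).

Lemma csol_csolD g I h u v hx ux vx : csol g I h u v hx ux vx -> csolD g I h u v.
Proof.
  intros [H1 [H2 [H3 H4]]].
  assert (E : forall f ft fx, C1e I f ft fx -> forall t x, I t -> fx t x = pdx f t x).
  { intros f ft fx [_ [D _]] t x It. symmetry. apply is_derive_unique; auto. }
  assert (E1 := E _ _ _ H1). assert (E2 := E _ _ _ H2). assert (E3 := E _ _ _ H3).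
  split; [|split; [|split]]; auto.
  - revert H1; apply C1e_ext; auto. intros; rewrite E2; auto.
  - revert H2; apply C1e_ext; auto. intros; rewrite E1; auto.
  - revert H3; apply C1e_ext; auto.
Qed.

Lemma pdx_ext f f' t : (forall x, f t x = f' t x) -> forall x, pdx f t x = pdx f' t x.
Proof. intros H x. apply Derive_ext; auto. Qed.

Lemma csolD_ext g (I : R -> Prop) h u v h' u' v' :
  (forall t x, I t -> h t x = h' t x /\ u t x = u' t x /\ v t x = v' t x) ->
  csolD g I h u v -> csolD g I h' u' v'.
Proof.
  intros E [H1 [H2 [H3 H4]]].
  assert (Eh : forall t x, I t -> h t x = h' t x) by (intros; apply E; auto).
  assert (Eu : forall t x, I t -> u t x = u' t x) by (intros; apply E; auto).
  assert (Ev : forall t x, I t -> v t x = v' t x) by (intros; apply E; auto).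
  assert (Dh : forall t x, I t -> pdx h t x = pdx h' t x) by (intros; apply pdx_ext; auto).
  assert (Du : forall t x, I t -> pdx u t x = pdx u' t x) by (intros; apply pdx_ext; auto).
  assert (Dv : forall t x, I t -> pdx v t x = pdx v' t x) by (intros; apply pdx_ext; auto).
  split; [|split; [|split]].
  - revert H1; apply C1e_ext; auto. intros; rewrite Eh, Du; auto.
  - revert H2; apply C1e_ext; auto. intros; rewrite Eh, Ev, Dh; auto.
  - revert H3; apply C1e_ext; auto. intros; rewrite Eu; auto.
  - intros. rewrite <- Eh; auto.
Qed.

Lemma C1e_local (I : R -> Prop) f ft fx :
  (forall t, I t -> exists (J : R -> Prop) d, 0 < d /\ J t /\ (forall s, I s -> Rabs (s - t) < d -> J s) /\ C1e J f ft fx) ->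
  C1e I f ft fx.
Proof.
  intros H.
  assert (HC : forall q, (forall t, I t -> exists (J : R -> Prop) d, 0 < d /\ J t /\
     (forall s, I s -> Rabs (s - t) < d -> J s) /\ cont_on J q) -> cont_on I q).
  { intros q Hq. apply cont_on_cto. intros t x It e He.
    destruct (Hq t It) as [J [d [Hd [Jt [HJ C]]]]]. apply cont_on_cto in C.
    destruct (C t x Jt e He) as [d' [Hd' Q]]. exists (Rmin d d'); split; [apply Rmin_pos; auto|].
    intros s y Is Hs Hy. assert (A1 := Rmin_l d d'). assert (A2 := Rmin_r d d').
    apply Q; try lra. apply HJ; auto; lra. }
  split; [|split; [|split; [|split]]].
  - intros t x It e He. destruct (H t It) as [J [d [Hd [Jt [HJ [C _]]]]]].
    destruct (C t x Jt e He) as [d' [Hd' Q]]. exists (Rmin d d'); split; [apply Rmin_pos; auto|].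
    intros s Is Hs. assert (A1 := Rmin_l d d'). assert (A2 := Rmin_r d d').
    apply Q; try lra. apply HJ; auto; lra.
  - intros t x It. destruct (H t It) as [J [d [Hd [Jt [HJ [_ [C _]]]]]]]. auto.
  - apply HC. intros t It. destruct (H t It) as [J [d [Hd [Jt [HJ [_ [_ [C _]]]]]]]]. exists J, d; auto.
  - apply HC. intros t It. destruct (H t It) as [J [d [Hd [Jt [HJ [_ [_ [_ [C _]]]]]]]]]. exists J, d; auto.
  - apply HC. intros t It. destruct (H t It) as [J [d [Hd [Jt [HJ [_ [_ [_ [_ C]]]]]]]]]. exists J, d; auto.
Qed.

Lemma csolD_local g (I : R -> Prop) h u v :
  (forall t, I t -> exists (J : R -> Prop) d, 0 < d /\ J t /\ (forall s, I s -> Rabs (s - t) < d -> J s) /\ csolD g J h u v) ->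
  csolD g I h u v.
Proof.
  intros H. split; [|split; [|split]];
    try (apply C1e_local; intros t It; destruct (H t It) as [J [d [Hd [Jt [HJ [C1 [C2 [C3 _]]]]]]]]; exists J, d; auto).
  intros t x It. destruct (H t It) as [J [d [Hd [Jt [HJ [_ [_ [_ C]]]]]]]]. auto.
Qed.

(** A final time with total functions [h], [u], [v], whose values matter only on [[0, tm s]]. *)
Definition state4 : Type := (R * (R -> R -> R) * (R -> R -> R) * (R -> R -> R))%type.
Definition tm (s : state4) : R := fst (fst (fst s)).
Definition ch (s : state4) := snd (fst (fst s)).
Definition cu (s : state4) := snd (fst s).
Definition cv (s : state4) := snd s.

Definition extends (s s' : state4) := tm s <= tm s' /\
  forall t x, 0 <= t <= tm s -> ch s' t x = ch s t x /\ cu s' t x = cu s t x /\ cv s' t x = cv s t x.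

Lemma extends_refl s : extends s s.
Proof. split; [lra|auto]. Qed.

Lemma extends_trans s1 s2 s3 : extends s1 s2 -> extends s2 s3 -> extends s1 s3.
Proof.
  intros [H1 H2] [H3 H4]. split; [lra|]. intros t x Ht.
  destruct (H2 t x Ht) as [<- [<- <-]]. apply H4; lra.
Qed.

(* Taking half of the longest possible step avoids any appeal to uniqueness of solutions. *)
Lemma greedy_chain (Good : state4 -> Prop) TM s0 : Good s0 -> (forall s, Good s -> tm s < TM) ->
  (forall s, Good s -> exists s', Good s' /\ extends s s' /\ tm s < tm s') ->
  exists q : nat -> state4, q 0%nat = s0 /\ forall n, Good (q n) /\ extends (q n) (q (S n)) /\ tm (q n) < tm (q (S n)) /\
    forall s', Good s' -> extends (q n) s' -> tm s' - tm (q n) <= 2 * (tm (q (S n)) - tm (q n)).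
Proof.
  intros H0 HTM Hex.
  assert (Hs : forall s : {s | Good s}, exists s' : {s | Good s}, extends (proj1_sig s) (proj1_sig s') /\
     tm (proj1_sig s) < tm (proj1_sig s') /\ forall s2, Good s2 -> extends (proj1_sig s) s2 ->
     tm s2 - tm (proj1_sig s) <= 2 * (tm (proj1_sig s') - tm (proj1_sig s))).
  { intros [s Hs]. simpl.
    set (E := fun d => exists s', Good s' /\ extends s s' /\ d = tm s' - tm s).
    destruct (completeness E) as [L [HL1 HL2]].
    { exists (TM - tm s). intros d [s' [G [_ ->]]]. specialize (HTM s' G). lra. }
    { exists 0, s. split; [auto|split; [apply extends_refl|lra]]. }
    destruct (Hex s Hs) as [s1 [G1 [X1 Y1]]].
    assert (HLpos : 0 < L).
    { apply Rlt_le_trans with (tm s1 - tm s); [lra|]. apply HL1. exists s1; auto. }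
    assert (Hhalf : exists s', Good s' /\ extends s s' /\ L / 2 < tm s' - tm s).
    { apply NNPP; intros Hno. assert (L <= L / 2); [|lra]. apply HL2. intros d [s' [G [X ->]]].
      apply Rnot_lt_le; intros Hlt. apply Hno. exists s'; auto. }
    destruct Hhalf as [s' [G [X Y]]]. exists (exist _ s' G). simpl. split; [auto|split; [lra|]].
    intros s2 G2 X2. assert (tm s2 - tm s <= L) by (apply HL1; exists s2; auto). lra. }
  apply functional_choice in Hs. destruct Hs as [next Hnext].
  exists (fun n => proj1_sig (Nat.iter n next (exist _ s0 H0))). split; auto.
  intros n. simpl. destruct (Hnext (Nat.iter n next (exist _ s0 H0))) as [X1 [X2 X3]].
  split; [apply proj2_sig|auto].
Qed.

(** As the times increase strictly, their supremum [Ts] is not attained. At each [t < Ts] some index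
    reaching beyond [t] is chosen, and [extends] makes the value independent of the choice. *)
Lemma chain_union (q : nat -> state4) TM : (forall n, extends (q n) (q (S n)) /\ tm (q n) < tm (q (S n))) ->
  (forall n, tm (q n) < TM) ->
  exists Ts H U V, Ts <= TM /\ (forall n, tm (q n) < Ts) /\ (forall t, t < Ts -> exists n, t < tm (q n)) /\
  forall n t x, 0 <= t <= tm (q n) -> H t x = ch (q n) t x /\ U t x = cu (q n) t x /\ V t x = cv (q n) t x.
Proof.
  intros Hq HTM.
  set (E := fun t => exists n, t = tm (q n)).
  destruct (completeness E) as [Ts [H1 H2]].
  { exists TM. intros t [n ->]. left; auto. }
  { exists (tm (q 0%nat)), 0%nat; auto. }
  assert (Hlt : forall n, tm (q n) < Ts).
  { intros n. apply Rlt_le_trans with (tm (q (S n))); [apply Hq|]. apply H1; exists (S n); auto. }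
  assert (Hex : forall t, t < Ts -> exists n, t < tm (q n)).
  { intros t Ht. apply NNPP; intros Hno. assert (Ts <= t); [|lra]. apply H2. intros r [n ->].
    apply Rnot_lt_le; intros Hl. apply Hno; exists n; auto. }
  assert (Hext : forall n k, extends (q n) (q (n + k)%nat)).
  { intros n k; induction k; [rewrite Nat.add_0_r; apply extends_refl|].
    rewrite Nat.add_succ_r. eapply extends_trans; [apply IHk|apply Hq]. }
  assert (Hpick : forall t, exists n, t < Ts -> t < tm (q n)).
  { intros t. destruct (Rlt_dec t Ts) as [Ht|Ht]; [destruct (Hex t Ht) as [n Hn]; exists n; auto|exists 0%nat; intros; lra]. }
  apply functional_choice in Hpick. destruct Hpick as [N HN].
  exists Ts, (fun t x => ch (q (N t)) t x), (fun t x => cu (q (N t)) t x), (fun t x => cv (q (N t)) t x).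
  split; [|split; [auto|split; [auto|]]].
  - apply H2. intros t [n ->]. left; auto.
  - intros n t x Ht. assert (HNt : t < tm (q (N t))) by (apply HN; specialize (Hlt n); lra).
    destruct (Nat.le_ge_cases n (N t)) as [Hle|Hge].
    + destruct (Hext n (N t - n)%nat) as [_ K]. replace (n + (N t - n))%nat with (N t) in K by lia.
      apply K; auto.
    + destruct (Hext (N t) (n - N t)%nat) as [_ K]. replace (N t + (n - N t))%nat with n in K by lia.
      destruct (K t x ltac:(lra)) as [-> [-> ->]]; auto.
Qed.

Definition ZD g (h u v : R -> R -> R) := Zw g h (pdx h) (pdx u) (pdx v).

Lemma Zj_ZD g h u v t x : Zj g 1 h u t x = ZD g h u v Bwd t x /\ Zj g 2 h u t x = ZD g h u v Fwd t x.
Proof.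
  unfold Zj, ZD, Zw, riemx, pdx.
  change (Derive (fun y => u t y) x) with (Derive (u t) x).
  change (Derive (fun y => h t y) x) with (Derive (h t) x).
  split; f_equal; simpl; ring.
Qed.

Lemma riem_zero_out g h u v t x : 0 < h t x -> (forall i, riem g h u v i t x = 0) ->
  h t x = 1 /\ u t x = 0 /\ v t x = 0.
Proof.
  intros Hh H. assert (HP := H Fwd). assert (HM := H Bwd). assert (HO := H Still). simpl in *.
  split; [|split; lra].
  assert (E := hinv_phi g (h t x) Hh). replace (phi g (h t x)) with 0 in E by lra. rewrite <- E; apply hinv_0.
Qed.

Lemma cont_on_speed g I h u v hx ux vx : csol g I h u v hx ux vx -> cont_on I (speed g h).
Proof.
  intros HS. apply (cont_on_comp I (fun z => Rpower z ((g + 1) / 2))); [|apply HS].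
  intros t x It. apply continuous_Rpower, HS; auto.
Qed.

Lemma speed_at_rest g I h u v hx ux vx : csol g I h u v hx ux vx ->
  forall t x, I t -> (forall i, riem g h u v i t x = 0) -> speed g h t x = 1.
Proof.
  intros HS t x It Hz. unfold speed.
  destruct (riem_zero_out g h u v t x) as [-> _]; auto; [apply HS; auto|].
  unfold Rpower. rewrite ln_1, Rmult_0_r, exp_0; auto.
Qed.

(** * Bounds common to all extensions of the given solution *)

Section Main.
Variables (g K0 c0 W Tp : R) (h u v : R -> R -> R).
Hypothesis Hg : 1 <= g.
Hypothesis HTp : 0 <= Tp.
Hypothesis Hsol : csolD g (fun t => 0 <= t <= Tp) h u v.
Hypothesis Hsupp : forall x, K0 < Rabs x -> h 0 x = 1 /\ u 0 x = 0 /\ v 0 x = 0.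
Hypothesis Hc0 : 0 < c0.
Hypothesis Hc0h : forall x, c0 <= h 0 x.
Hypothesis HW0 : 0 < W.
Hypothesis HW : forall x, / h 0 x + pdx v 0 x <= W.
Hypothesis Hmin : exists i x, i <> Still /\ ZD g h u v i Tp x <= - sqrt (2 * W).

Definition Good (s : state4) := Tp <= tm s /\ csolD g (fun t => 0 <= t <= tm s) (ch s) (cu s) (cv s) /\
  forall t x, 0 <= t <= Tp -> ch s t x = h t x /\ cu s t x = u t x /\ cv s t x = v t x.

Definition sinit : state4 := (Tp, h, u, v).

Lemma Good_init : Good sinit.
Proof. split; [apply Rle_refl|split; auto]. Qed.

Definition sZ (s : state4) := ZD g (ch s) (cu s) (cv s).

Lemma Good_at s t i x : Good s -> 0 <= t <= Tp -> 
  riem g (ch s) (cu s) (cv s) i t x = riem g h u v i t x /\ sZ s i t x = ZD g h u v i t x /\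
  pdx (cv s) t x = pdx v t x.
Proof.
  intros [_ [_ H]] Ht.
  assert (Eh : forall y, ch s t y = h t y) by (intros; apply H; auto).
  assert (Eu : forall y, cu s t y = u t y) by (intros; apply H; auto).
  assert (Ev : forall y, cv s t y = v t y) by (intros; apply H; auto).
  assert (Dh := pdx_ext _ _ _ Eh). assert (Du := pdx_ext _ _ _ Eu). assert (Dv := pdx_ext _ _ _ Ev).
  split; [|split]; auto.
  - destruct i; simpl; rewrite ?Eh, ?Eu, ?Ev; auto.
  - unfold sZ, ZD, Zw, riemx. destruct i; rewrite ?Eh, ?Dh, ?Du, ?Dv; auto.
Qed.

Lemma Good_out s t x : Good s -> 0 <= t <= tm s -> K0 + 2 * tm s < Rabs x ->
  ch s t x = 1 /\ cu s t x = 0 /\ cv s t x = 0.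
Proof.
  intros HG Ht Hx. assert (HG' := HG). destruct HG' as [HT [HS HE]].
  assert (HD := csol_dsol _ _ _ _ _ _ _ _ HS).
  apply (riem_zero_out g); [apply HS; auto|]. intros i.
  apply (finite_propagation (tm s) (speed g (ch s)) _ _ ltac:(lra) HD) with (M0 := K0); auto.
  - apply cont_on_speed with (1 := HS).
  - apply (speed_at_rest _ _ _ _ _ _ _ _ HS).
  - intros y j Hy. rewrite (proj1 (Good_at s 0 j y HG ltac:(lra))).
    destruct (Hsupp y Hy) as [E1 [E2 E3]]. destruct j; simpl; rewrite ?E1, ?E2, ?E3, ?phi_1; ring.
  - lra.
Qed.

(** The degenerate strip [[0, 0]] lets the boundedness lemmas for strips deliver bounds at time 0
    alone. *)
Lemma init_bounds : exists m b Wb, 0 <= m /\ (forall x, norm3 (fun i => riem g h u v i 0 x) <= m) /\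
  sqrt (2 * W) <= b /\ (forall i x, i <> Still -> ZD g h u v i 0 x <= b) /\
  (forall x, Rabs (/ h 0 x + pdx v 0 x) <= Wb).
Proof.
  assert (HS : csolD g (fun t => 0 <= t <= 0) h u v).
  { revert Hsol; apply csol_sub. intros; lra. }
  assert (Ho : forall t x, 0 <= t <= 0 -> K0 < Rabs x -> h t x = 1 /\ u t x = 0 /\ v t x = 0).
  { intros t x Ht. replace t with 0 by lra. apply Hsupp. }
  assert (I0 : 0 <= 0 <= 0) by lra.
  assert (CR : forall i, CK 0 K0 (riem g h u v i)).
  { intros i. split; [apply (csol_dsol _ _ _ _ _ _ _ _ HS i)|]. exists 0. intros t x Ht Hx.
    destruct (Ho t x Ht Hx) as [E1 [E2 E3]]. destruct i; simpl; rewrite ?E1, ?E2, ?E3, ?phi_1; ring. }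
  assert (CZ : forall i, CK 0 K0 (ZD g h u v i)) by (intros; eapply CK_Zw; eauto).
  assert (CO : CK 0 K0 (fun t x => / h t x + pdx v t x)).
  { apply CK_plus.
    - apply (CK_comp 0 K0 (fun z => / z)); [|eapply CK_h; eauto].
      intros t x Ht. apply ex_derive_cont.
      assert (0 < h t x) by (apply HS; auto). auto_derive; lra.
    - apply (CK_hx_ux_vx 0 K0 g h u v _ _ _ HS Ho). }
  assert (R0 := Rle_refl 0).
  destruct (CK_bdd 0 K0 R0 _ (CR Fwd)) as [m1 H1]. destruct (CK_bdd 0 K0 R0 _ (CR Bwd)) as [m2 H2].
  destruct (CK_bdd 0 K0 R0 _ (CR Still)) as [m3 H3].
  destruct (CK_bdd 0 K0 R0 _ (CZ Fwd)) as [z1 Z1]. destruct (CK_bdd 0 K0 R0 _ (CZ Bwd)) as [z2 Z2].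
  destruct (CK_bdd 0 K0 R0 _ CO) as [Wb HWb].
  exists (Rabs m1 + Rabs m2 + Rabs m3), (Rabs z1 + Rabs z2 + sqrt (2 * W)), Wb.
  assert (Q1 := Rle_abs m1). assert (Q2 := Rle_abs m2). assert (Q3 := Rle_abs m3).
  assert (Q4 := Rle_abs z1). assert (Q5 := Rle_abs z2).
  assert (P1 := Rabs_pos m1). assert (P2 := Rabs_pos m2). assert (P3 := Rabs_pos m3).
  assert (P4 := Rabs_pos z1). assert (P5 := Rabs_pos z2). assert (P6 := sqrt_pos (2 * W)).
  split; [lra|]. split; [|split; [lra|split; [|intros; apply HWb; auto]]].
  - intros x. destruct (norm3_att (fun i => riem g h u v i 0 x)) as [i ->].
    specialize (H1 0 x I0). specialize (H2 0 x I0). specialize (H3 0 x I0). destruct i; lra.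
  - intros i x Hi. specialize (Z1 0 x I0). specialize (Z2 0 x I0).
    apply Rabs_le_iff in Z1, Z2. destruct i; [lra|lra|congruence].
Qed.

Variables (m b Wb : R).
Hypothesis Hm0 : 0 <= m.
Hypothesis Hm : forall x, norm3 (fun i => riem g h u v i 0 x) <= m.
Hypothesis Hb : sqrt (2 * W) <= b.
Hypothesis HbZ : forall i x, i <> Still -> ZD g h u v i 0 x <= b.
Hypothesis HWb : forall x, Rabs (/ h 0 x + pdx v 0 x) <= Wb.

Definition pp := / sqrt c0.
Definition qq := b / 2.
Definition Ah T := m * exp (2 * T).
(** [phi h] is half the difference of two invariants, each bounded by [Ah T]; the bound on [h]
    follows by inverting [phi]. *)
Definition Mh T := hinv g (Ah T).

Lemma b_pos : 0 < b.
Proof. apply Rlt_le_trans with (sqrt (2 * W)); auto. apply sqrt_lt_R0; lra. Qed.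

Lemma pp_pos : 0 < pp.
Proof. apply Rinv_0_lt_compat, sqrt_lt_R0; auto. Qed.

Lemma qq_pos : 0 < qq.
Proof. unfold qq; generalize b_pos; lra. Qed.

Lemma Good_norm s t x : Good s -> 0 <= t <= tm s ->
  norm3 (fun i => riem g (ch s) (cu s) (cv s) i t x) <= Ah t.
Proof.
  intros HG Ht. assert (HG' := HG). destruct HG' as [HT [HS HE]].
  apply (global_bound (tm s) (speed g (ch s)) _ (riemx g (ch s) (pdx (ch s)) (pdx (cu s)) (pdx (cv s)))) with (M0 := K0); auto.
  - lra.
  - apply csol_dsol; auto.
  - apply cont_on_speed with (1 := HS).
  - apply (speed_at_rest _ _ _ _ _ _ _ _ HS).
  - intros y j Hy. rewrite (proj1 (Good_at s 0 j y HG ltac:(lra))).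
    destruct (Hsupp y Hy) as [E1 [E2 E3]]. destruct j; simpl; rewrite ?E1, ?E2, ?E3, ?phi_1; ring.
  - intros y. destruct (norm3_att (fun i => riem g (ch s) (cu s) (cv s) i 0 y)) as [i ->].
    rewrite (proj1 (Good_at s 0 i y HG ltac:(lra))).
    eapply Rle_trans; [apply (norm3_le (fun i => riem g h u v i 0 y))|apply Hm].
Qed.

Lemma Ah_mono t T : t <= T -> Ah t <= Ah T.
Proof.
  intros H. apply Rmult_le_compat_l; auto. destruct (Req_dec t T) as [->|]; [lra|].
  left; apply exp_increasing; lra.
Qed.

Lemma Good_riem s t x T i : Good s -> 0 <= t <= tm s -> t <= T ->
  Rabs (riem g (ch s) (cu s) (cv s) i t x) <= Ah T.
Proof.
  intros HG Ht HT. eapply Rle_trans; [apply (norm3_le (fun i => riem g (ch s) (cu s) (cv s) i t x))|].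
  eapply Rle_trans; [apply Good_norm; auto|apply Ah_mono; auto].
Qed.

Lemma Good_hle s t x T : Good s -> 0 <= t <= tm s -> t <= T -> ch s t x <= Mh T.
Proof.
  intros HG Ht HT. assert (H1 := Good_riem s t x T Fwd HG Ht HT). assert (H2 := Good_riem s t x T Bwd HG Ht HT).
  simpl in H1, H2. apply Rabs_le_iff in H1, H2.
  assert (0 <= Ah T) by (apply Rmult_le_pos; [auto|left; apply exp_pos]).
  apply (phi_le_inv g); [apply hinv_pos| |apply HG; auto].
  unfold Mh. rewrite phi_hinv by (apply inrange_pos; auto). lra.
Qed.

Lemma Good_omega s t x : Good s -> 0 <= t <= tm s ->
  / ch s t x + pdx (cv s) t x = / h 0 x + pdx v 0 x.
Proof.
  intros HG Ht. assert (HG' := HG). destruct HG' as [HT [HS HE]].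
  rewrite (omega_const (tm s) (K0 + 2 * tm s) ltac:(lra) g _ _ _ _ _ _ HS (fun t x Ht Hx => Good_out s t x HG Ht Hx)) by auto.
  rewrite (proj2 (proj2 (Good_at s 0 Fwd x HG ltac:(lra)))).
  destruct (HE 0 x ltac:(lra)) as [-> _]. auto.
Qed.

Lemma Good_W s t x : Good s -> 0 <= t <= tm s -> / ch s t x + pdx (cv s) t x <= W.
Proof. intros HG Ht. rewrite Good_omega; auto. Qed.

Lemma Good_upper s t x i : Good s -> 0 <= t <= tm s -> i <> Still -> sZ s i t x <= b.
Proof.
  intros HG Ht Hi. assert (HG' := HG). destruct HG' as [HT [HS HE]].
  apply (Z_upper (tm s) (K0 + 2 * tm s) g W (Mh (tm s)) (ch s) (cu s) (cv s)); auto; try lra.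
  - intros; apply Good_out; auto.
  - intros; apply Good_W; auto.
  - intros; apply Good_hle; auto; lra.
  - intros j y Hj. assert (E := proj1 (proj2 (Good_at s 0 j y HG ltac:(lra)))).
    unfold sZ, ZD in E. rewrite E. apply HbZ; auto.
Qed.

Lemma Good_lower s t x : Good s -> 0 <= t <= tm s -> / (pp + qq * t) <= sqrt (ch s t x).
Proof.
  intros HG Ht. assert (HG' := HG). destruct HG' as [HT [HS HE]].
  apply (h_lower (tm s) g _ _ _ _ _ _ HS); auto.
  - intros y. destruct (HE 0 y ltac:(lra)) as [-> _]. auto.
  - left; apply b_pos.
  - intros i r y Hi Hr. apply Good_upper; auto.
Qed.

Lemma Good_decline s t0 x0 i0 b0 : Good s -> i0 <> Still -> 0 <= t0 <= tm s -> sZ s i0 t0 x0 <= b0 ->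
  b0 <= - sqrt (2 * W) -> forall t eta, t0 <= t <= tm s -> 0 < eta ->
  exists x i, i <> Still /\ sZ s i t x <= b0 - / sqrt (Mh (tm s)) / 2 * (t - t0) + eta.
Proof.
  intros HG Hi0 Ht0 HZ Hb0 t eta Ht Heta. assert (HG' := HG). destruct HG' as [HT [HS HE]].
  apply (Z_decline (tm s) (K0 + 2 * tm s) g W (Mh (tm s)) (ch s) (cu s) (cv s)) with (x0 := x0) (i0 := i0); auto; try lra.
  - intros; apply Good_out; auto.
  - intros; apply Good_W; auto.
  - intros; apply Good_hle; auto; lra.
Qed.

Lemma Good_restrict s T1 : Good s -> Tp <= T1 <= tm s -> Good (T1, ch s, cu s, cv s).
Proof.
  intros [HT [HS HE]] H1. split; [unfold tm; simpl; lra|]. split; auto.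
  revert HS; apply csol_sub. intros t Ht. unfold tm in *; simpl in *; lra.
Qed.

Lemma Good_TM : exists TM, forall s, Good s -> tm s < TM.
Proof.
  (* In the unit of time after [Tp] the minimum falls by at least [g1 / 2 - g1 / 8 > g1 / 4], hence
     below [- n1]. The strict inequality [2 * W < n1^2] makes [k] positive, and [k] is such that
     [W = (/ 2 - k) * n1^2]. *)
  set (T1 := Tp + 1). set (g1 := / sqrt (Mh T1)).
  assert (G1 : 0 < g1) by (apply Rinv_0_lt_compat, sqrt_lt_R0, hinv_pos).
  assert (SW : 0 < sqrt (2 * W)) by (apply sqrt_lt_R0; lra).
  set (n1 := sqrt (2 * W) + g1 / 4).
  assert (Hn : 2 * W < n1 * n1).
  { rewrite <- (sqrt_sqrt (2 * W)) by lra. unfold n1. nra. }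
  set (k := / 2 - W / (n1 * n1)).
  assert (Ek : W / (n1 * n1) * (n1 * n1) = W) by (field; unfold n1; lra).
  assert (Hk : 0 < k < / 2).
  { unfold k. assert (0 < W / (n1 * n1)) by (apply Rdiv_lt_0_compat; lra).
    assert (W / (n1 * n1) < / 2); [|lra]. apply Rmult_lt_reg_r with (n1 * n1); lra. }
  exists (Rmax (T1 + 1) (((pp + qq * T1) * exp (qq / (k * n1)) - pp) / qq)).
  intros s HG. destruct (Rle_dec T1 (tm s)) as [Hle|Hgt].
  2:{ eapply Rlt_le_trans; [|apply Rmax_l]. lra. }
  eapply Rlt_le_trans; [|apply Rmax_r].
  destruct Hmin as [i0 [x0 [Hi0 Hx0]]].
  (* Restricting to [[0, T1]] makes the rate of decline depend on [Mh T1] and not on the final time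
     of [s]. *)
  assert (HGr := Good_restrict s T1 HG ltac:(unfold T1 in *; lra)).
  assert (E0 := proj1 (proj2 (Good_at _ Tp i0 x0 HGr ltac:(lra)))).
  destruct (Good_decline _ Tp x0 i0 (- sqrt (2 * W)) HGr Hi0) with (t := T1) (eta := g1 / 8) as [x [i [Hi Hx]]].
  { unfold tm; simpl; unfold T1; lra. }
  { rewrite E0; auto. }
  { lra. }
  { unfold tm; simpl; unfold T1; lra. }
  { lra. }
  change (sZ s i T1 x <= - sqrt (2 * W) - g1 / 2 * (T1 - Tp) + g1 / 8) in Hx.
  assert (HG' := HG). destruct HG' as [HT [HS HE]].
  apply (Z_blowup (tm s) (K0 + 2 * tm s) g W (Mh (tm s)) (ch s) (cu s) (cv s) (pdx (ch s)) (pdx (cu s)) (pdx (cv s)))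
    with (x0 := x) (i0 := i); auto; try lra.
  - intros; apply Good_out; auto.
  - intros; apply Good_W; auto.
  - intros; apply Good_hle; auto; lra.
  - unfold T1 in *; lra.
  - change (sZ s i T1 x < - n1). unfold n1, T1 in *. lra.
  - unfold n1; lra.
  - apply pp_pos.
  - apply qq_pos.
  - unfold k. replace (/ 2 - (/ 2 - W / (n1 * n1))) with (W / (n1 * n1)) by ring. lra.
  - intros; apply Good_lower; auto.
Qed.

(** The step [tau] depends on [N] alone, because every other norm entering local existence is
    bounded in terms of the data and of [TM]. *)
Lemma Good_step N : 0 <= N -> exists tau, 0 < tau /\ forall s, Good s ->
  (forall i x, i <> Still -> - N <= sZ s i (tm s) x) ->
  exists s', Good s' /\ extends s s' /\ tm s' = tm s + tau.
Proof.
  intros HN. destruct Good_TM as [TM HTM].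
  assert (HTM0 : Tp < TM) by (apply (HTM sinit Good_init)).
  assert (PP := pp_pos). assert (QQ := qq_pos). assert (BP := b_pos).
  set (w := pp + qq * TM). assert (Hw : 0 < w) by (unfold w; nra).
  set (c := / w * / w).
  assert (Hiw : 0 < / w) by (apply Rinv_0_lt_compat; auto).
  assert (Hc : 0 < c) by (unfold c; nra).
  assert (HAh : 0 <= Ah TM) by (apply Rmult_le_pos; [auto|left; apply exp_pos]).
  assert (HWb0 : 0 <= Wb) by (eapply Rle_trans; [apply Rabs_pos|apply (HWb 0)]).
  (* The three summands bound the invariants, their derivatives [Z / sqrt h] with [sqrt h >= / w],
     and [v_x = omega - 1 / h] with [1 / h <= w^2]. *)
  set (B := Ah TM + (b + N) * w + (Wb + w * w)).
  assert (HbN : 0 <= (b + N) * w) by nra.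
  destruct (extension g c (Rmax (Mh TM) c) B Hg Hc (Rmax_r _ _) ltac:(unfold B; nra)) as [tau [Htau HE]].
  exists tau; split; auto. intros s HG HZ.
  assert (HG' := HG). destruct HG' as [HT [HS HEq]].
  assert (Hts := HTM s HG). assert (Its : 0 <= tm s <= tm s) by lra.
  assert (Hlow : forall x, / w <= sqrt (ch s (tm s) x)).
  { intros x. eapply Rle_trans; [|apply Good_lower; auto]. apply Rinv_le_contravar; [nra|]. unfold w; nra. }
  assert (Hpos : forall x, 0 < ch s (tm s) x) by (intros; apply HS; auto).
  assert (Hcl : forall x, c <= ch s (tm s) x).
  { intros x. rewrite <- (sqrt_sqrt (ch s (tm s) x)) by (left; apply Hpos). specialize (Hlow x). unfold c; nra. }
  destruct (HE (tm s) (K0 + 2 * tm s) (ch s) (cu s) (cv s) (pdx (ch s)) (pdx (cu s)) (pdx (cv s)) tau)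
    as [H [U [V [Hx [Ux [Vx [HS2 HA]]]]]]]; auto; try lra.
  - intros; apply Good_out; auto.
  - intros x; split; auto. eapply Rle_trans; [apply (Good_hle s _ x TM); auto; lra|apply Rmax_l].
  - intros i x. eapply Rle_trans; [apply (Good_riem s _ x TM); auto; lra|]. unfold B; nra.
  - intros i x.
    assert (HPM : i <> Still -> Rabs (riemx g (ch s) (pdx (ch s)) (pdx (cu s)) (pdx (cv s)) i (tm s) x) <= (b + N) * w).
    { intros Hi. assert (Z1 := HZ i x Hi). assert (Z2 := Good_upper s (tm s) x i HG Its Hi).
      unfold sZ, ZD, Zw in Z1, Z2. specialize (Hlow x).
      set (sq := sqrt (ch s (tm s) x)) in *. set (R1 := riemx _ _ _ _ _ _ _ _) in *.
      assert (HX : Rabs (sq * R1) <= b + N) by (apply Rabs_le_iff; lra).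
      rewrite Rabs_mult, (Rabs_right sq) in HX by lra.
      assert (/ w * Rabs R1 <= b + N).
      { eapply Rle_trans; [|apply HX]. apply Rmult_le_compat_r; [apply Rabs_pos|auto]. }
      replace (Rabs R1) with (/ w * Rabs R1 * w) by (field; lra). apply Rmult_le_compat_r; lra. }
    destruct i.
    + eapply Rle_trans; [apply HPM; discriminate|unfold B; nra].
    + eapply Rle_trans; [apply HPM; discriminate|unfold B; nra].
    + simpl. assert (Ho := Good_omega s (tm s) x HG Its). specialize (HWb x). rewrite <- Ho in HWb.
      assert (/ ch s (tm s) x <= w * w).
      { replace (w * w) with (/ c) by (unfold c; field; lra). apply Rinv_le_contravar; auto. }
      assert (0 < / ch s (tm s) x) by (apply Rinv_0_lt_compat; auto).
      apply Rabs_le_iff in HWb. apply Rabs_le_iff. unfold B; lra.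
  - exists (tm s + tau, H, U, V). split; [|split].
    + split; [change (Tp <= tm s + tau); lra|]. split; [eapply csol_csolD; apply HS2|].
      intros t x Ht. destruct (HA t x ltac:(lra)) as [E1 [E2 E3]]. simpl.
      unfold ch, cu, cv; simpl. rewrite E1, E2, E3. apply HEq; auto.
    + split; [change (tm s <= tm s + tau); lra|]. intros t x Ht. apply HA; auto.
    + reflexivity.
Qed.

Lemma Good_bounded_below s : Good s -> exists N, 0 <= N /\ forall i x, i <> Still -> - N <= sZ s i (tm s) x.
Proof.
  intros HG. assert (HG' := HG). destruct HG' as [HT [HS HEq]].
  assert (HTs : 0 <= tm s) by lra.
  assert (HO : forall t x, 0 <= t <= tm s -> K0 + 2 * tm s < Rabs x -> ch s t x = 1 /\ cu s t x = 0 /\ cv s t x = 0)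
    by (intros; apply Good_out; auto).
  assert (CZ : forall i, CK (tm s) (K0 + 2 * tm s) (sZ s i)) by (intros; eapply CK_Zw; eauto).
  destruct (CK_bdd _ _ HTs _ (CZ Fwd)) as [n1 H1]. destruct (CK_bdd _ _ HTs _ (CZ Bwd)) as [n2 H2].
  exists (Rabs n1 + Rabs n2). assert (P1 := Rabs_pos n1). assert (P2 := Rabs_pos n2).
  assert (Q1 := Rle_abs n1). assert (Q2 := Rle_abs n2).
  split; [lra|]. intros i x Hi.
  specialize (H1 (tm s) x ltac:(lra)). specialize (H2 (tm s) x ltac:(lra)).
  apply Rabs_le_iff in H1, H2. destruct i; [lra|lra|congruence].
Qed.

Lemma ZD_ext h1 u1 v1 h2 u2 v2 t : (forall x, h1 t x = h2 t x /\ u1 t x = u2 t x /\ v1 t x = v2 t x) ->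
  forall i x, ZD g h1 u1 v1 i t x = ZD g h2 u2 v2 i t x.
Proof.
  intros H i x.
  assert (Eh : forall y, h1 t y = h2 t y) by (intros; apply H).
  assert (Eu : forall y, u1 t y = u2 t y) by (intros; apply H).
  assert (Ev : forall y, v1 t y = v2 t y) by (intros; apply H).
  unfold ZD, Zw, riemx. rewrite (pdx_ext _ _ _ Eh), (pdx_ext _ _ _ Eu), (pdx_ext _ _ _ Ev), Eh.
  destruct i; auto.
Qed.

Lemma blowup : exists Ts H U V, Tp < Ts /\ csolD g (fun t => 0 <= t < Ts) H U V /\
  (forall t x, 0 <= t <= Tp -> H t x = h t x /\ U t x = u t x /\ V t x = v t x) /\
  (exists c, 0 < c /\ forall t x, 0 <= t < Ts -> c <= H t x) /\
  (exists B, forall t x, 0 <= t < Ts -> H t x <= B /\ Rabs (U t x) <= B /\ Rabs (V t x) <= B) /\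
  (forall i t x, i <> Still -> 0 <= t < Ts -> ZD g H U V i t x <= b) /\
  (forall L, exists d, 0 < d /\ forall t, 0 <= t < Ts -> Ts - d < t -> exists i x, i <> Still /\ ZD g H U V i t x < L).
Proof.
  destruct Good_TM as [TM HTM].
  destruct (greedy_chain Good TM sinit Good_init HTM) as [q [Hq0 Hq]].
  { intros s HG. destruct (Good_bounded_below s HG) as [N [HN HZ]].
    destruct (Good_step N HN) as [tau [Htau Hst]]. destruct (Hst s HG HZ) as [s' [G [X E]]].
    exists s'. split; [auto|split; [auto|lra]]. }
  assert (HG : forall n, Good (q n)) by (intros; apply Hq).
  destruct (chain_union q TM) as [Ts [H [U [V [HTs [Hlt [Hex HA]]]]]]].
  { intros n; split; apply Hq. }
  { intros; apply HTM, HG. }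
  assert (Htp : forall n, Tp <= tm (q n)) by (intros n; apply (HG n)).
  assert (HZ : forall n i t x, 0 <= t <= tm (q n) -> ZD g H U V i t x = sZ (q n) i t x).
  { intros n i t x Ht. apply ZD_ext. intros; apply HA; auto. }
  assert (PP := pp_pos). assert (QQ := qq_pos).
  assert (TpTs : Tp < Ts) by (generalize (Hlt 0%nat) (Htp 0%nat); lra).
  exists Ts, H, U, V. split; [auto|]. split; [|split; [|split; [|split; [|split]]]].
  - apply csolD_local. intros t Ht. destruct (Hex t ltac:(lra)) as [n Hn].
    exists (fun s => 0 <= s <= tm (q n)), (tm (q n) - t). split; [lra|]. split; [lra|]. split.
    + intros s Hs Hst. apply Rabs_def2 in Hst. lra.
    + apply (csolD_ext g _ (ch (q n)) (cu (q n)) (cv (q n))); [|apply (HG n)].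
      intros s x Hs. destruct (HA n s x Hs) as [-> [-> ->]]; auto.
  - intros t x Ht. destruct (HA 0%nat t x) as [-> [-> ->]]; [generalize (Htp 0%nat); lra|].
    rewrite Hq0; auto.
  - set (w := pp + qq * Ts). assert (Hw : 0 < w) by (unfold w; nra).
    exists (/ w * / w). assert (Hiw : 0 < / w) by (apply Rinv_0_lt_compat; auto). split; [nra|].
    intros t x Ht. destruct (Hex t ltac:(lra)) as [n Hn]. destruct (HA n t x ltac:(lra)) as [-> _].
    assert (L1 := Good_lower (q n) t x (HG n) ltac:(lra)).
    assert (/ w <= / (pp + qq * t)) by (apply Rinv_le_contravar; unfold w; nra).
    rewrite <- (sqrt_sqrt (ch (q n) t x)); [nra|]. left; apply (HG n); lra.
  - exists (Rmax (Mh Ts) (Ah Ts)). intros t x Ht. destruct (Hex t ltac:(lra)) as [n Hn].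
    destruct (HA n t x ltac:(lra)) as [-> [-> ->]].
    split; [|split].
    + eapply Rle_trans; [apply (Good_hle (q n) t x Ts); auto; lra|apply Rmax_l].
    + assert (K1 := Good_riem (q n) t x Ts Fwd (HG n) ltac:(lra) ltac:(lra)).
      assert (K2 := Good_riem (q n) t x Ts Bwd (HG n) ltac:(lra) ltac:(lra)).
      simpl in K1, K2. apply Rabs_le_iff in K1, K2.
      eapply Rle_trans; [|apply Rmax_r]. apply Rabs_le_iff; lra.
    + eapply Rle_trans; [apply (Good_riem (q n) t x Ts Still); auto; lra|apply Rmax_r].
  - intros i t x Hi Ht. destruct (Hex t ltac:(lra)) as [n Hn]. rewrite (HZ n) by lra.
    apply Good_upper; auto; lra.
  (* [- sqrt (2 * W)] makes [Good_decline] applicable from level [L']; the extra 1 absorbs its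
     error, taken as [/ 2]. *)
  - intros L. set (L' := Rmin L (- sqrt (2 * W)) - 1).
    rmin_bounds L (- sqrt (2 * W)).
    (* Otherwise a step of length [tau] would be possible from every [q n], so the chain would
       advance by at least [tau / 2] each time and pass [TM]. *)
    assert (Hn : exists n i x, i <> Still /\ sZ (q n) i (tm (q n)) x <= L').
    { apply NNPP; intros Hno.
      assert (HL' : 0 <= - L') by (generalize (sqrt_pos (2 * W)); unfold L'; lra).
      destruct (Good_step (- L') HL') as [tau [Htau Hst]].
      assert (Hgrow : forall n, tm (q n) + tau / 2 <= tm (q (S n))).
      { intros n. destruct (Hst (q n) (HG n)) as [s' [G [X E]]].
        - intros i x Hi. apply Rnot_lt_le; intros Hl. apply Hno. exists n, i, x. split; auto. lra.
        - destruct (Hq n) as [_ [_ [_ Hmax]]]. specialize (Hmax s' G X). lra. }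
      assert (Hlin : forall n, INR n * (tau / 2) <= tm (q n)).
      { induction n; [simpl; generalize (Htp 0%nat); lra|]. rewrite S_INR. specialize (Hgrow n). lra. }
      destruct (nfloor_ex (Rmax 0 (2 * TM / tau)) (Rmax_l _ _)) as [n [_ Hn2]].
      specialize (Hlin (S n)). rewrite S_INR in Hlin.
      assert (2 * TM / tau < INR n + 1) by (eapply Rle_lt_trans; [apply Rmax_r|exact Hn2]).
      assert (2 * TM / tau * (tau / 2) = TM) by (field; lra).
      assert (2 * TM / tau * (tau / 2) < (INR n + 1) * (tau / 2)) by (apply Rmult_lt_compat_r; lra).
      specialize (HTM (q (S n)) (HG (S n))). lra. }
    destruct Hn as [n [i [x [Hi Hx]]]].
    exists (Ts - tm (q n)). split; [generalize (Hlt n); lra|]. intros t Ht Htn.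
    destruct (Hex t ltac:(lra)) as [k Hk].
    assert (Htpn := Htp n).
    assert (E1 : sZ (q k) i (tm (q n)) x <= L') by (rewrite <- HZ, (HZ n) by lra; auto).
    (* Once at or below [L'] the minimum stays below [L] at all later times, which gives a limit and
       not only a lower limit. *)
    destruct (Good_decline (q k) (tm (q n)) x i L' (HG k) Hi ltac:(lra) E1 ltac:(unfold L'; lra) t (/ 2) ltac:(lra) ltac:(lra))
      as [y [j [Hj Hy]]].
    exists j, y. split; auto. rewrite (HZ k) by lra.
    assert (0 < / sqrt (Mh (tm (q k)))) by (apply Rinv_0_lt_compat, sqrt_lt_R0, hinv_pos).
    assert (0 <= / sqrt (Mh (tm (q k))) / 2 * (t - tm (q n))) by (apply Rmult_le_pos; lra).
    unfold L' in Hy; lra.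
Qed.
End Main.

(** * Translation into the quantities of the statement *)

Lemma minZ_ZD g h u v t x : minZ g h u t x = Rmin (ZD g h u v Bwd t x) (ZD g h u v Fwd t x).
Proof. unfold minZ. destruct (Zj_ZD g h u v t x) as [-> ->]; auto. Qed.

Lemma minZ_le g h u v t x i : i <> Still -> minZ g h u t x <= ZD g h u v i t x.
Proof.
  intros Hi. rewrite (minZ_ZD g h u v). destruct i; [apply Rmin_r|apply Rmin_l|congruence].
Qed.

Lemma infZ_le g h u t x : Rbar_le (infZ g h u t) (minZ g h u t x).
Proof. unfold infZ. apply (proj1 (Glb_Rbar_correct _)). exists x; auto. Qed.

(** [real] sends infinite values to 0; the bound [B] excludes [p_infty], and the value at [x]
    excludes [m_infty]. *)
Lemma omega0_sharp_ub h0 v0 B : (forall x, omega0 h0 v0 x <= B) ->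
  forall x, omega0 h0 v0 x <= omega0_sharp h0 v0.
Proof.
  intros HB x. unfold omega0_sharp. set (E := fun z => exists x, z = omega0 h0 v0 x).
  destruct (Lub_Rbar_correct E) as [H1 H2].
  assert (K1 : Rbar_le (omega0 h0 v0 x) (Lub_Rbar E)) by (apply H1; exists x; auto).
  assert (K2 : Rbar_le (Lub_Rbar E) B).
  { apply H2. intros z [y ->]. simpl; auto. }
  destruct (Lub_Rbar E); simpl in *; auto; contradiction.
Qed.

Theorem theorem1p1 (gamma T' : R) (h0 u0 v0 : R -> R) (h u v : R -> R -> R) :
  1 <= gamma -> 0 <= T' ->
  (* (h, u, v) is a classical solution on [0, T'] x R *)
  classical_sol gamma (fun t => 0 <= t <= T') h u v ->
  (* initial data *)
  (forall x, h 0 x = h0 x /\ u 0 x = u0 x /\ v 0 x = v0 x) ->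
  (exists c, 0 < c /\ forall x, c <= h0 x) ->
  C1_R (fun x => h0 x - 1) /\ compact_support (fun x => h0 x - 1) ->
  C1_R u0 /\ compact_support u0 ->
  C1_R v0 /\ compact_support v0 ->
  (* blow-up criterion at time T' *)
  Rbar_le (infZ gamma h u T') (Finite (- sqrt (2 * omega0_sharp h0 v0))) ->
  exists Ts : R, T' < Ts /\
  exists H U V : R -> R -> R,
    (* on [0, Ts) the solution exists classically and extends (h, u, v) *)
    classical_sol gamma (fun t => 0 <= t < Ts) H U V /\
    (forall t x, 0 <= t <= T' -> H t x = h t x /\ U t x = u t x /\ V t x = v t x) /\
    (exists c, 0 < c /\ forall t x, 0 <= t < Ts -> c <= H t x) /\
    (exists M, forall t x, 0 <= t < Ts ->
        H t x <= M /\ Rabs (U t x) <= M /\ Rabs (V t x) <= M) /\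
    (exists M, forall t x, 0 <= t < Ts ->
        Zj gamma 1 H U t x <= M /\ Zj gamma 2 H U t x <= M) /\
    (* lim_{t -> Ts-} inf_xi min_j Z_j(t, xi) = -oo *)
    (forall M : R, exists delta, 0 < delta /\
        forall t, 0 <= t < Ts -> Ts - delta < t ->
          Rbar_lt (infZ gamma H U t) (Finite M)).
Proof.
  intros Hg HT Hcs Hinit [c [Hc Hch]] [_ [K1 Hs1]] [_ [K2 Hs2]] [_ [K3 Hs3]] HZ.
  assert (Hg0 : gamma <> 0) by lra.
  destruct (proj1 (classical_csol gamma _ h u v Hg0) Hcs) as [hx [ux [vx Hcsol]]].
  apply csol_csolD in Hcsol.
  set (K := Rmax K1 (Rmax K2 K3)).
  assert (L1 : K1 <= K) by apply Rmax_l.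
  assert (L2 : K2 <= K) by (eapply Rle_trans; [apply Rmax_l|apply Rmax_r]).
  assert (L3 : K3 <= K) by (eapply Rle_trans; [apply Rmax_r|apply Rmax_r]).
  assert (Hsupp : forall x, K < Rabs x -> h 0 x = 1 /\ u 0 x = 0 /\ v 0 x = 0).
  { intros x Hx. destruct (Hinit x) as [-> [-> ->]].
    specialize (Hs1 x ltac:(lra)). specialize (Hs2 x ltac:(lra)). specialize (Hs3 x ltac:(lra)). lra. }
  set (W := omega0_sharp h0 v0) in *.
  destruct (init_bounds gamma K W T' h u v HT Hcsol Hsupp) as [m [b [Wb [Hm0 [Hm [Hb [HbZ HWb]]]]]]].
  assert (Hom : forall x, omega0 h0 v0 x = / h 0 x + pdx v 0 x).
  { intros x. unfold omega0, pdx. destruct (Hinit x) as [-> _]. f_equal.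
    apply Derive_ext. intros y. symmetry; apply Hinit. }
  assert (HW : forall x, / h 0 x + pdx v 0 x <= W).
  { intros x. rewrite <- Hom. apply omega0_sharp_ub with Wb. intros y. rewrite Hom.
    eapply Rle_trans; [apply Rle_abs|apply HWb]. }
  assert (HGood : Good gamma T' h u v (sinit T' h u v)) by (apply Good_init; auto).
  assert (Hout : forall t x, 0 <= t <= T' -> K + 2 * T' < Rabs x -> h t x = 1 /\ u t x = 0 /\ v t x = 0).
  { intros t x Ht Hx. apply (Good_out gamma K T' h u v HT Hsupp (sinit T' h u v) t x HGood Ht Hx). }
  (* Far out the data are at rest, where [omega = 1]; hence [W >= 1]. *)
  assert (HW0 : 0 < W).
  { set (x := Rabs K + 2 * T' + 1). assert (KK := Rle_abs K). assert (KP := Rabs_pos K).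
    assert (Hx : K + 2 * T' + / 2 < Rabs x) by (unfold x; rewrite Rabs_right; lra).
    destruct (Hsupp x ltac:(lra)) as [E _]. specialize (HW x). rewrite E, Rinv_1 in HW.
    assert (V0 : pdx v 0 x = 0).
    { apply (proj2 (CK_derive T' (K + 2 * T') v _ (pdx v) (proj1 (proj2 (proj2 Hcsol)))
        ltac:(exists 0; intros; apply Hout; auto))); lra. }
    lra. }
  (* The [Z_j] vanish far out, so the infimum is attained and the non-strict hypothesis passes to a
     point. *)
  assert (Hmin : exists i x, i <> Still /\ ZD gamma h u v i T' x <= - sqrt (2 * W)).
  { assert (CZ : forall i, CK T' (K + 2 * T') (fun t x => -1 * ZD gamma h u v i t x)).
    { intros i. apply (CK_mult _ _ (fun _ _ => -1)); [apply CK_const|].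
      apply (CK_Zw T' (K + 2 * T') gamma h u v _ _ _ Hcsol Hout). }
    destruct (CK_slice_max_pair T' (fun i t x => -1 * ZD gamma h u v i t x) (K + 2 * T') T' (CZ Fwd) (CZ Bwd)) as [i [x [Hi Hx]]];
      [lra|].
    exists i, x. split; auto. apply Rnot_lt_le; intros Hlt.
    assert (HL : Rbar_le (ZD gamma h u v i T' x) (infZ gamma h u T')).
    { apply (proj2 (Glb_Rbar_correct _)). intros z [y ->]. simpl. rewrite (minZ_ZD gamma h u v).
      generalize (Hx Fwd y ltac:(discriminate)) (Hx Bwd y ltac:(discriminate)); intros.
      apply Rmin_glb; lra. }
    generalize (Rbar_le_trans _ _ _ HL HZ). simpl. lra. }
  destruct (blowup gamma K c W T' h u v) with (m := m) (b := b) (Wb := Wb)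
    as [Ts [H [U [V [HTs [HS [HA [HB1 [HB2 [HB3 HB4]]]]]]]]]]; auto.
  { intros x. destruct (Hinit x) as [-> _]; auto. }
  exists Ts; split; auto. exists H, U, V.
  split; [apply classical_csol; auto; eexists _, _, _; apply HS|].
  split; [auto|split; [auto|split; [auto|split]]].
  - exists b. intros t x Ht. destruct (Zj_ZD gamma H U V t x) as [-> ->].
    split; apply HB3; auto; discriminate.
  - intros L. destruct (HB4 L) as [d [Hd Hlim]]. exists d; split; auto.
    intros t Ht Htd. destruct (Hlim t Ht Htd) as [i [x [Hi Hx]]].
    apply Rbar_le_lt_trans with (minZ gamma H U t x); [apply infZ_le|].
    simpl. eapply Rle_lt_trans; [apply (minZ_le gamma H U V t x i Hi)|auto].
Qed.
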